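(* Let $s\in(0,2]$, and let $\phi_0\in H^{s}(\mathbb{T})$ and $\psi_0\in H^{s-2}(\mathbb{T})$ be real-valued. Let $T_s\in(0,\infty]$ be the maximum existence time of the solution of the ''good'' Boussinesq equation $$z_{tt}+z_{xxxx}-z_{xx}-(z^2)_{xx}=0,\quad x\in\mathbb{T},\ t>0,\qquad z(0,x)=\phi_0(x),\quad z_t(0,x)=\psi_0(x).$$ Let $T<T_s$ and denote the unique solution with initial data $(\phi_0,\psi_0)$ by $(z,z_t)\in C([0,T],H^{s})\times C([0,T],H^{s-2})$. For a time step $\tau>0$, let $(z^n,z_t^n)$ be the numerical solution of the filtered Lie-Trotter splitting scheme with step $\tau$ defined in the context. Then there exist $\tau_0>0$ and a constant $C_T>0$, with $C_T$ independent of $\tau$ and $n$, such that for all $0<\tau\le\tau_0$ and all $n\in\mathbb{N}$ with $0<t_n=n\tau\le T$, $$\|z(t_n)-z^n\|_{L^2}+\|z_t(t_n)-z_t^n\|_{H^{-2}}\le C_T\,\tau^{s/2}.$$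
   Context: Here $\mathbb{T}=[-\pi,\pi]$ with periodic boundary conditions and $H^r=H^r(\mathbb{T})$. Operators. $\langle\partial_x^2\rangle:=(1+\partial_x^4)^{1/2}$ is the Fourier multiplier with symbol $\sqrt{1+k^4}$, $k\in\mathbb{Z}$; $\langle\partial_x^2\rangle^{-1}$ and $e^{it\langle\partial_x^2\rangle}$ are the Fourier multipliers with symbols $(1+k^4)^{-1/2}$ and $e^{it\sqrt{1+k^4}}$. For $\tau>0$, $\Pi_\tau$ is the Fourier projection onto frequencies $|k|\le\tau^{-1/2}$, i.e. $\Pi_\tau=\chi(-i\partial_x/\tau^{-1/2})$ with $\chi$ the characteristic function of $[-1,1]$. Notion of solution. With $u=z+\tfrac12-i\langle\partial_x^2\rangle^{-1}z_t$, the equation is equivalent to the first-order equation $$\partial_t u=i\langle\partial_x^2\rangle u-\tfrac{i}{4}\langle\partial_x^2\rangle^{-1}\big[2(u+\overline{u})+\partial_x^2(u+\overline{u})^2\big],\qquad u(0)=u_0:=\phi_0+\tfrac12-i\langle\partial_x^2\rangle^{-1}\psi_0\in H^s,$$ and $z=\tfrac12(u+\overline u)-\tfrac12$, $z_t=\tfrac i2\langle\partial_x^2\rangle(u-\overline u)$. Solutions are mild solutions, i.e. solutions of the corresponding Duhamel integral equation. For $s\ge 0$ this equation is locally well-posed: for some maximal $T_s\in(0,\infty]$ and every $T<T_s$ and $b\in(\frac12,1)$, there is a unique solution $u\in X^{s,b}(T)\subseteq C([0,T],H^s)$. Here $X^{s,b}(T)$ is the space of restrictions to $[0,T]$ of tempered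 distributions $v$ on $\mathbb{R}\times\mathbb{T}$ with $\|\langle k\rangle^s\langle\sigma-\sqrt{k^4+1}\rangle^b\,\widehat v(\sigma,k)\|_{l^2_kL^2_\sigma}<\infty$, where $\widehat v$ is the space-time Fourier transform and $\langle\cdot\rangle=\sqrt{1+|\cdot|^2}$. Numerical scheme. Define $$\varPhi^{\tau}(v)=e^{i\tau\langle\partial_x^2\rangle}\Pi_\tau\Big[v-\tfrac{i\tau}{2}\langle\partial_x^2\rangle^{-1}(v+\overline v)-\tfrac{i\tau}{4}\langle\partial_x^2\rangle^{-1}\partial_x^2(\Pi_\tau v+\Pi_\tau\overline v)^2\Big],$$ $u^0=\Pi_\tau u_0$, $u^{n+1}=\varPhi^\tau(u^n)$ for $n\ge0$, and $$z^n=\tfrac12(u^n+\overline{u^n})-\tfrac12,\qquad z^n_t=\tfrac i2\langle\partial_x^2\rangle(u^n-\overline{u^n}).$$ *)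

(* Defs.v *)
From HB Require Import structures.
From mathcomp Require Export all_boot all_order all_algebra.
From mathcomp Require Export complex.
From mathcomp Require Export all_classical all_reals all_analysis.
Export numFieldNormedType.Exports.
Export Order.TTheory GRing.Theory Num.Theory.

Set Implicit Arguments.
Unset Strict Implicit.
Unset Printing Implicit Defensive.

Local Open Scope classical_set_scope.
Local Open Scope ring_scope.
Local Open Scope complex_scope.

(* Conventions.  A function on the torus is a function R -> R[i], of which only
   the values on [-pi, pi] matter.  A periodic distribution is given by its
   Fourier coefficients, and a function f is viewed as a distribution through
   [fourier f].  Products of functions are always pointwise. *)

Definition torus (R : realType) : set R := `[- pi, pi].
Arguments torus : clear implicits.

Definition distr (R : realType) : Type := int -> R[i].

Definition expi (R : realType) (x : R) : R[i] := cos x +i* sin x.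

Definition cmeasurable (R : realType) (D : set R) (f : R -> R[i]) : Prop :=
  measurable_fun D (fun x => complex.Re (f x)) /\
  measurable_fun D (fun x => complex.Im (f x)).

Definition cintegral (R : realType) (D : set R) (f : R -> R[i]) : R[i] :=
  (\int[lebesgue_measure]_(x in D) complex.Re (f x)) +i*
  (\int[lebesgue_measure]_(x in D) complex.Im (f x)).

Definition fourier (R : realType) (f : R -> R[i]) : distr R := fun k =>
  ((2 * pi)^-1)%:C * cintegral (torus R) (fun x => f x * expi (- (k%:~R * x))).

(* The function with Fourier coefficients [a], for finitely supported [a] (the
   finitely supported sum below is 0 by convention when the support of [a] is
   infinite). *)
Definition trigpoly (R : realType) (a : distr R) : R -> R[i] := fun x =>
  \sum_(k \in [set: int]) (a k * expi (k%:~R * x)).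

(* Norms are extended-real-valued: +oo outside of the corresponding space. *)

Definition L2norm (R : realType) (f : R -> R[i]) : \bar R :=
  ((\int[lebesgue_measure]_(x in torus R) (Normc.normc (f x) ^+ 2)%:E) `^ 2^-1)%E.

Definition L2 (R : realType) (f : R -> R[i]) : Prop :=
  cmeasurable (torus R) f /\ (L2norm f < +oo)%E.

Definition jap (R : realType) (x : R) : R := Num.sqrt (1 + `|x| ^+ 2).

Definition Hnorm (R : realType) (r : R) (a : distr R) : \bar R :=
  ((\esum_(k in [set: int])
      (jap (k%:~R : R) `^ (2 * r) * Normc.normc (a k) ^+ 2)%:E) `^ 2^-1)%E.

Definition in_H (R : realType) (r : R) (a : distr R) : Prop :=
  (Hnorm r a < +oo)%E.

Definition fun_in_H (R : realType) (r : R) (f : R -> R[i]) : Prop :=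
  L2 f /\ in_H r (fourier f).

Definition real_distr (R : realType) (a : distr R) : Prop :=
  forall k : int, a (- k) = (a k)^*.

(* The symbol of <dx^2> = (1 + dx^4)^(1/2). *)
Definition omega (R : realType) (k : int) : R := Num.sqrt (1 + k%:~R ^+ 4).

Definition bdx2 (R : realType) (a : distr R) : distr R := fun k =>
  (omega R k)%:C * a k.

Definition bdx2_inv (R : realType) (a : distr R) : distr R := fun k =>
  ((omega R k)^-1)%:C * a k.

(* e^(i t <dx^2>) *)
Definition propag (R : realType) (t : R) (a : distr R) : distr R := fun k =>
  expi (t * omega R k) * a k.

Definition dx2 (R : realType) (a : distr R) : distr R := fun k =>
  - (k%:~R ^+ 2) * a k.

(* The projection Pi_tau. *)
Definition proj (R : realType) (tau : R) (a : distr R) : distr R := fun k =>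
  if `|k%:~R : R| <= tau `^ (- 2^-1) then a k else 0.

Definition fconj (R : realType) (v : R -> R[i]) : R -> R[i] := fun x => (v x)^*.

(* u_0 = phi_0 + 1/2 - i <dx^2>^-1 psi_0; [phi0] is only used through its
   Fourier coefficients since u_0 is a priori a distribution *)
Definition u_init (R : realType) (phi0 : R -> R) (psi0 : distr R) : distr R :=
  fun k => fourier (fun x => (phi0 x)%:C + 2^-1) k - 'i * bdx2_inv psi0 k.

(* z = (u + conj u) / 2 - 1/2 *)
Definition z_of (R : realType) (v : R -> R[i]) : R -> R[i] := fun x =>
  2^-1 * (v x + fconj v x) - 2^-1.

(* z_t = i/2 <dx^2> (u - conj u) *)
Definition zt_of (R : realType) (v : R -> R[i]) : distr R := fun k =>
  'i / 2 * bdx2 (fourier (fun x => v x - fconj v x)) k.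

(* - i/4 <dx^2>^-1 (2 (v + conj v) + dx^2 (v + conj v)^2) *)
Definition forcing (R : realType) (v : R -> R[i]) : distr R :=
  let w := fun x => v x + fconj v x in
  fun k => - ('i / 4) *
    bdx2_inv (fun j => 2 * fourier w j + dx2 (fourier (fun x => w x ^+ 2)) j) k.

Definition cont_in_H (R : realType) (s T : R) (u : R -> R -> R[i]) : Prop :=
  (forall t : R, 0 <= t <= T -> fun_in_H s (u t)) /\
  (forall t0 : R, 0 <= t0 <= T ->
    Hnorm s (fun k => fourier (u t) k - fourier (u t0) k)
      @[t --> within `[0, T] (nbhs t0)] --> 0%E).

(* u is the restriction to [0, T] of a distribution on R x torus with space-time
   Fourier transform V and finite X^(s,b) norm.  Finiteness of that norm forces
   the Fourier transform to be a measurable function, and, for b > 1/2,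
   V(., k) to be integrable, so that the restriction is given by the inversion
   formula and is (represented by) an element of C([0, T], H^s). *)
Definition in_Xsb (R : realType) (s b T : R) (u : R -> R -> R[i]) : Prop :=
  cont_in_H s T u /\
  exists V : int -> R -> R[i],
    [/\ forall k, cmeasurable [set: R] (V k),
        (\esum_(k in [set: int]) \int[lebesgue_measure]_sigma
           (jap (k%:~R : R) `^ (2 * s) * jap (sigma - omega R k) `^ (2 * b)
            * Normc.normc (V k sigma) ^+ 2)%:E < +oo)%E
      & forall t : R, 0 <= t <= T -> forall k,
          fourier (u t) k = ((2 * pi)^-1)%:C *
            cintegral [set: R] (fun sigma => V k sigma * expi (sigma * t))].

(* Duhamel's formula on [0, T], Fourier coefficient by Fourier coefficient *)
Definition duhamel (R : realType) (T : R) (u0 : distr R) (u : R -> R -> R[i])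
    : Prop :=
  forall t : R, 0 <= t <= T -> forall k : int,
    fourier (u t) k = propag t u0 k +
      cintegral `[0, t] (fun r => propag (t - r) (forcing (u r)) k).

Definition mild_solution (R : realType) (s b T : R) (u0 : distr R)
    (u : R -> R -> R[i]) : Prop :=
  in_Xsb s b T u /\ duhamel T u0 u.

Definition unique_solvable (R : realType) (s b T : R) (u0 : distr R) : Prop :=
  (exists u, mild_solution s b T u0 u) /\
  (forall u v, mild_solution s b T u0 u -> mild_solution s b T u0 v ->
     forall t : R, 0 <= t <= T ->
       u t = v t %[ae lebesgue_measure in torus R]).

Definition max_time (R : realType) (s : R) (u0 : distr R) : \bar R :=
  ereal_sup [set Tmax : \bar R | (0 < Tmax)%E /\
    forall T : R, 0 < T -> (T%:E < Tmax)%E ->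
    forall b : R, 2^-1 < b -> b < 1 -> unique_solvable s b T u0].

(* (z, z_t) is the solution on [0, T] of the good Boussinesq equation with
   initial data (phi0, psi0) *)
Definition gB_solution (R : realType) (s b T : R) (phi0 : R -> R)
    (psi0 : distr R) (z : R -> R -> R[i]) (zt : R -> distr R) : Prop :=
  exists u : R -> R -> R[i],
    mild_solution s b T (u_init phi0 psi0) u /\
    forall t : R, 0 <= t <= T -> z t = z_of (u t) /\ zt t = zt_of (u t).

Definition Phi (R : realType) (tau : R) (v : R -> R[i]) : R -> R[i] :=
  let w := fun x => v x + fconj v x in
  let wtau := fun x => trigpoly (proj tau (fourier v)) x
                     + trigpoly (proj tau (fourier (fconj v))) x in
  trigpoly (propag tau (proj tau (fun k =>
    fourier v k
    - 'i * tau%:C / 2 * bdx2_inv (fourier w) k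
    - 'i * tau%:C / 4 * bdx2_inv (dx2 (fourier (fun x => wtau x ^+ 2))) k))).

Definition num_sol (R : realType) (tau : R) (u0 : distr R) (n : nat)
    : R -> R[i] :=
  iter n (Phi tau) (trigpoly (proj tau u0)).

(* Main.v *)
(** Write [c_k(t) = exp(-i t omega_k) (u(t))^_k] and [d^n_k = exp(-i n tau omega_k) (u^n)^_k].
    In these variables the equation is [c' = F(t, c)] and the scheme is the truncated
    Euler step [d^(n+1) = Pi_tau (d^n + tau F(n tau, d^n))], where the quadratic part of
    [F] has coefficients [exp(-i t theta)].  Except when one of the frequencies
    [j], [k - j], [k] vanishes, [|theta|] is at least the product of two of them, so
    [1 / theta] is a Hilbert-Schmidt kernel.  Hence no Bourgain space is needed:
    summation by parts in time gains [1 / theta] on every non-resonant sum, at the price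
    of time increments, and bounds the errors made by truncating the frequencies, by
    discretizing time and by replacing [c] with [d] in [l2].  The Sobolev regularity
    enters through [min(1, tau |theta|) <= C tau^(s/2) <j>^s <k - j>^s] and through
    [1 <= tau^(s/2) <k>^s] for [tau k^2 > 1]; a discrete Gronwall lemma then concludes.

    To deal with finite sums only, the solution is sampled on a grid of step [tau / m]
    and truncated to [|k| <= L]: for [m] and [L] large it satisfies an explicit Euler
    scheme of step [tau / m] up to an arbitrarily small error.  The passage to and from
    functions is by Parseval's inequality, proved by approximating functions in [L^2] by
    trigonometric polynomials. *)

Require Import Defs.
From mathcomp Require Import measurable_realfun ring lra zify.

Set Implicit Arguments.
Unset Strict Implicit.
Unset Printing Implicit Defensive.

Local Open Scope classical_set_scope.
Local Open Scope ring_scope.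
Local Open Scope complex_scope.

(** The obstacle is that a product of two L2 functions has Fourier coefficients that are merely
    bounded, so the time increments of [c], and those of the error, are not small in [l2]. Two norms
    are therefore kept apart: sequences are measured in [l2], their time increments in the supremum
    norm. Summation by parts leaves increments of one factor times the other factor, a quantity in
    [l2] over [j] uniformly in [k]; pairing it with a Hilbert-Schmidt kernel is what produces [l2]
    over [k]. Dividing by [exp(-i tau theta) - 1] requires that the discrete phase stay away from
    the nonzero multiples of [2 pi]. The filter ensures this: if [tau n^2 <= 1] for the three
    frequencies [n] involved and [tau <= 1/3], then [|tau theta| <= 4 < 2 pi]. The fine grid obeys
    the same restriction with [h] in place of [tau], whence the condition [h L^2 <= 1]. The
    exceptional frequencies need no oscillation: for [k = 0] the multiplier of the quadratic term
    vanishes, and for [k != 0] only [j = 0] and [j = k] remain, two terms which are bounded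
    directly. *)

Local Notation nc := Normc.normc.

(** * Square-summable families and summation by parts *)

Section ComplexModulus.
Variable R : realType.
Implicit Types (z w : R[i]) (x y : R).

Lemma nc_ge0 z : 0 <= nc z.
Proof. by case: z => a b; rewrite /= sqrtr_ge0. Qed.

Lemma nc0 : nc (0 : R[i]) = 0.
Proof. by rewrite /= expr0n /= addr0 sqrtr0. Qed.

Lemma nc_conj z : nc z^*%C = nc z.
Proof. by case: z => a b; rewrite /= sqrrN. Qed.

Lemma nc_real x : nc x%:C = `|x|.
Proof. by rewrite /= expr0n /= addr0 sqrtr_sqr. Qed.

Lemma nc_sqr z : nc z ^+ 2 = complex.Re z ^+ 2 + complex.Im z ^+ 2.
Proof. by case: z => a b /=; rewrite sqr_sqrtr // addr_ge0 // sqr_ge0. Qed.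

Lemma nc_sub z w : nc (z - w) <= nc z + nc w.
Proof. by rewrite -(normcN w) le_normcD. Qed.

Lemma nc_distC z w : nc (z - w) = nc (w - z).
Proof. by rewrite -normcN opprB. Qed.

Lemma nc_sum (I : Type) (r : seq I) (P : pred I) (F : I -> R[i]) :
  nc (\sum_(i <- r | P i) F i) <= \sum_(i <- r | P i) nc (F i).
Proof.
elim/big_ind2 : _ => [|x1 x2 y1 y2 h1 h2|//]; first by rewrite nc0.
by apply: (le_trans (le_normcD _ _)); apply: lerD.
Qed.

Lemma nc_expr z n : nc (z ^+ n) = nc z ^+ n.
Proof.
elim: n => [|n IH]; first by rewrite !expr0 Normc.normc1.
by rewrite !exprS Normc.normcM IH.
Qed.

Lemma expi0 : expi 0 = 1 :> R[i].
Proof. by rewrite /expi cos0 sin0. Qed.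

Lemma expiD x y : expi (x + y) = expi x * expi y.
Proof. by rewrite /expi cosD sinD; congr (_ +i* _); rewrite addrC. Qed.

Lemma nc_expi x : nc (expi x) = 1.
Proof. by rewrite /expi /= cos2Dsin2 sqrtr1. Qed.

Lemma conj_expi x : (expi x)^*%C = expi (- x).
Proof. by rewrite /expi cosN sinN. Qed.

Lemma expiNl x : expi (- x) * expi x = 1.
Proof. by rewrite -expiD addNr expi0. Qed.

Lemma expiMn x n : expi (n%:R * x) = expi x ^+ n.
Proof.
elim: n => [|n IH]; first by rewrite mul0r expr0 expi0.
by rewrite -natr1 mulrDl mul1r expiD IH exprSr.
Qed.

End ComplexModulus.

Section SquareSummable.
Variable R : realType.

(** Bounding all finite sums over duplicate-free lists expresses that the [l2] norm is at most [F]
    without any infinite sum or limit. *)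
Definition l2le (I : eqType) (f : I -> R) (F : R) : Prop :=
  0 <= F /\ forall s : seq I, uniq s -> \sum_(i <- s) f i ^+ 2 <= F ^+ 2.

Lemma sum_cauchy_schwarz (I : Type) (s : seq I) (f g : I -> R) :
  (\sum_(i <- s) f i * g i) ^+ 2
    <= (\sum_(i <- s) f i ^+ 2) * (\sum_(i <- s) g i ^+ 2).
Proof.
elim: s => [|i s IH]; first by rewrite !big_nil expr0n mul0r.
rewrite !big_cons.
have SF : 0 <= \sum_(j <- s) f j ^+ 2 by apply: sumr_ge0 => j _; exact: sqr_ge0.
have SG : 0 <= \sum_(j <- s) g j ^+ 2 by apply: sumr_ge0 => j _; exact: sqr_ge0.
move: SF SG IH; set F := \sum_(j <- s) f j ^+ 2.
set G := \sum_(j <- s) g j ^+ 2; set H := \sum_(j <- s) _.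
move: (f i) (g i) => a b F0 G0 IH.
have X0 : 0 <= F * b ^+ 2 by rewrite mulr_ge0 // sqr_ge0.
have Y0 : 0 <= G * a ^+ 2 by rewrite mulr_ge0 // sqr_ge0.
(* From [H^2 <= F G], the left side is at most [4 (F b^2) (G a^2)], and the difference with the
   right side is a square. *)
have : (2 * (H * (a * b))) ^+ 2 <= (F * b ^+ 2 + G * a ^+ 2) ^+ 2.
  have Hab : H ^+ 2 * (a * b) ^+ 2 <= F * G * (a * b) ^+ 2.
    by rewrite ler_wpM2r // sqr_ge0.
  have := sqr_ge0 (F * b ^+ 2 - G * a ^+ 2).
  move: Hab; rewrite !expr2; lra.
rewrite -ler_sqrt ?sqr_ge0// !sqrtr_sqr (ger0_norm (addr_ge0 X0 Y0)) => h.
have := le_trans (ler_norm _) h.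
move: IH; rewrite !expr2; lra.
Qed.

Section Basics.
Variable I : eqType.
Implicit Types (f g : I -> R) (F G : R) (s : seq I).

Lemma l2le_ge0 f F : l2le f F -> 0 <= F.
Proof. by case. Qed.

Lemma l2le_mono f g F : (forall i, `|f i| <= `|g i|) -> l2le g F -> l2le f F.
Proof.
move=> fg [F0 gF]; split=> // s us; apply: le_trans (gF s us).
apply: ler_sum => i _; rewrite -(real_normK (num_real (f i))).
by rewrite -(real_normK (num_real (g i))) lerXn2r ?nnegrE.
Qed.

Lemma l2le_weak f F G : F <= G -> l2le f F -> l2le f G.
Proof.
move=> FG [F0 fF]; have G0 := le_trans F0 FG; split => // s us.
by apply: le_trans (fF s us) _; rewrite lerXn2r ?nnegrE.
Qed.

Lemma l2le_sup f F i : l2le f F -> `|f i| <= F.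
Proof.
move=> [F0 /(_ [:: i] isT)]; rewrite big_seq1.
by rewrite -ler_sqrt ?sqr_ge0// !sqrtr_sqr (ger0_norm F0).
Qed.

Lemma l2le0 F : 0 <= F -> l2le (fun _ : I => 0) F.
Proof.
by move=> F0; split=> // s _; rewrite big1 ?sqr_ge0// => i _; rewrite expr0n.
Qed.

Lemma l2le_cs f g F G s : l2le f F -> l2le g G -> uniq s ->
  \sum_(i <- s) `|f i| * `|g i| <= F * G.
Proof.
move=> [F0 fF] [G0 gG] us.
have S0 : 0 <= \sum_(i <- s) `|f i| * `|g i|.
  by apply: sumr_ge0 => i _; rewrite mulr_ge0.
rewrite -(ger0_norm S0) -(ger0_norm (mulr_ge0 F0 G0)) -!sqrtr_sqr.
rewrite ler_sqrt ?sqr_ge0//; apply: le_trans (sum_cauchy_schwarz _ _ _) _.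
under eq_bigr do rewrite real_normK ?num_real//.
under [X in _ * X]eq_bigr do rewrite real_normK ?num_real//.
rewrite exprMn; apply: ler_pM; try (by apply: sumr_ge0 => i _; exact: sqr_ge0).
  exact: fF.
exact: gG.
Qed.

Lemma l2leD f g F G : l2le f F -> l2le g G -> l2le (fun i => f i + g i) (F + G).
Proof.
move=> lf lg; have [F0 fF] := lf; have [G0 gG] := lg.
split=> [|s us]; first exact: addr_ge0.
have := l2le_cs lf lg us; have := fF s us; have := gG s us.
have -> : \sum_(i <- s) (f i + g i) ^+ 2 =
  \sum_(i <- s) f i ^+ 2 + 2 * (\sum_(i <- s) f i * g i)
  + \sum_(i <- s) g i ^+ 2.
  rewrite mulr_sumr -!big_split /=; apply: eq_bigr => i _; ring.
have : \sum_(i <- s) f i * g i <= \sum_(i <- s) `|f i| * `|g i|.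
  by apply: ler_sum => i _; rewrite -normrM ler_norm.
rewrite !expr2; lra.
Qed.

Lemma l2leZ f F c : l2le f F -> l2le (fun i => c * f i) (`|c| * F).
Proof.
move=> [F0 fF]; split=> [|s us]; first by rewrite mulr_ge0.
under eq_bigr do rewrite exprMn.
rewrite -mulr_sumr exprMn real_normK ?num_real//.
by rewrite ler_wpM2l ?sqr_ge0 ?fF.
Qed.

Lemma l2le_sum (T : Type) (r : seq T) (f : T -> I -> R) (F : T -> R) :
  (forall t, l2le (f t) (F t)) ->
  l2le (fun i => \sum_(t <- r) f t i) (\sum_(t <- r) F t).
Proof.
move=> fF; elim: r => [|t r IH].
  rewrite big_nil; apply: (@l2le_mono _ (fun _ => 0)); last exact: l2le0.
  by move=> i; rewrite big_nil.
rewrite big_cons; apply: (l2le_mono _ (l2leD (fF t) IH)) => i.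
by rewrite big_cons.
Qed.

Lemma l2leM f g F G : 0 <= G -> l2le f F -> (forall i, `|g i| <= G) ->
  l2le (fun i => f i * g i) (F * G).
Proof.
move=> G0 [F0 fF] gG; split=> [|s us]; first exact: mulr_ge0.
rewrite exprMn; apply: (@le_trans _ _ ((\sum_(i <- s) f i ^+ 2) * G ^+ 2)).
  rewrite mulr_suml; apply: ler_sum => i _; rewrite exprMn.
  rewrite ler_wpM2l ?sqr_ge0// -(real_normK (num_real (g i))).
  by rewrite lerXn2r ?nnegrE.
by rewrite ler_wpM2r ?sqr_ge0 ?fF.
Qed.

Lemma l2le_inj (J : eqType) (phi : J -> I) f F : injective phi ->
  l2le f F -> l2le (fun j => f (phi j)) F.
Proof.
move=> iphi [F0 fF]; split=> // s us.
by rewrite -(big_map phi predT (fun i => f i ^+ 2)) fF // map_inj_uniq.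
Qed.

End Basics.

Lemma l2le_sum_nat (I : eqType) n (f : nat -> I -> R) (F : nat -> R) :
  (forall t, (t < n)%N -> l2le (f t) (F t)) ->
  l2le (fun i => \sum_(t < n) f t i) (\sum_(t < n) F t).
Proof.
by move=> fF; apply: (@l2le_sum _ _ _ (fun t : 'I_n => f t) (fun t => F t)) => t;
  exact: fF.
Qed.

(** Cauchy-Schwarz in [j] for fixed [k] leaves [G^2] times the sum of [p (k, j)^2] over [j], and
    these sums add up to at most [P^2]. The family [g] has to be bounded only uniformly in [k]: all
    the summability in [k] comes from the kernel. *)
Lemma hilbert_schmidt (I J : eqType) (p : I * J -> R) (g : I -> J -> R)
    (P G : R) (s : seq J) :
  uniq s -> l2le p P -> 0 <= G -> (forall k, l2le (g k) G) ->
  l2le (fun k => \sum_(j <- s) `|p (k, j)| * `|g k j|) (P * G).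
Proof.
move=> us [P0 pP] G0 gG; split=> [|r ur]; first exact: mulr_ge0.
apply: (@le_trans _ _ (\sum_(k <- r) (\sum_(j <- s) p (k, j) ^+ 2) * G ^+ 2)).
  apply: ler_sum => k _; apply: le_trans (sum_cauchy_schwarz _ _ _) _.
  under eq_bigr do rewrite real_normK ?num_real//.
  apply: ler_wpM2l; first by apply: sumr_ge0 => j _; exact: sqr_ge0.
  under eq_bigr do rewrite real_normK ?num_real//.
  by have [_] := gG k; exact.
rewrite -mulr_suml exprMn ler_wpM2r ?sqr_ge0//.
have := pP [seq (k, j) | k <- r, j <- s] (allpairs_uniq ur us _).
rewrite big_allpairs; apply.
by move=> [a b] [c d] _ _ [-> ->].
Qed.

End SquareSummable.

Section Abel.
Variable R : realType.
Implicit Types (q : R[i]) (x : nat -> R[i]).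

Lemma abel_sum q x n : (q - 1) * (\sum_(i < n) q ^+ i * x i) =
  q ^+ n * x n - x 0%N - \sum_(i < n) q ^+ i.+1 * (x i.+1 - x i).
Proof.
elim: n => [|n IH]; first by rewrite !big_ord0 mulr0 expr0; ring.
by rewrite !big_ord_recr /= mulrDr IH !exprS; ring.
Qed.

(** One more term is summed, yet [x n.+1] does not occur: the last phase is charged to the boundary
    term. In the stability estimate this keeps the error at the current time out of the right-hand
    side. *)
Lemma abel_sumS q x n : (q - 1) * (\sum_(i < n.+1) q ^+ i * x i) =
  q ^+ n.+1 * x n - x 0%N - \sum_(i < n) q ^+ i.+1 * (x i.+1 - x i).
Proof. by rewrite big_ord_recr /= mulrDr abel_sum !exprS; ring. Qed.

Lemma nc_sum_unimod q x n : nc q = 1 ->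
  nc (\sum_(i < n) q ^+ i.+1 * (x i.+1 - x i))
    <= \sum_(i < n) nc (x i.+1 - x i).
Proof.
move=> q1; apply: le_trans (nc_sum _ _ _) _; apply: ler_sum => i _.
by rewrite Normc.normcM nc_expr q1 expr1n mul1r.
Qed.

Lemma abel_le q x n : nc q = 1 ->
  nc (q - 1) * nc (\sum_(i < n) q ^+ i * x i) <=
  nc (x n) + nc (x 0%N) + \sum_(i < n) nc (x i.+1 - x i).
Proof.
move=> q1; rewrite -Normc.normcM abel_sum.
apply: le_trans (nc_sub _ _) (lerD _ (nc_sum_unimod _ _ q1)).
apply: le_trans (nc_sub _ _) _.
by rewrite Normc.normcM nc_expr q1 expr1n mul1r.
Qed.

Lemma abel_leS q x n : nc q = 1 ->
  nc (q - 1) * nc (\sum_(i < n.+1) q ^+ i * x i) <=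
  nc (x n) + nc (x 0%N) + \sum_(i < n) nc (x i.+1 - x i).
Proof.
move=> q1; rewrite -Normc.normcM abel_sumS.
apply: le_trans (nc_sub _ _) (lerD _ (nc_sum_unimod _ _ q1)).
apply: le_trans (nc_sub _ _) _.
by rewrite Normc.normcM nc_expr q1 expr1n mul1r.
Qed.

End Abel.

(** * Riemann sums of oscillating sequences on two grids *)

Section Riemann.
Variable R : realType.
Implicit Types (q : R[i]) (x : nat -> R[i]).

Lemma sum_blocks (V : nmodType) (F : nat -> V) N m :
  \sum_(i < N * m) F i = \sum_(n < N) \sum_(l < m) F (n * m + l)%N.
Proof.
elim: N => [|N IH]; first by rewrite mul0n !big_ord0.
by rewrite big_ord_recr /= -IH mulSnr big_split_ord.
Qed.

Lemma telescope_ord (V : zmodType) (x : nat -> V) a m :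
  x (a + m)%N - x a = \sum_(l < m) (x (a + l).+1 - x (a + l)%N).
Proof.
elim: m => [|m IH]; first by rewrite big_ord0 addn0 subrr.
by rewrite big_ord_recr /= -IH addnS addrC subrKA.
Qed.

Lemma nc_expr_sub1 q l : nc q = 1 -> nc (q ^+ l - 1) <= l%:R * nc (q - 1).
Proof.
move=> q1; elim: l => [|l IH]; first by rewrite expr0 subrr nc0 mul0r.
have -> : q ^+ l.+1 - 1 = q * (q ^+ l - 1) + (q - 1) by rewrite exprS; ring.
apply: le_trans (le_normcD _ _) _; rewrite Normc.normcM q1 mul1r -natr1 mulrDl.
by rewrite mul1r lerD2r.
Qed.

Lemma block_variation x a m l : (l <= m)%N ->
  nc (x (a + l)%N - x a) <= \sum_(i < m) nc (x (a + i).+1 - x (a + i)%N).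
Proof.
move=> lm; rewrite telescope_ord; apply: le_trans (nc_sum _ _ _) _.
rewrite (big_ord_widen m (fun i => nc (x (a + i).+1 - x (a + i)%N)))//.
rewrite [leRHS](bigID (fun i : 'I_m => (i < l)%N)) /= lerDl.
by apply: sumr_ge0 => i _; exact: nc_ge0.
Qed.

(* The two bounds are obtained differently: the first is Abel summation on each
   sum, the second compares the sums on each block of length [m]. *)
Lemma riemann_osc q x N m (c h phi : R) : nc q = 1 -> 0 <= h -> 0 <= phi ->
  0 < c -> c <= 1 ->
  nc (q - 1) <= phi -> c * phi <= nc (q - 1) ->
  c * (m%:R * phi) <= nc (q ^+ m - 1) ->
  let T := h%:C * (\sum_(i < N * m) q ^+ i * x i)
    - (m%:R * h)%:C * \sum_(n < N) q ^+ (n * m) * x (n * m)%N in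
  let V := nc (x (N * m)%N) + nc (x 0%N)
    + \sum_(i < N * m) nc (x i.+1 - x i) in
  c * phi * nc T <= 2 * h * V /\ c * nc T <= 2 * (m%:R * h) * V.
Proof.
move=> q1 h0 phi0 c0 c1 qphi cphi cmphi T V.
set D := \sum_(i < N * m) nc (x i.+1 - x i).
have D0 : 0 <= D by apply: sumr_ge0 => i _; exact: nc_ge0.
have V0 : 0 <= V by rewrite !addr_ge0 ?nc_ge0.
have DV : D <= V by rewrite /V lerDr addr_ge0 ?nc_ge0.
have qm1 : nc (q ^+ m) = 1 by rewrite nc_expr q1 expr1n.
set S := \sum_(i < N * m) q ^+ i * x i.
set S' := \sum_(n < N) q ^+ (n * m) * x (n * m)%N.
have S'E : S' = \sum_(n < N) (q ^+ m) ^+ n * x (n * m)%N.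
  by apply: eq_bigr => i _; rewrite -exprM mulnC.
have HS : nc (q - 1) * nc S <= V by exact: abel_le.
have blockD : \sum_(n < N) (\sum_(l < m) nc (x (n * m + l).+1 - x (n * m + l)%N)) = D.
  by rewrite /D (sum_blocks (fun i => nc (x i.+1 - x i))).
have HS' : nc (q ^+ m - 1) * nc S' <= V.
  rewrite S'E; apply: le_trans (abel_le (fun n => x (n * m)%N) N qm1) _.
  rewrite mul0n lerD2l -/D -blockD; apply: ler_sum => n _.
  by rewrite mulSnr; exact: block_variation.
have mh0 : 0 <= m%:R * h by rewrite mulr_ge0.
have nT : nc T <= h * nc S + m%:R * h * nc S'.
  apply: le_trans (nc_sub _ _) _.
  by rewrite !Normc.normcM !nc_real !ger0_norm.
split.
  have h1 : c * phi * nc S <= V.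
    by apply: le_trans _ HS; rewrite ler_wpM2r ?nc_ge0.
  have h2 : c * (m%:R * phi) * nc S' <= V.
    by apply: le_trans _ HS'; rewrite ler_wpM2r ?nc_ge0.
  apply: (@le_trans _ _ (c * phi * (h * nc S + m%:R * h * nc S'))).
    by rewrite ler_wpM2l // mulr_ge0 // ltW.
  have := ler_wpM2l h0 h1; have := ler_wpM2l h0 h2; lra.
(* [T1] is the cost of freezing [x] at the start of each block, paid by its variation. The phases
   that remain sum to [g] on every block; [g] has size [(m h) (m phi)], and the factor [m phi] is
   recovered from the Abel bound on [S']. *)
pose g := h%:C * \sum_(l < m) (q ^+ l - 1).
pose T1 := \sum_(n < N) h%:C * \sum_(l < m) q ^+ (n * m + l) *
   (x (n * m + l)%N - x (n * m)%N).
have TE : T = T1 + g * S'.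
  rewrite /T /T1 /S /g (sum_blocks (fun i => q ^+ i * x i)) mulr_sumr.
  rewrite [_ * S']mulr_sumr /S' mulr_sumr -big_split -sumrB /=.
  apply: eq_bigr => n _.
  have -> : (m%:R * h)%:C = h%:C * \sum_(l < m) 1 :> R[i].
    by rewrite sumr_const card_ord -mulr_natr mul1r mulrC rmorphM /= rmorph_nat.
  rewrite -mulrA -mulrBr -[h%:C * _ * _]mulrA -mulrDr; congr (_ * _).
  rewrite !mulr_suml -sumrB -big_split /=; apply: eq_bigr => l _.
  by rewrite exprD; ring.
have nT1 : nc T1 <= m%:R * h * D.
  apply: le_trans (nc_sum _ _ _) _; rewrite -blockD mulr_sumr.
  apply: ler_sum => n _; rewrite Normc.normcM nc_real (ger0_norm h0).
  rewrite -mulrA [X in _ <= X]mulrCA ler_wpM2l//.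
  apply: le_trans (nc_sum _ _ _) _.
  rewrite [X in _ <= X]mulr_natl -[X in _ *+ X]card_ord -sumr_const.
  apply: ler_sum => l _.
  rewrite Normc.normcM nc_expr q1 expr1n mul1r.
  by apply: block_variation; exact: ltnW.
have ng : nc g <= m%:R * h * (m%:R * phi).
  rewrite /g Normc.normcM nc_real (ger0_norm h0) -mulrA [X in _ <= X]mulrCA ler_wpM2l//.
  apply: le_trans (nc_sum _ _ _) _.
  rewrite [X in _ <= X]mulr_natl -[X in _ *+ X]card_ord -sumr_const.
  apply: ler_sum => l _; apply: le_trans (nc_expr_sub1 _ q1) _.
  by apply: ler_pM => //; rewrite ?ler_nat ?nc_ge0 // ltnW.
have h2 : c * (m%:R * phi) * nc S' <= V.
  by apply: le_trans _ HS'; rewrite ler_wpM2r ?nc_ge0.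
have nTle : nc T <= m%:R * h * D + m%:R * h * (m%:R * phi) * nc S'.
  rewrite TE; apply: le_trans (le_normcD _ _) _; apply: lerD => //.
  by rewrite Normc.normcM ler_wpM2r ?nc_ge0.
apply: le_trans (ler_wpM2l (ltW c0) nTle) _.
have h3 := ler_wpM2l mh0 h2.
have h4 : c * (m%:R * h * D) <= m%:R * h * V.
  have h5 : m%:R * h * D <= m%:R * h * V by rewrite ler_wpM2l.
  by apply: le_trans h5; rewrite ler_piMl// mulr_ge0.
lra.
Qed.

End Riemann.

(** * Upper and lower bounds for the modulus of [exp(ix) - 1] *)

Section TrigBounds.
Variable R : realType.
Implicit Types (x y : R).

Lemma nonneg_of_derive (f df : R -> R) :
  (forall x, is_derive x 1 f (df x)) -> f 0 = 0 ->
  (forall x, 0 <= x -> 0 <= df x) -> forall x, 0 <= x -> 0 <= f x.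
Proof.
move=> fd f0 df0 x; rewrite le_eqVlt => /predU1P[<-|x0]; first by rewrite f0.
have cf : {within `[0, x], continuous f}.
  apply: continuous_subspaceT => y; apply: differentiable_continuous.
  by apply/derivable1_diffP; have [] := fd y.
have [c + ] := MVT x0 (fun y _ => fd y) cf.
rewrite in_itv /= f0 !subr0 => /andP[c0 _] ->.
by rewrite mulr_ge0 ?df0 ?ltW.
Qed.

Lemma sin_le x : 0 <= x -> sin x <= x.
Proof.
move=> x0; rewrite -subr_ge0.
apply: (@nonneg_of_derive (fun x => x - sin x) (fun x => 1 - cos x)) x0.
- by rewrite sin0 subr0.
- by move=> y _; rewrite subr_ge0 cos_le1.
Qed.

Lemma sin_ge x : 0 <= x -> x - x ^+ 3 / 6 <= sin x.
Proof.
move=> x0; rewrite -subr_ge0.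
apply: (@nonneg_of_derive (fun x => sin x - (x - x ^+ 3 / 6))
          (fun x => cos x - 1 + x ^+ 2 / 2)) x0.
- move=> y; apply: is_derive_eq.
  by rewrite /GRing.scale /=; field.
- by rewrite sin0 expr0n /= mul0r !subr0.
move=> y y0.
apply: (@nonneg_of_derive (fun x => cos x - 1 + x ^+ 2 / 2)
          (fun x => x - sin x)) y0.
- move=> z; apply: is_derive_eq.
  by rewrite /GRing.scale /=; field.
- by rewrite cos0 expr0n /= mul0r subrr addr0.
- by move=> z z0; rewrite subr_ge0 sin_le.
Qed.

Lemma nc_expi_sub1 x : nc (expi x - 1) = 2 * `|sin (x / 2)|.
Proof.
have n0 : 0 <= 2 * `|sin (x / 2)| by rewrite mulr_ge0.
apply/eqP; rewrite -(@eqrXn2 _ 2%N) ?nc_ge0//; apply/eqP.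
rewrite nc_sqr exprMn real_normK ?num_real// /expi /=.
have xE : x = (x / 2) *+ 2 by rewrite -mulr_natr; field.
move: (x / 2) xE => y ->.
have -> : cos (y *+ 2) = 1 - 2 * sin y ^+ 2.
  by rewrite cos_mulr2n cos2sin2; ring.
rewrite sin_mulr2n.
have := cos2sin2 y; move: (cos y) (sin y) => a b ab.
have -> : (1 - 2 * b ^+ 2 - 1) ^+ 2 + (a * b *+ 2 - 0) ^+ 2 =
  4 * b ^+ 2 * (b ^+ 2 + a ^+ 2) by ring.
by rewrite ab; ring.
Qed.

Lemma nc_expi_sub1_le x : nc (expi x - 1) <= `|x|.
Proof.
rewrite nc_expi_sub1.
wlog x0 : x / 0 <= x => [H|].
  have [|x0] := leP 0 x; first exact: H.
  by rewrite -normrN -sinN -mulNr -(normrN x); apply: H; rewrite oppr_ge0 ltW.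
have [x4|x4] := leP x 4; last first.
  rewrite (ger0_norm x0); have := sin_max (x / 2); lra.
have s0 : 0 <= sin (x / 2).
  have := @sin_ge (x / 2) _; have -> : (0 <= x / 2) = true by apply/idP; lra.
  move=> /(_ isT); apply: le_trans.
  have -> : x / 2 - (x / 2) ^+ 3 / 6 = x * (24 - x ^+ 2) / 48 by field.
  rewrite mulr_ge0 // mulr_ge0 //; nra.
rewrite !ger0_norm //; have := @sin_le (x / 2); lra.
Qed.

(** The modulus is [2 |sin (x / 2)|], and for [0 <= y <= 2] the cubic bound gives
    [sin y >= y (1 - 4 / 6) = y / 3]. The threshold 4 is the one supplied by [phase_le]. *)
Lemma nc_expi_sub1_ge x : `|x| <= 4 -> `|x| / 3 <= nc (expi x - 1).
Proof.
rewrite nc_expi_sub1.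
wlog x0 : x / 0 <= x => [H|].
  have [|x0] := leP 0 x; first exact: H.
  by have := H (- x); rewrite mulNr sinN !normrN; apply; rewrite oppr_ge0 ltW.
rewrite ger0_norm // => x4.
have h : x / 6 <= sin (x / 2).
  apply: le_trans (@sin_ge (x / 2) _); last by lra.
  have : 0 <= x * (16 - x ^+ 2) by rewrite mulr_ge0 //; nra.
  have -> : x / 2 - (x / 2) ^+ 3 / 6 = x * (16 - x ^+ 2) / 48 + x / 6 by field.
  lra.
rewrite ger0_norm; lra.
Qed.

End TrigBounds.

(** * Phases and Sobolev weights *)

Section Sums.
Variable R : realType.

Lemma ler_sum_subset (I : eqType) (s t : seq I) (F : I -> R) :
  uniq s -> uniq t -> {subset s <= t} -> (forall i, 0 <= F i) ->
  \sum_(i <- s) F i <= \sum_(i <- t) F i.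
Proof.
move=> us ut st F0.
rewrite [leRHS](bigID (mem s)) /= -[X in _ <= X + _]big_filter.
have -> : \sum_(i <- [seq i <- t | i \in s]) F i = \sum_(i <- s) F i.
  apply: perm_big; apply: uniq_perm; rewrite ?filter_uniq // => i.
  by rewrite mem_filter andb_idr // => /st.
by rewrite lerDl sumr_ge0.
Qed.

(** Induction against the telescoping bound [1 / (x + 1)^2 <= 1 / x - 1 / (x + 1)]; the term of
    index 0 is [0^-1 = 0]. *)
Lemma sum_inv_sqr n : \sum_(i < n.+2) (i%:R : R)^-1 ^+ 2 <= 2 - n.+1%:R^-1.
Proof.
elim: n => [|n IH].
  by rewrite !big_ord_recr big_ord0 /= invr0 invr1 expr0n /= expr1n; lra.
rewrite big_ord_recr /=; apply: le_trans (lerD IH (lexx _)) _.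
have n1 : (0 : R) < n.+1%:R by rewrite ltr0n.
rewrite -(natr1 n.+1); move: (n.+1%:R : R) n1 => x x0.
rewrite -subr_ge0.
have -> : 2 - (x + 1)^-1 - (2 - x^-1 + (x + 1)^-1 ^+ 2) = (x * (x + 1) ^+ 2)^-1.
  by field; rewrite !gt_eqF // addr_gt0.
by rewrite invr_ge0 mulr_ge0 ?sqr_ge0 ?ltW.
Qed.

Lemma sum_inv_sqr_nat (s : seq nat) : uniq s ->
  \sum_(i <- s) (i%:R : R)^-1 ^+ 2 <= 2.
Proof.
move=> us; pose n := \max_(i <- s) i.
apply: (@le_trans _ _ (\sum_(i <- iota 0 n.+2) (i%:R : R)^-1 ^+ 2)).
  apply: ler_sum_subset => [||i si|i]; rewrite ?iota_uniq ?sqr_ge0 //.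
  rewrite mem_iota /= add0n ltnS; apply: leqW.
  exact: (@leq_bigmax_seq _ _ predT id).
rewrite -[X in iota _ X]subn0 -/(index_iota 0 n.+2) big_mkord.
by apply: le_trans (sum_inv_sqr n) _; rewrite gerBl invr_ge0.
Qed.

(** Nonnegative and negative integers contribute at most 2 each to the sum of squares, and
    [2 + 2 = 2^2]. The value at [k = 0] is [0^-1 = 0]. *)
Lemma l2le_inv_int : l2le (fun k : int => (`|k%:~R| : R)^-1) 2.
Proof.
split=> // s us.
have half (P : pred int) : {in P &, injective absz} ->
    \sum_(k <- s | P k) (`|k%:~R| : R)^-1 ^+ 2 <= 2.
  move=> Pinj; rewrite -big_filter.
  have -> : \sum_(i <- [seq x <- s | P x]) (`|i%:~R| : R)^-1 ^+ 2 =
            \sum_(n <- map absz [seq x <- s | P x]) (n%:R : R)^-1 ^+ 2.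
    by rewrite big_map; apply: eq_bigr => i _; rewrite -intr_norm -abszE.
  apply: sum_inv_sqr_nat; rewrite map_inj_in_uniq ?filter_uniq //.
  by move=> x y; rewrite !mem_filter => /andP[Px _] /andP[Py _]; exact: Pinj.
rewrite (bigID (fun k => 0 <= k)) /=.
have -> : (2 : R) ^+ 2 = 2 + 2 by ring.
by apply: lerD; apply: half => x y; rewrite /in_mem /=; lia.
Qed.

Lemma l2le_prod (f g : int -> R) F G : l2le f F -> l2le g G ->
  l2le (fun ab : int * int => f ab.1 * g ab.2) (F * G).
Proof.
move=> [F0 fF] [G0 gG]; split=> [|s us]; first exact: mulr_ge0.
pose s1 := undup (map fst s); pose s2 := undup (map snd s).
apply: (@le_trans _ _ (\sum_(ab <- [seq (a, b) | a <- s1, b <- s2])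
   (f ab.1 * g ab.2) ^+ 2)).
  apply: ler_sum_subset => //.
  - by apply: allpairs_uniq; rewrite ?undup_uniq // => -[a b] [c d] _ _ [-> ->].
  - move=> [a b] abs; apply: allpairs_f; rewrite mem_undup.
      exact: (map_f fst abs).
    exact: (map_f snd abs).
  - by move=> i; exact: sqr_ge0.
rewrite big_allpairs /=.
apply: (@le_trans _ _ (\sum_(a <- s1) f a ^+ 2 * G ^+ 2)).
  apply: ler_sum => a _; under eq_bigr do rewrite exprMn.
  by rewrite -mulr_sumr ler_wpM2l ?sqr_ge0 ?gG ?undup_uniq.
by rewrite -mulr_suml exprMn ler_wpM2r ?sqr_ge0 ?fF ?undup_uniq.
Qed.

End Sums.

Section Symbols.
Variable R : realType.
Implicit Types (k j : int) (t : R).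

Local Notation r k := ((k : int)%:~R : R).

Lemma omega_sqr k : omega R k ^+ 2 = 1 + r k ^+ 4.
Proof.
by rewrite /omega sqr_sqrtr // addr_ge0 // -[4%N]/(2 * 2)%N exprM sqr_ge0.
Qed.

Lemma omega_ge k : r k ^+ 2 <= omega R k.
Proof.
rewrite -(@ler_pXn2r _ 2%N) ?nnegrE ?sqr_ge0 ?sqrtr_ge0 //.
by rewrite omega_sqr -exprM lerDr.
Qed.

Lemma omega_le k : omega R k <= r k ^+ 2 + 1.
Proof.
have h := sqr_ge0 (r k).
rewrite -(@ler_pXn2r _ 2%N) ?nnegrE ?sqrtr_ge0 ?addr_ge0 //.
rewrite omega_sqr -subr_ge0.
have -> : (r k ^+ 2 + 1) ^+ 2 - (1 + r k ^+ 4) = 2 * r k ^+ 2 by ring.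
by rewrite mulr_ge0.
Qed.

Lemma sqr_int_ge1 k : k != 0 -> 1 <= r k ^+ 2.
Proof.
move=> k0; rewrite -(real_normK (num_real _)) -intr_norm exprn_ege1 // ler1z; lia.
Qed.

(** False at [k = 0], where [omega] is 1. In the three phases of mixed sign at most two of the
    corrections [omega - k^2] have the same sign, so with the constant one half their total is at
    most 1; a quadratic part [2 x] with [|x| >= 1] then keeps half of its size. *)
Lemma omega_le_half k : k != 0 -> omega R k <= r k ^+ 2 + 2^-1.
Proof.
move=> /sqr_int_ge1 k1; have h := sqr_ge0 (r k).
rewrite -(@ler_pXn2r _ 2%N) ?nnegrE ?sqrtr_ge0 ?addr_ge0 //.
rewrite omega_sqr -subr_ge0.
have -> : (r k ^+ 2 + 2^-1) ^+ 2 - (1 + r k ^+ 4) = r k ^+ 2 - 3 / 4 by field.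
lra.
Qed.

Lemma omega_ge1 k : 1 <= omega R k.
Proof.
rewrite -(@ler_pXn2r _ 2%N) ?nnegrE ?sqrtr_ge0 // omega_sqr expr1n lerDl.
by rewrite -[4%N]/(2 * 2)%N exprM sqr_ge0.
Qed.

Lemma omega_gt0 k : 0 < omega R k.
Proof. exact: lt_le_trans ltr01 (omega_ge1 k). Qed.

Lemma omegaN k : omega R (- k) = omega R k.
Proof. by rewrite /omega mulrNz -[4%N]/(2 * 2)%N !exprM sqrrN. Qed.

Definition sgb (e : bool) : R := if e then 1 else -1.

Definition theta (e1 e2 : bool) k j : R :=
  omega R k - sgb e1 * omega R j - sgb e2 * omega R (k - j).

Definition nonres k j := [&& k != 0, j != 0 & k - j != 0].

(* The Hilbert-Schmidt bound of [theta_lower] for [1 / theta], with [kj = (k, j)];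
   the junk value [0^-1 = 0] only occurs off [nonres]. *)
Definition hs (e1 e2 : bool) (kj : int * int) : R :=
  let a := if e1 == e2 then kj.2 else kj.1 in
  let b := if e1 == e2 then kj.1 - kj.2 else if e1 then kj.1 - kj.2 else kj.2 in
  `|r a|^-1 * `|r b|^-1.

Lemma hs_ge0 e1 e2 kj : 0 <= hs e1 e2 kj.
Proof. by rewrite mulr_ge0 // invr_ge0. Qed.

(** In each case [(k, j)] determines and is determined by the pair of frequencies in the
    denominator, so the kernel is a tensor square of [1 / |n|], each factor having norm at most
    2. *)
Lemma l2le_hs e1 e2 : l2le (hs e1 e2) 4.
Proof.
have -> : (4 : R) = 2 * 2 by ring.
pose phi (kj : int * int) :=
  (if e1 == e2 then kj.2 else kj.1,
   if e1 == e2 then kj.1 - kj.2 else if e1 then kj.1 - kj.2 else kj.2).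
apply: (l2le_inj (phi := phi) _ (l2le_prod (l2le_inv_int R) (l2le_inv_int R))).
by move=> [a b] [c d]; rewrite /phi /=; case: eqP => _; [|case: ifP => _];
  move=> [h1 h2]; congr (_, _); lia.
Qed.

(* The quadratic parts of the phases factor as [2 j (k - j)], [2 k (k - j)] and
   [2 k j], and the corrections are at most 1. *)
Lemma theta_lower e1 e2 k j : nonres k j -> 1 <= hs e1 e2 (k, j) * `|theta e1 e2 k j|.
Proof.
move=> /and3P[k0 j0 l0].
have lE : r (k - j) = r k - r j by rewrite rmorphB.
have key (a b : int) : a != 0 -> b != 0 -> `|r a * r b| <= `|theta e1 e2 k j| ->
    1 <= `|r a|^-1 * `|r b|^-1 * `|theta e1 e2 k j|.
  move=> a0 b0 h; rewrite -invfM -normrM mulrC ler_pdivlMr ?mul1r //.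
  by rewrite normr_gt0 mulf_neq0 // intr_eq0.
have abs1 (a b : int) : a != 0 -> b != 0 -> 1 <= `|r a * r b|.
  move=> a0 b0; rewrite -intrM -intr_norm ler1z.
  by rewrite normrM; nia.
have [dk dj dl] : [/\ 0 <= omega R k - r k ^+ 2 <= 2^-1,
   0 <= omega R j - r j ^+ 2 <= 2^-1 &
   0 <= omega R (k - j) - (r k - r j) ^+ 2 <= 2^-1].
  rewrite -lE; split; rewrite subr_ge0 omega_ge lerBlDl omega_le_half //.
have fin (x y : R) : 1 <= `|x| -> `|y - 2 * x| <= 1 -> `|x| <= `|y|.
  move=> x1 h; have : `|2 * x| <= `|y| + `|y - 2 * x|.
    by rewrite -{1}(subKr y (2 * x)); exact: ler_normB.
  by rewrite normrM ger0_norm //; lra.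
case: e1 e2 key => -[] key; apply: key => //; rewrite /theta /sgb.
- apply: fin; first exact: abs1.
  by rewrite lE ler_norml; apply/andP; split; lra.
- apply: fin; first exact: abs1.
  by rewrite lE ler_norml; apply/andP; split; lra.
- apply: fin; first exact: abs1.
  by rewrite ler_norml; apply/andP; split; lra.
- rewrite lE; set x := r j * _.
  have h1 : `|x| <= r j ^+ 2 + (r k - r j) ^+ 2.
    have := sqr_ge0 (r j - (r k - r j)); have := sqr_ge0 (r j + (r k - r j)).
    rewrite /x ler_norml => ? ?; apply/andP; split; nra.
  apply: le_trans h1 _; apply: le_trans _ (ler_norm _).
  have := sqr_ge0 (r k); lra.
Qed.

Lemma theta_upper e1 e2 k j : `|theta e1 e2 k j| <=
  r k ^+ 2 + r j ^+ 2 + r (k - j) ^+ 2 + 3.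
Proof.
have h1 := omega_le k; have h2 := omega_le j; have h3 := omega_le (k - j).
have g1 := omega_gt0 k; have g2 := omega_gt0 j; have g3 := omega_gt0 (k - j).
by rewrite /theta /sgb ler_norml; apply/andP; split; case: e1; case: e2; lra.
Qed.

Lemma phase_le e1 e2 t k j : 0 <= t -> t <= 3^-1 -> t * r k ^+ 2 <= 1 ->
  t * r j ^+ 2 <= 1 -> t * r (k - j) ^+ 2 <= 1 -> `|t * theta e1 e2 k j| <= 4.
Proof.
move=> t0 t3 tk tj tl; rewrite normrM (ger0_norm t0).
apply: le_trans (ler_wpM2l t0 (theta_upper e1 e2 k j)) _; lra.
Qed.

Definition jsq k : R := 1 + r k ^+ 2.

Lemma jsq_ge1 k : 1 <= jsq k.
Proof. by rewrite lerDl sqr_ge0. Qed.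

Lemma theta_jsq e1 e2 k j : `|theta e1 e2 k j| <= 3 * (jsq j * jsq (k - j)).
Proof.
apply: le_trans (theta_upper _ _ _ _) _; rewrite /jsq rmorphB /=.
move: (r k) (r j) => x y.
have -> : x ^+ 2 + y ^+ 2 + (x - y) ^+ 2 + 3 =
  3 * ((1 + y ^+ 2) * (1 + (x - y) ^+ 2)) - (x - 2 * y) ^+ 2
  - 3 * (y * (x - y)) ^+ 2.
  by ring.
have := sqr_ge0 (x - 2 * y); have := sqr_ge0 (y * (x - y)); lra.
Qed.

Lemma jsq_submul k j : jsq k <= 2 * (jsq j * jsq (k - j)).
Proof.
rewrite /jsq rmorphB /=; move: (r k) (r j) => x y.
have := sqr_ge0 (x - 2 * y); have := sqr_ge0 (y * (x - y)); nra.
Qed.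

End Symbols.

Section Weights.
Variables (R : realType) (s : R).
Hypothesis hs : 0 < s <= 2.
Implicit Types (k j : int) (t : R).

Local Notation r k := ((k : int)%:~R : R).

(** This is exactly the weight [<k>^s], since [jsq] is the square of the Japanese bracket. *)
Definition wt k : R := jsq R k `^ (s / 2).

Lemma half_bounds : 0 < s / 2 <= 1.
Proof. by have /andP[h1 h2] := hs; apply/andP; split; lra. Qed.

Lemma wt_ge1 k : 1 <= wt k.
Proof.
have /andP[h1 _] := half_bounds.
have {1}<- : (1 : R) `^ (s / 2) = 1 by rewrite powR1.
rewrite /wt ge0_ler_powR ?nnegrE ?jsq_ge1 ?ltW //.
exact: lt_le_trans ltr01 (jsq_ge1 _ _).
Qed.

Lemma wt_gt0 k : 0 < wt k.
Proof. exact: lt_le_trans ltr01 (wt_ge1 k). Qed.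

(** The interpolation [min(1, y) <= y^(s/2)]: a number in [[0, 1]] does not decrease when raised to
    a power at most 1. The condition [s <= 2] enters here. *)
Lemma powR_ge_min (x y : R) : 0 <= x -> x <= 1 -> x <= y -> x <= y `^ (s / 2).
Proof.
move=> x0 x1 xy; have /andP[h1 h2] := half_bounds.
apply: (@le_trans _ _ (x `^ (s / 2))).
  move: x0; rewrite le_eqVlt => /predU1P[<-|x0]; first by rewrite powR_ge0.
  by apply: ger1_powR; rewrite ?x0.
by apply: ge0_ler_powR; rewrite ?nnegrE ?(ltW h1) // (le_trans x0).
Qed.

Lemma wt_high t k : 0 < t -> 1 <= t * r k ^+ 2 -> 1 <= t `^ (s / 2) * wt k.
Proof.
move=> t0 tk; have /andP[h1 _] := half_bounds.
have j0 : 0 <= jsq R k := le_trans ler01 (jsq_ge1 _ _).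
rewrite -powRM ?(ltW t0) //; apply: powR_ge_min => //.
apply: le_trans tk _; rewrite ler_wpM2l ?(ltW t0) // /jsq; lra.
Qed.

Lemma powR_le_base (c : R) : 1 <= c -> c `^ (s / 2) <= c.
Proof.
move=> c1; have /andP[h1 h2] := half_bounds; exact: ler1_powR.
Qed.

Lemma wt_theta t e1 e2 k j (x : R) : 0 <= t -> 0 <= x -> x <= 1 ->
  x <= t * `|theta R e1 e2 k j| -> x <= 3 * (t `^ (s / 2) * (wt j * wt (k - j))).
Proof.
move=> t0 x0 x1 xt; have /andP[h1 _] := half_bounds.
have j0 i : 0 <= jsq R i := le_trans ler01 (jsq_ge1 _ _).
apply: (@le_trans _ _ ((3 * (t * (jsq R j * jsq R (k - j)))) `^ (s / 2))).
  apply: powR_ge_min => //; apply: le_trans xt _; rewrite mulrCA ler_wpM2l //.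
  exact: theta_jsq.
rewrite !powRM ?mulr_ge0 // ler_wpM2r ?mulr_ge0 ?powR_ge0 //.
by apply: powR_le_base; lra.
Qed.

(** For low frequencies [t <k>^2 <= 2], so passing to the power [s / 2] costs at most a factor 2.
    The purpose is to exchange [t / <k>^s] for [2 t^(s/2) / <k>^2], which is square-summable in
    [k]. *)
Lemma wt_low t k : 0 < t -> t <= 1 -> t * r k ^+ 2 <= 1 ->
  t * jsq R k <= 2 * (t `^ (s / 2) * wt k).
Proof.
move=> t0 t1 tk; have /andP[h1 _] := half_bounds.
have j0 : 0 <= jsq R k := le_trans ler01 (jsq_ge1 _ _).
have tj : 0 <= t * jsq R k by rewrite mulr_ge0 // ltW.
rewrite -powRM ?(ltW t0) //.
have : t * jsq R k / 2 <= (t * jsq R k) `^ (s / 2).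
  apply: powR_ge_min; rewrite ?divr_ge0 //; last lra.
  rewrite /jsq; lra.
lra.
Qed.

Lemma wt_submul k j : wt k <= 2 * (wt j * wt (k - j)).
Proof.
have /andP[h1 _] := half_bounds.
have j0 i : 0 <= jsq R i := le_trans ler01 (jsq_ge1 _ _).
apply: (@le_trans _ _ ((2 * (jsq R j * jsq R (k - j))) `^ (s / 2))).
  by apply: ge0_ler_powR; rewrite ?nnegrE ?jsq_submul ?(ltW h1) ?mulr_ge0 // mulr_ge0.
rewrite !powRM ?mulr_ge0 // ler_wpM2r ?mulr_ge0 ?powR_ge0 //.
by apply: powR_le_base; lra.
Qed.

Lemma l2le_inv_jsq : l2le (fun k => (jsq R k)^-1) 3.
Proof.
have -> : (3 : R) = 1 + 2 by ring.
apply: (@l2le_mono _ _ _ (fun k : int => (k == 0)%:R + `|r k|^-1)).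
  move=> k; apply: le_trans _ (ler_norm _); rewrite ger0_norm ?invr_ge0; last first.
    by rewrite (le_trans ler01) ?jsq_ge1.
  have [->|k0] := eqVneq k 0.
    by rewrite /jsq mulr0z normr0 invr0 expr0n /= !addr0 invr1.
  rewrite add0r lef_pV2 ?posrE ?normr_gt0 ?intr_eq0 //; last first.
    by rewrite (lt_le_trans ltr01) ?jsq_ge1.
  rewrite /jsq -(real_normK (num_real _)); have := sqr_ge0 (`|r k| - 1); nra.
apply: l2leD (l2le_inv_int R); split=> // u uu; rewrite expr1n.
have -> : \sum_(i <- u) ((i == 0)%:R : R) ^+ 2 = (count_mem 0 u)%:R.
  elim: u {uu} => [|a u IH]; first by rewrite big_nil.
  by rewrite big_cons IH /= natrD; case: (a == 0); rewrite ?expr1n ?expr0n.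
by rewrite count_uniq_mem // lern1 leq_b1.
Qed.

End Weights.

(** * Bilinear sums in the interaction picture *)

Section Variation.
Variable R : realType.

Definition variation (x : nat -> R[i]) n : R :=
  nc (x n) + nc (x 0%N) + \sum_(i < n) nc (x i.+1 - x i).

Lemma variation_ge0 x n : 0 <= variation x n.
Proof.
by rewrite /variation !addr_ge0 ?nc_ge0 // sumr_ge0 // => i _; exact: nc_ge0.
Qed.

Lemma variationZ (w : R[i]) x n :
  variation (fun i => w * x i) n = nc w * variation x n.
Proof.
rewrite /variation !mulrDr mulr_sumr !Normc.normcM; congr (_ + _).
by apply: eq_bigr => i _; rewrite -mulrBr Normc.normcM.
Qed.

(** In each term of the product rule one factor is an increment, bounded uniformly in [j] and [k],
    and the other is in [l2] over [j]; the kernel [hs], of norm 4, does the rest. The endpoint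
    values of [f] have separate uniform bounds, so that an error starting from 0 creates no boundary
    term at time 0, and [F] depends on the time index as Gronwall's lemma requires. *)
Lemma l2le_variation (J : seq int) e1 e2 n (f g : nat -> int -> int -> R[i])
    (phi0 phin G : R) (F df dg : nat -> R) :
  uniq J -> 0 <= phi0 -> 0 <= phin ->
  (forall i, (i < n)%N -> 0 <= df i) -> (forall i, (i < n)%N -> 0 <= dg i) ->
  (forall i k, (i <= n)%N -> l2le (fun j => nc (g i k j)) G) ->
  (forall i k, (i < n)%N -> l2le (fun j => nc (f i k j)) (F i)) ->
  (forall k j, nc (f 0%N k j) <= phi0) -> (forall k j, nc (f n k j) <= phin) ->
  (forall i k j, (i < n)%N -> nc (f i.+1 k j - f i k j) <= df i) ->
  (forall i k j, (i < n)%N -> nc (g i.+1 k j - g i k j) <= dg i) ->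
  l2le (fun k => \sum_(j <- J) hs R e1 e2 (k, j)
          * variation (fun i => f i k j * g i k j) n)
    (4 * (phin * G + phi0 * G + \sum_(i < n) (df i * G + F i * dg i))).
Proof.
move=> uJ p0 pn df0 dg0 gG fF f0 fn fdf gdg.
have inner k : l2le (fun j => variation (fun i => f i k j * g i k j) n)
    (phin * G + phi0 * G + \sum_(i < n) (df i * G + F i * dg i)).
  apply: (@l2le_mono _ _ _ (fun j => nc (g n k j) * phin + nc (g 0%N k j) * phi0
     + \sum_(i < n) (nc (g i.+1 k j) * df i + nc (f i k j) * dg i))).
    move=> j; rewrite ger0_norm ?variation_ge0 //.
    apply: le_trans _ (ler_norm _); rewrite /variation; apply: lerD.
      by apply: lerD; rewrite Normc.normcM mulrC ler_wpM2l ?nc_ge0.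
    apply: ler_sum => i _.
    have -> : f i.+1 k j * g i.+1 k j - f i k j * g i k j =
      (f i.+1 k j - f i k j) * g i.+1 k j + f i k j * (g i.+1 k j - g i k j).
      by ring.
    apply: le_trans (le_normcD _ _) _; rewrite !Normc.normcM.
    by apply: lerD; [rewrite mulrC|]; rewrite ler_wpM2l ?nc_ge0 ?fdf ?gdg.
  have step (a : int -> R) (A c : R) : 0 <= c -> l2le a A ->
      l2le (fun j => a j * c) (A * c).
    by move=> c0 aA; apply: l2leM => // i; rewrite ger0_norm.
  apply: l2leD; first by apply: l2leD; rewrite mulrC; apply: step => //; exact: gG.
  apply: (@l2le_sum_nat _ _ n (fun i j => nc (g i.+1 k j) * df i + nc (f i k j) * dg i)
    (fun i => df i * G + F i * dg i)) => i ilt.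
  apply: l2leD; last by apply: step; [exact: dg0|exact: fF].
  by rewrite mulrC; apply: step; [exact: df0|exact: gG].
have B0 := l2le_ge0 (inner 0).
apply: (l2le_mono _ (hilbert_schmidt uJ (l2le_hs R e1 e2) B0 inner)) => k.
rewrite ler_norml; apply/andP; split.
  rewrite lerNl; apply: le_trans (normr_ge0 _); rewrite oppr_le0.
  by apply: sumr_ge0 => j _; rewrite mulr_ge0 ?hs_ge0 ?variation_ge0.
apply: le_trans _ (ler_norm _); apply: ler_sum => j _.
by rewrite !ger0_norm ?hs_ge0 ?variation_ge0.
Qed.

(** The step size cancels: [|q - 1| >= h |theta| / 3], so that
    [h / |q - 1| <= 3 / |theta| <= 3 hs]. *)
Lemma osc_abel e1 e2 k j h n (x : nat -> R[i]) :
  0 < h -> nonres k j -> `|h * theta R e1 e2 k j| <= 4 ->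
  h * nc (\sum_(i < n) expi (- (h * theta R e1 e2 k j)) ^+ i * x i)
    <= 3 * (hs R e1 e2 (k, j) * variation x n) /\
  h * nc (\sum_(i < n.+1) expi (- (h * theta R e1 e2 k j)) ^+ i * x i)
    <= 3 * (hs R e1 e2 (k, j) * variation x n).
Proof.
move=> h0 nr th4; set q := expi _; set th := theta _ _ _ _ _ in th4 q *.
have q1 : nc q = 1 by exact: nc_expi.
have ql : h * `|th| / 3 <= nc (q - 1).
  rewrite -{1}(gtr0_norm h0) -normrM -normrN; apply: nc_expi_sub1_ge.
  by rewrite normrN.
have hs1 := theta_lower R e1 e2 nr; rewrite -/th in hs1.
have key S : nc (q - 1) * nc S <= variation x n ->
    h * nc S <= 3 * (hs R e1 e2 (k, j) * variation x n).
  move=> SV; have S0 := nc_ge0 S; have hs0 := hs_ge0 R e1 e2 (k, j).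
  have h1 : h * `|th| / 3 * nc S <= variation x n.
    by apply: le_trans SV; rewrite ler_wpM2r.
  have h2 := ler_wpM2l hs0 h1.
  have h3 : h * nc S <= hs R e1 e2 (k, j) * `|th| * (h * nc S).
    by rewrite ler_peMl // mulr_ge0 // ltW.
  lra.
by split; apply: key; [exact: abel_le|exact: abel_leS].
Qed.

(* Uses both bounds of [riemann_osc]: the minimum of [tau] and [1 / |theta|] is
   controlled by [tau ^ (s / 2)] times Sobolev weights over [|theta|]. *)
Lemma osc_riemann s e1 e2 k j h m N (x : nat -> R[i]) :
  0 < s <= 2 -> 0 < h -> nonres k j ->
  `|h * theta R e1 e2 k j| <= 4 -> `|m%:R * h * theta R e1 e2 k j| <= 4 ->
  let q := expi (- (h * theta R e1 e2 k j)) in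
  nc (h%:C * (\sum_(i < N * m) q ^+ i * x i)
    - (m%:R * h)%:C * \sum_(n < N) q ^+ (n * m) * x (n * m)%N) <=
  18 * ((m%:R * h) `^ (s / 2)) *
    (hs R e1 e2 (k, j) * (wt s j * wt s (k - j) * variation x (N * m))).
Proof.
move=> Hs h0 nr th4 mth4; cbv zeta; set q := expi _.
set th := theta _ _ _ _ _ in th4 mth4 q *.
set T := nc _.
have q1 : nc q = 1 by exact: nc_expi.
have nth c : 0 <= c -> `|- (c * th)| = c * `|th|.
  by move=> c0; rewrite normrN normrM ger0_norm.
have ql : 3^-1 * (h * `|th|) <= nc (q - 1).
  rewrite -(nth _ (ltW h0)) mulrC; apply: nc_expi_sub1_ge.
  by rewrite normrN.
have qu : nc (q - 1) <= h * `|th|.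
  by rewrite -(nth _ (ltW h0)); exact: nc_expi_sub1_le.
have mh0 : 0 <= m%:R * h by rewrite mulr_ge0 // ltW.
have qm : 3^-1 * (m%:R * (h * `|th|)) <= nc (q ^+ m - 1).
  have -> : q ^+ m = expi (- (m%:R * h * th)).
    by rewrite /q -expiMn; congr expi; ring.
  rewrite mulrA -(nth _ mh0) mulrC; apply: nc_expi_sub1_ge.
  by rewrite normrN.
have [] := riemann_osc x N q1 (ltW h0) (mulr_ge0 (ltW h0) (normr_ge0 th))
  _ _ qu ql qm; [by lra|by lra|].
rewrite -/(variation x (N * m)%N) -/T => b1 b2.
set V := variation _ _ in b1 b2 *; set tau := m%:R * h in b2 *.
have tau0 : 0 <= tau by rewrite mulr_ge0 // ltW.
have V0 : 0 <= V by exact: variation_ge0.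
have T0 : 0 <= T by exact: nc_ge0.
have hs0 := hs_ge0 R e1 e2 (k, j).
have b1' : T * `|th| <= 6 * V.
  rewrite -(ler_pM2l h0); lra.
have b2' : T <= 6 * (tau * V) by lra.
(* Together, [T |theta| <= 6 V] and [T <= 6 tau V] say that [T |theta|] is at most [6 V] times this
   minimum, which [wt_theta] bounds by a power of [tau] and weights. *)
pose y := Num.min (tau * `|th|) 1.
have y0 : 0 <= y by rewrite le_min ler01 andbT mulr_ge0.
have hy : T * `|th| <= 6 * V * y.
  rewrite /y; case: (leP (tau * `|th|) 1) => _; last by rewrite mulr1.
  have := ler_wpM2r (normr_ge0 th) b2'; lra.
have yW : y <= 3 * (tau `^ (s / 2) * (wt s j * wt s (k - j))).
  have y1 : y <= 1 by rewrite /y ge_min lexx orbT.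
  have yt : y <= tau * `|th| by rewrite /y ge_min lexx.
  exact: (wt_theta Hs tau0 y0 y1 yt).
have hs1 := theta_lower R e1 e2 nr; rewrite -/th in hs1.
apply: (@le_trans _ _ (hs R e1 e2 (k, j) * (T * `|th|))).
  by rewrite mulrCA ler_peMr.
apply: (@le_trans _ _ (hs R e1 e2 (k, j) * (6 * V * y))).
  by rewrite ler_wpM2l.
apply: (@le_trans _ _ (hs R e1 e2 (k, j) * (6 * V *
   (3 * (tau `^ (s / 2) * (wt s j * wt s (k - j))))))).
  by rewrite ler_wpM2l // ler_wpM2l // mulr_ge0.
lra.
Qed.

End Variation.

Section Quadratic.
Variable R : realType.
Implicit Types (a b : int -> R[i]) (F G t : R) (k j : int).

Local Notation r k := ((k : int)%:~R : R).

(* [false] stands for the complex conjugate function, whose coefficients are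
   the conjugates of those at the opposite frequencies. *)
Definition csg (e : bool) a j : R[i] := if e then a j else (a (- j))^*%C.

Lemma csgB e a b j : csg e (fun k => a k - b k) j = csg e a j - csg e b j.
Proof. by case: e => //=; rewrite rmorphB. Qed.

Lemma csg_le e a (w : int -> R) j : (forall i, w (- i) = w i) ->
  (forall i, nc (a i) <= w i) -> nc (csg e a j) <= w j.
Proof. by move=> wN aw; case: e => //=; rewrite nc_conj -wN. Qed.

Lemma csg_eq0 e a j : (a j = 0) -> a (- j) = 0 -> csg e a j = 0.
Proof. by move=> a0 a0'; case: e; rewrite /= ?a0 // a0' rmorph0. Qed.

Lemma l2le_csg e (w : int -> R) a F : (forall i, w (- i) = w i) ->
  l2le (fun j => w j * nc (a j)) F -> l2le (fun j => w j * nc (csg e a j)) F.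
Proof.
move=> wN aF; case: e => //=.
apply: (l2le_mono _ (l2le_inj (oppr_inj (V := int)) aF)) => j /=.
by rewrite nc_conj wN.
Qed.

Lemma l2n_csg e a F : l2le (fun j => nc (a j)) F ->
  l2le (fun j => nc (csg e a j)) F.
Proof.
move=> aF; have := @l2le_csg e (fun=> 1) a F (fun=> erefl).
have E b : (fun j => 1 * nc (b j)) = (fun j => nc (b j)).
  by apply/funext => j; rewrite mul1r.
by rewrite !E; exact.
Qed.

Lemma l2le_refl (f : int -> R) F k : l2le f F -> l2le (fun j => f (k - j)) F.
Proof. by apply: l2le_inj => x y /(congr1 (fun z => k - z)); rewrite !subKr. Qed.

Definition bil (e1 e2 : bool) (J : seq int) t a b k : R[i] :=
  \sum_(j <- J) expi (- (t * theta R e1 e2 k j)) * (csg e1 a j * csg e2 b (k - j)).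

(** The symbol of [-(i/4) <dx^2>^-1 dx^2]: a bounded multiplier that vanishes at frequency 0. *)
Definition mult k : R[i] := 'i / 4 * (r k ^+ 2 / omega R k)%:C.

Definition nonlin J t a k : R[i] :=
  mult k * \sum_(e : bool * bool) bil e.1 e.2 J t a a k.

(** The term [-(i/2) <dx^2>^-1 (u + conj u)] in the interaction picture: passing to the conjugate
    reverses the phase, so undoing the propagator leaves [exp(-2 i t omega)]. *)
Definition lin t a k : R[i] := - ('i / 2) * ((omega R k)^-1)%:C *
  (a k + expi (- (2 * t * omega R k)) * (a (- k))^*%C).

Lemma nc_i : nc ('i : R[i]) = 1.
Proof. by rewrite /= expr0n expr1n /= add0r sqrtr1. Qed.

Lemma nc_nat n : nc (n%:R : R[i]) = n%:R.
Proof.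
by rewrite -(rmorph_nat (real_complex R)) nc_real ger0_norm.
Qed.

Lemma mult0 : mult 0 = 0.
Proof. by rewrite /mult mulr0z expr0n /= mul0r mulr0. Qed.

Lemma nc_mult k : nc (mult k) <= 1.
Proof.
rewrite /mult !Normc.normcM nc_i Normc.normcV nc_nat nc_real.
have w0 := omega_gt0 R k.
have : `|r k ^+ 2 / omega R k| <= 1.
  rewrite ger0_norm; last by rewrite divr_ge0 ?sqr_ge0 // ltW.
  by rewrite ler_pdivrMr // mul1r omega_ge.
lra.
Qed.

(** Cauchy-Schwarz in [j]. Without oscillation this bound, uniform in [k] but not summable, is all
    that two factors in [l2] give. *)
Lemma bil_sup e1 e2 J t a b F G k : uniq J ->
  l2le (fun j => nc (a j)) F -> l2le (fun j => nc (b j)) G ->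
  nc (bil e1 e2 J t a b k) <= F * G.
Proof.
move=> uJ aF bG.
apply: le_trans _ (l2le_cs (l2n_csg e1 aF) (l2le_refl k (l2n_csg e2 bG)) uJ).
apply: le_trans (nc_sum _ _ _) _; apply: ler_sum => j _.
by rewrite !Normc.normcM nc_expi mul1r !ger0_norm ?nc_ge0.
Qed.

Lemma bil_diff e1 e2 J t a b k :
  bil e1 e2 J t a a k - bil e1 e2 J t b b k =
  bil e1 e2 J t (fun i => a i - b i) a k + bil e1 e2 J t b (fun i => a i - b i) k.
Proof.
rewrite /bil -sumrB -big_split /=; apply: eq_bigr => j _; rewrite !csgB; ring.
Qed.

Lemma sum_bool2_le (f : bool * bool -> R[i]) (B : R) :
  (forall e, nc (f e) <= B) -> nc (\sum_e f e) <= 4 * B.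
Proof.
move=> fB; apply: le_trans (nc_sum _ _ _) _.
apply: (@le_trans _ _ (\sum_(e : bool * bool) B)); first by apply: ler_sum.
by rewrite sumr_const card_prod card_bool mulr_natl.
Qed.

Lemma nonlin_sup J t a F k : uniq J -> l2le (fun j => nc (a j)) F ->
  nc (nonlin J t a k) <= 4 * (F * F).
Proof.
move=> uJ aF; rewrite /nonlin Normc.normcM -[leRHS]mul1r.
apply: ler_pM; rewrite ?nc_ge0 ?nc_mult //.
by apply: sum_bool2_le => e; exact: bil_sup.
Qed.

Lemma nonlin_diff_sup J t a b F G E k : uniq J ->
  l2le (fun j => nc (a j)) F -> l2le (fun j => nc (b j)) G ->
  l2le (fun j => nc (a j - b j)) E ->
  nc (nonlin J t a k - nonlin J t b k) <= 4 * (E * (F + G)).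
Proof.
move=> uJ aF bG abE; rewrite /nonlin -mulrBr Normc.normcM -[leRHS]mul1r.
apply: ler_pM; rewrite ?nc_ge0 ?nc_mult // -sumrB.
apply: sum_bool2_le => e; rewrite bil_diff; apply: le_trans (le_normcD _ _) _.
by rewrite mulrDr [X in _ <= _ + X]mulrC; apply: lerD; apply: bil_sup.
Qed.

Lemma linB t a b k : lin t a k - lin t b k = lin t (fun i => a i - b i) k.
Proof. by rewrite /lin rmorphB; ring. Qed.

Lemma nc_lin t a k : nc (lin t a k) <=
  2^-1 * (omega R k)^-1 * (nc (a k) + nc (a (- k))).
Proof.
have w0 := omega_gt0 R k.
rewrite /lin Normc.normcM; apply: ler_pM; rewrite ?nc_ge0 //.
  rewrite Normc.normcM normcN Normc.normcM nc_i Normc.normcV nc_nat mul1r nc_real.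
  by rewrite ger0_norm // invr_ge0 ltW.
apply: le_trans (le_normcD _ _) _.
by rewrite Normc.normcM nc_expi nc_conj mul1r.
Qed.

Lemma nc_lin1 t a k : nc (lin t a k) <= 2^-1 * (nc (a k) + nc (a (- k))).
Proof.
have w0 := omega_gt0 R k; have n0 := addr_ge0 (nc_ge0 (a k)) (nc_ge0 (a (- k))).
apply: le_trans (nc_lin _ _ _) _; rewrite ler_wpM2r // ler_piMr ?invr_ge0 //.
by rewrite invf_le1 // omega_ge1.
Qed.

Lemma l2le_lin t a F : l2le (fun j => nc (a j)) F ->
  l2le (fun j => nc (lin t a j)) F.
Proof.
move=> aF; have F0 := l2le_ge0 aF.
have -> : F = `|2^-1| * (F + F) by rewrite ger0_norm //; field.
apply: (l2le_mono _ (l2leZ 2^-1 (l2leD aF (l2le_inj (oppr_inj (V := int)) aF)))).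
move=> j /=; rewrite ger0_norm ?nc_ge0 //.
by apply: le_trans (nc_lin1 _ _ _) (ler_norm _).
Qed.

End Quadratic.

(** * Convergence of the coefficients *)

Section FineTrajectory.
Variables (R : realType) (s tau h : R) (m : nat) (J : seq int) (A Lam : R).
Variable (c : nat -> int -> R[i]).
Hypothesis Hs : 0 < s <= 2.
Hypothesis h0 : 0 < h.
Hypothesis tau0 : 0 < tau.
Hypothesis tau3 : tau <= 3^-1.
Hypothesis tauE : tau = m%:R * h.
Hypothesis uJ : uniq J.
Hypothesis Lam0 : 0 <= Lam.
Hypothesis cA : forall i, l2le (fun j => wt s j * nc (c i j)) A.
(** The increments come from the quadratic forcing, hence are controlled pointwise in [j] only, with
    the decay [1 / <j>^s]. The next hypothesis restricts the frequencies so that the fine phases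
    [h theta] stay below 4. *)
Hypothesis cL : forall i j, nc (c i.+1 j - c i j) <= h * Lam / wt s j.
Hypothesis cJ : forall i j, 1 < h * (j%:~R : R) ^+ 2 -> c i j = 0.

Implicit Types (a : int -> R[i]) (k j : int).
Local Notation r k := ((k : int)%:~R : R).
Local Notation eta := (tau `^ (s / 2)).

Definition low k : bool := tau * r k ^+ 2 <= 1.
Definition cut a k : R[i] := if low k then a k else 0.
(** Frequency 0 is left out: every pair is resonant there, and [mult] vanishes. *)
Definition chi k : bool := low k && (k != 0).
Definition high a k : R[i] := a k - cut a k.

Lemma lowN k : low (- k) = low k.
Proof. by rewrite /low mulrNz sqrrN. Qed.

Lemma low0 : low 0.
Proof. by rewrite /low mulr0z expr0n mulr0. Qed.

Lemma tau_le1 : tau <= 1.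
Proof. by apply: le_trans tau3 _; rewrite invf_le1 ?ler1n. Qed.

Lemma m_gt0 : (0 < m)%N.
Proof. by move: tau0; rewrite tauE; case: m; rewrite // mul0r ltxx. Qed.

Lemma h_le_tau : h <= tau.
Proof.
by rewrite tauE ler_peMl ?(ltW h0) // ler1n m_gt0.
Qed.

Lemma tau_le_eta : tau <= eta.
Proof. exact: (powR_ge_min Hs (ltW tau0) tau_le1 (lexx _)). Qed.

Lemma eta_gt0 : 0 < eta.
Proof. exact: powR_gt0. Qed.

Let eta0 : 0 <= eta := ltW eta_gt0.

Lemma wtN k : wt s (- k) = wt s k :> R.
Proof. by rewrite /wt /jsq mulrNz sqrrN. Qed.

Lemma A_ge0 : 0 <= A.
Proof. exact: l2le_ge0 (cA 0). Qed.

Lemma nc_cut a k : nc (cut a k) <= nc (a k).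
Proof. by rewrite /cut; case: ifP => // _; rewrite nc0 nc_ge0. Qed.

Lemma cutB a a' k : cut a k - cut a' k = cut (fun i => a i - a' i) k.
Proof. by rewrite /cut; case: ifP => // _; rewrite subr0. Qed.

Lemma nc_high a k : nc (high a k) <= eta * (wt s k * nc (a k)).
Proof.
rewrite /high /cut; case: ifP => lk.
  by rewrite subrr nc0 !mulr_ge0 ?nc_ge0 ?(ltW (wt_gt0 Hs k)).
rewrite subr0 mulrA ler_peMl ?nc_ge0 // wt_high //.
by move: lk => /negbT; rewrite -ltNge => /ltW.
Qed.

Lemma wt_weak a F : l2le (fun j => wt s j * nc (a j)) F ->
  l2le (fun j => nc (a j)) F.
Proof.
apply: l2le_mono => j.
rewrite !ger0_norm ?mulr_ge0 ?nc_ge0 ?(ltW (wt_gt0 Hs j)) //.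
by rewrite ler_peMl ?nc_ge0 ?wt_ge1.
Qed.

Lemma wt_inv_le1 k : (wt s k)^-1 <= 1 :> R.
Proof. by rewrite invf_le1 ?wt_ge1 ?wt_gt0. Qed.

Lemma l2le_cut_wt i : l2le (fun j => wt s j * nc (cut (c i) j)) A.
Proof.
apply: (l2le_mono _ (cA i)) => j.
have w0 := ltW (wt_gt0 Hs j : 0 < wt s j :> R).
by rewrite !ger0_norm ?mulr_ge0 ?nc_ge0 // ler_wpM2l ?nc_cut.
Qed.

Lemma l2le_c i : l2le (fun j => nc (c i j)) A.
Proof. exact/wt_weak/cA. Qed.

Lemma l2le_cut i : l2le (fun j => nc (cut (c i) j)) A.
Proof. exact/wt_weak/l2le_cut_wt. Qed.

Lemma l2le_high i : l2le (fun j => nc (high (c i) j)) (eta * A).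
Proof.
have -> : eta * A = `|eta| * A by rewrite ger0_norm.
apply: (l2le_mono _ (l2leZ eta (cA i))) => j.
by rewrite ger0_norm ?nc_ge0 //; apply: le_trans (nc_high _ _) (ler_norm _).
Qed.

Lemma block_diff i l j : (l <= m)%N -> nc (c (i + l)%N j - c i j) <= tau * Lam / wt s j.
Proof.
move=> lm; apply: le_trans (block_variation (fun i => c i j) i lm) _.
apply: (@le_trans _ _ (\sum_(i < m) h * Lam / wt s j)); first by apply: ler_sum.
by rewrite sumr_const card_ord -mulr_natl tauE !mulrA.
Qed.

(** The weight [1 / <j>^s] of [block_diff] need not be square-summable. Below the filter threshold
    [wt_low] trades it for [<j>^-2], at the price of [tau^(s/2)] in place of [tau]: the order aimed
    at. *)
Lemma cut_block_diff i l j : (l <= m)%N ->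
  nc (cut (c (i + l)%N) j - cut (c i) j) <= 2 * eta * Lam / jsq R j.
Proof.
move=> lm; have j0 : 0 < jsq R j := lt_le_trans ltr01 (jsq_ge1 _ _).
have w0 := wt_gt0 Hs j : 0 < wt s j :> R.
rewrite cutB /cut; case: ifP => lj; last first.
  by rewrite nc0 divr_ge0 ?(ltW j0) // mulr_ge0 // mulr_ge0.
apply: le_trans (block_diff i j lm) _.
have := wt_low Hs tau0 tau_le1 lj.
rewrite ler_pdivlMr // mulrAC ler_pdivrMr // => hh.
have := ler_wpM2r Lam0 hh; lra.
Qed.

Lemma l2le_jsq (K : R) : 0 <= K -> l2le (fun j : int => K / jsq R j) (3 * K).
Proof.
by move=> K0; rewrite mulrC -{2}(ger0_norm K0); apply: l2leZ; exact: l2le_inv_jsq.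
Qed.

Lemma chi_low k : chi k -> low k. Proof. by case/andP. Qed.

Lemma phase4 e1 e2 t k j : 0 < t -> t <= tau -> low k ->
  t * r j ^+ 2 <= 1 -> t * r (k - j) ^+ 2 <= 1 -> `|t * theta R e1 e2 k j| <= 4.
Proof.
move=> t0 tt lk tj tkj; apply: phase_le => //; [exact: ltW|exact: le_trans tt tau3|].
by apply: le_trans lk; rewrite ler_wpM2r ?sqr_ge0.
Qed.

Lemma expi_step e1 e2 k j t n :
  expi (- (n%:R * t * theta R e1 e2 k j)) = expi (- (t * theta R e1 e2 k j)) ^+ n.
Proof. by rewrite -expiMn; congr expi; ring. Qed.

(** The disjunction sets aside the [j] whose contribution vanishes at all times, for which no bound
    on the phase is available. *)
Lemma osc_sum_bound e1 e2 k t n (x : nat -> int -> R[i]) : 0 < t ->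
  (forall j, (forall i, x i j = 0) \/
     nonres k j /\ `|t * theta R e1 e2 k j| <= 4) ->
  t * nc (\sum_(i < n) \sum_(j <- J) expi (- (i%:R * t * theta R e1 e2 k j)) * x i j)
   <= 3 * \sum_(j <- J) hs R e1 e2 (k, j) * variation (x^~ j) n /\
  t * nc (\sum_(i < n.+1) \sum_(j <- J) expi (- (i%:R * t * theta R e1 e2 k j)) * x i j)
   <= 3 * \sum_(j <- J) hs R e1 e2 (k, j) * variation (x^~ j) n.
Proof.
move=> t0 Hx.
have key p : (forall j, t * nc (\sum_(i < p) expi (- (t * theta R e1 e2 k j)) ^+ i * x i j)
    <= 3 * (hs R e1 e2 (k, j) * variation (x^~ j) n)) ->
   t * nc (\sum_(i < p) \sum_(j <- J) expi (- (i%:R * t * theta R e1 e2 k j)) * x i j)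
   <= 3 * \sum_(j <- J) hs R e1 e2 (k, j) * variation (x^~ j) n.
  move=> H; rewrite exchange_big /= [leRHS]mulr_sumr.
  apply: (@le_trans _ _ (\sum_(j <- J) t * nc (\sum_(i < p)
      expi (- (i%:R * t * theta R e1 e2 k j)) * x i j))).
    by rewrite -mulr_sumr ler_wpM2l ?(ltW t0) // nc_sum.
  apply: ler_sum => j _; apply: le_trans _ (H j).
  by under eq_bigr do rewrite expi_step.
by split; apply: key => j; (have [x0|[nr th4]] := Hx j;
  [rewrite big1 ?nc0 ?mulr0 ?mulr_ge0 ?hs_ge0 ?variation_ge0 // => i _;
   rewrite x0 mulr0|have [] := osc_abel n (x^~ j) t0 nr th4]).
Qed.

Lemma csg_high0 e i j : low j -> csg e (high (c i)) j = 0.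
Proof.
by move=> lj; apply: csg_eq0; rewrite /high /cut ?lowN lj subrr.
Qed.

Lemma csg_cut0 e i j : ~~ low j -> csg e (cut (c i)) j = 0.
Proof. by move=> /negbTE lj; apply: csg_eq0; rewrite /cut ?lowN lj. Qed.

Lemma csg_fine e i j : csg e (c i) j != 0 -> h * r j ^+ 2 <= 1.
Proof.
apply: contraR; rewrite -ltNge => lj; apply/eqP.
by apply: csg_eq0; apply: cJ => //; rewrite mulrNz sqrrN.
Qed.

Lemma csg_fine_high e i j : csg e (high (c i)) j != 0 -> h * r j ^+ 2 <= 1.
Proof.
apply: contraR; rewrite -ltNge => lj; apply/eqP.
apply: csg_eq0; rewrite /high /cut cJ ?if_same ?subrr //.
by rewrite mulrNz sqrrN.
Qed.

Lemma low_fine j : low j -> h * r j ^+ 2 <= 1.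
Proof. by apply: le_trans; rewrite ler_wpM2r ?sqr_ge0 ?h_le_tau. Qed.

Lemma csg_incr e (f : (int -> R[i]) -> int -> R[i]) i j (w : int -> R) :
  (forall a b k, f a k - f b k = f (fun l => a l - b l) k) ->
  (forall a k, nc (f a k) <= w k * nc (a k)) -> (forall k, 0 <= w k) ->
  (forall k, w (- k) = w k) ->
  nc (csg e (f (c i.+1)) j - csg e (f (c i)) j) <= w j * (h * Lam / wt s j).
Proof.
move=> fB fw w0 wN; rewrite -csgB.
apply: (@csg_le _ _ _ (fun j => w j * (h * Lam / wt s j))) => k.
  by rewrite wN wtN.
by rewrite fB; apply: le_trans (fw _ _) _; rewrite ler_wpM2l ?w0.
Qed.

Lemma highB a b k : high a k - high b k = high (fun l => a l - b l) k.
Proof. by rewrite /high -cutB; ring. Qed.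

Lemma csg_c_incr e i j : nc (csg e (c i.+1) j - csg e (c i) j) <= h * Lam.
Proof.
rewrite -csgB; apply: (@csg_le _ _ _ (fun=> h * Lam)) => // k.
apply: le_trans (cL i k) _; rewrite ler_piMr ?wt_inv_le1 // mulr_ge0 // ltW //.
Qed.

Lemma csg_cut_incr e i j : nc (csg e (cut (c i.+1)) j - csg e (cut (c i)) j)
  <= h * Lam / wt s j.
Proof.
rewrite -[leRHS]mul1r.
apply: (@csg_incr e cut i j (fun=> 1)) => // a; first exact: cutB.
by move=> k; rewrite mul1r nc_cut.
Qed.

Lemma csg_high_incr e i j :
  nc (csg e (high (c i.+1)) j - csg e (high (c i)) j) <= eta * (h * Lam).
Proof.
have w0 k := wt_gt0 Hs k : 0 < wt s k :> R.
have -> : eta * (h * Lam) = (eta * wt s j) * (h * Lam / wt s j).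
  by field; rewrite gt_eqF.
apply: (@csg_incr e high i j (fun k => eta * wt s k)).
- exact: highB.
- by move=> a k; rewrite -mulrA nc_high.
- by move=> k; rewrite mulr_ge0 // ltW.
- by move=> k; rewrite wtN.
Qed.

(** Each difference contains one factor [high (c i)], of size [eta] in [l2]; its increments gain
    [eta] too, because the weight spent cancels the decay in [cL]. Non-resonance is automatic: [k]
    is low, so in either case [j = 0] or [j = k] would put the frequency of the high factor among
    the low ones, where it vanishes. *)
Lemma trunc_bound e1 e2 n (T : R) : n%:R * h <= T ->
  l2le (fun k => if chi k then nc (h%:C * \sum_(i < n)
      (bil e1 e2 J (i%:R * h) (c i) (c i) k -
       bil e1 e2 J (i%:R * h) (cut (c i)) (cut (c i)) k)) else 0)
   (24 * (A * A + A * Lam * T + (A * A + A * Lam * T)) * eta).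
Proof.
move=> nT; have A0 := A_ge0; have h0' := ltW h0.
have T0 : 0 <= T by apply: le_trans nT; rewrite mulr_ge0.
have part B f g : (forall k i, l2le (fun j => nc (g i k j)) B) -> 0 <= B ->
   (forall k i, l2le (fun j => nc (f i k j)) (eta * A)) ->
   (forall k i j, nc (f i.+1 k j - f i k j) <= eta * (h * Lam)) ->
   (forall k i j, nc (g i.+1 k j - g i k j) <= h * Lam) ->
   l2le (fun k => 3 * \sum_(j <- J) hs R e1 e2 (k, j)
        * variation (fun i => f i k j * g i k j) n)
     (12 * ((2 * A * B + (A + B) * Lam * T) * eta)).
  move=> gB B0 fA fi gi.
  have hl0 : 0 <= h * Lam by rewrite mulr_ge0.
  have eA0 : 0 <= eta * A by rewrite mulr_ge0.
  have := @l2le_variation R J e1 e2 n f g (eta * A) (eta * A) B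
    (fun=> eta * A) (fun=> eta * (h * Lam)) (fun=> h * Lam) uJ eA0 eA0.
  move=> /(_ (fun _ _ => mulr_ge0 eta0 hl0) (fun _ _ => hl0)).
  move=> /(_ (fun i k _ => gB k i) (fun i k _ => fA k i)).
  have sup i k j : nc (f i k j) <= eta * A.
    by have := l2le_sup j (fA k i); rewrite ger0_norm ?nc_ge0.
  move=> /(_ (sup 0%N) (sup n) (fun i k j _ => fi k i j) (fun i k j _ => gi k i j)).
  move=> /(l2leZ 3); rewrite (ger0_norm (ler0n _ 3)); apply: l2le_weak.
  rewrite sumr_const card_ord -mulr_natl.
  have := ler_wpM2l (mulr_ge0 (mulr_ge0 (addr_ge0 A0 B0) Lam0) eta0) nT; lra.
have P1 := part A (fun i (k : int) j => csg e1 (high (c i)) j)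
  (fun i k j => csg e2 (c i) (k - j)).
have P2 := part A (fun i k j => csg e2 (high (c i)) (k - j))
  (fun i (k : int) j => csg e1 (cut (c i)) j).
have -> : 24 * (A * A + A * Lam * T + (A * A + A * Lam * T)) * eta =
  12 * ((2 * A * A + (A + A) * Lam * T) * eta) +
  12 * ((2 * A * A + (A + A) * Lam * T) * eta) by ring.
apply: (l2le_mono _ (l2leD (P1 _ A0 _ _ _) (P2 _ A0 _ _ _))); first last.
- move=> k i j; apply: le_trans (csg_cut_incr _ _ _) _.
  by rewrite ler_piMr ?wt_inv_le1 // mulr_ge0.
- by move=> k i j; exact: csg_high_incr.
- by move=> k i; apply: (l2le_refl (f := fun j => nc (csg e2 (high (c i)) j)) k);
    exact/l2n_csg/l2le_high.
- by move=> k i; exact/l2n_csg/l2le_cut.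
- by move=> k i j; exact: csg_c_incr.
- by move=> k i j; exact: csg_high_incr.
- by move=> k i; exact/l2n_csg/l2le_high.
- by move=> k i; apply: (l2le_refl (f := fun j => nc (csg e2 (c i) j)) k);
    exact/l2n_csg/l2le_c.
move=> k; have [ck|_] := boolP (chi k); last by rewrite normr0.
have [lk k0] := andP ck.
apply: le_trans _ (ler_norm _).
rewrite ger0_norm ?nc_ge0 // Normc.normcM nc_real (gtr0_norm h0).
under eq_bigr do rewrite bil_diff.
rewrite big_split /=.
apply: le_trans (ler_wpM2l h0' (le_normcD _ _)) _.
rewrite mulrDr; apply: lerD.
  apply: (osc_sum_bound (x := fun i j => csg e1 (high (c i)) j * csg e2 (c i) (k - j)) n h0 _).1.
  move=> j; have [?|/existsNP[i /eqP]] :=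
    pselect (forall i, csg e1 (high (c i)) j * csg e2 (c i) (k - j) = 0); first by left.
  rewrite mulf_eq0 negb_or => /andP[f0 g0]; right.
  have lj : ~~ low j by apply: contra f0 => lj; rewrite csg_high0.
  split; last by apply: phase4 h_le_tau _ _ _ => //;
    [exact: csg_fine_high f0|exact: csg_fine g0].
  rewrite /nonres k0 /=; apply/andP; split.
    by apply: contra lj => /eqP ->; exact: low0.
  by apply: contra lj; rewrite subr_eq0 => /eqP <-.
rewrite [leRHS](_ : _ = 3 * \sum_(j <- J) hs R e1 e2 (k, j) *
  variation (fun i => csg e1 (cut (c i)) j * csg e2 (high (c i)) (k - j)) n); last first.
  congr (_ * _); apply: eq_bigr => j _; congr (_ * variation _ _).
  by apply/funext => i; rewrite mulrC.
apply: (osc_sum_bound (x := fun i j => csg e1 (cut (c i)) j * csg e2 (high (c i)) (k - j)) n h0 _).1.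
move=> j; have [?|/existsNP[i /eqP]] :=
  pselect (forall i, csg e1 (cut (c i)) j * csg e2 (high (c i)) (k - j) = 0); first by left.
rewrite mulf_eq0 negb_or => /andP[f0 g0]; right.
have lkj : ~~ low (k - j) by apply: contra g0 => lj; rewrite csg_high0.
have lj : low j by apply: contraNT f0 => lj; rewrite csg_cut0.
split; last by apply: phase4 h_le_tau _ _ _ => //;
  [exact: low_fine|exact: csg_fine_high g0].
rewrite /nonres k0 /=; apply/andP; split.
  by apply: contra lkj => /eqP ->; rewrite subr0.
by apply: contra lkj => /eqP ->; exact: low0.
Qed.

Definition bilN e1 e2 t a b k : R[i] :=
  \sum_(j <- J | nonres k j) expi (- (t * theta R e1 e2 k j)) * (csg e1 a j * csg e2 b (k - j)).

Definition bilR e1 e2 t a b k : R[i] :=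
  \sum_(j <- J | ~~ nonres k j) expi (- (t * theta R e1 e2 k j)) * (csg e1 a j * csg e2 b (k - j)).

Lemma bilE e1 e2 t a b k : bil e1 e2 J t a b k = bilN e1 e2 t a b k + bilR e1 e2 t a b k.
Proof. by rewrite /bil (bigID (nonres k)). Qed.

(** The weights demanded by [osc_riemann] are absorbed into the two factors. Both remain bounded by
    [A] in [l2], and their increments are still at most [h Lam], since [csg_cut_incr] carries the
    inverse weight. *)
Lemma time_nonres e1 e2 N (T : R) : (N * m)%:R * h <= T ->
  l2le (fun k => if chi k then
      nc (h%:C * \sum_(i < N * m) bilN e1 e2 (i%:R * h) (cut (c i)) (cut (c i)) k
        - tau%:C * \sum_(n < N) bilN e1 e2 (n%:R * tau) (cut (c (n * m)%N)) (cut (c (n * m)%N)) k)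
    else 0) (144 * (A * A + A * Lam * T) * eta).
Proof.
move=> NT; have A0 := A_ge0; have h0' := ltW h0.
have hl0 : 0 <= h * Lam by rewrite mulr_ge0.
pose f i (k : int) j := (wt s j)%:C * csg e1 (cut (c i)) j : R[i].
pose g i (k : int) j := (wt s (k - j))%:C * csg e2 (cut (c i)) (k - j) : R[i].
have w0 k := ltW (wt_gt0 Hs k : 0 < wt s k :> R).
have w0' k := wt_gt0 Hs k : 0 < wt s k :> R.
have fA i k : l2le (fun j => nc (f i k j)) A.
  apply: (l2le_mono _ (l2le_csg e1 wtN (l2le_cut_wt i))) => j.
  by rewrite /f Normc.normcM nc_real (ger0_norm (w0 _)).
have gA i k : l2le (fun j => nc (g i k j)) A.
  apply: (l2le_mono _ (l2le_refl k (l2le_csg e2 wtN (l2le_cut_wt i)))) => j.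
  by rewrite /g Normc.normcM nc_real (ger0_norm (w0 _)).
have incr e i j : nc ((wt s j)%:C * csg e (cut (c i.+1)) j -
    (wt s j)%:C * csg e (cut (c i)) j) <= h * Lam.
  rewrite -mulrBr Normc.normcM nc_real (ger0_norm (w0 _)).
  by rewrite -ler_pdivlMl // mulrC csg_cut_incr.
have sup i k j : nc (f i k j) <= A.
  by have := l2le_sup j (fA i k); rewrite ger0_norm ?nc_ge0.
have := @l2le_variation R J e1 e2 (N * m)%N f g A A A
  (fun=> A) (fun=> h * Lam) (fun=> h * Lam) uJ A0 A0
  (fun _ _ => hl0) (fun _ _ => hl0) (fun i k _ => gA i k) (fun i k _ => fA i k)
  (sup 0%N) (sup (N * m)%N) (fun i k j _ => incr e1 i j)
  (fun i k j _ => incr e2 i (k - j)).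
move=> /(l2leZ (18 * eta)) H.
apply: (l2le_mono _ (l2le_weak _ H)); last first.
  rewrite ger0_norm ?mulr_ge0 // sumr_const card_ord -mulr_natl.
  have := ler_wpM2l (mulr_ge0 (mulr_ge0 A0 Lam0) eta0) NT; lra.
move=> k; have [ck|_] := boolP (chi k); last by rewrite normr0.
apply: le_trans _ (ler_norm _); rewrite ger0_norm ?nc_ge0 //.
rewrite /bilN exchange_big /= [h%:C * _]mulr_sumr [X in tau%:C * X]exchange_big /=.
rewrite [tau%:C * _]mulr_sumr -sumrB.
apply: le_trans (nc_sum _ _ _) _; rewrite [leRHS]mulr_sumr big_mkcond /=.
apply: ler_sum => j _; rewrite -/(f _ k j).
have varE : wt s j * wt s (k - j) *
   variation (fun i => csg e1 (cut (c i)) j * csg e2 (cut (c i)) (k - j)) (N * m)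
   = variation (fun i => f i k j * g i k j) (N * m).
  have -> : wt s j * wt s (k - j) = nc ((wt s j)%:C * (wt s (k - j))%:C : R[i]).
    by rewrite Normc.normcM !nc_real !ger0_norm.
  rewrite -variationZ; congr (variation _ _); apply/funext => i.
  by rewrite /f /g; ring.
have rhs0 : 0 <= 18 * eta * (hs R e1 e2 (k, j) *
    variation (fun i => f i k j * g i k j) (N * m)).
  by rewrite !mulr_ge0 ?hs_ge0 ?variation_ge0.
case: ifP => // nr; rewrite -varE.
have [lj|lj] := boolP (low j); last first.
  rewrite !big1 ?mulr0 ?subr0 ?nc0 ?varE // => i _;
  by rewrite csg_cut0 // mul0r mulr0.
have [lkj|lkj] := boolP (low (k - j)); last first.
  rewrite !big1 ?mulr0 ?subr0 ?nc0 ?varE // => i _;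
  by rewrite [X in _ * X]mulrC csg_cut0 // mul0r mulr0.
have lk := chi_low ck.
have := @osc_riemann R s e1 e2 k j h m N
  (fun i => csg e1 (cut (c i)) j * csg e2 (cut (c i)) (k - j)) Hs h0 nr
  (phase4 e1 e2 h0 h_le_tau lk (low_fine lj) (low_fine lkj)).
rewrite -tauE => /(_ (phase4 e1 e2 tau0 (lexx _) lk lj lkj)); apply: le_trans.
rewrite le_eqVlt; apply/orP; left; apply/eqP; congr (nc (_ * _ - _ * _)).
  by apply: eq_bigr => i _; rewrite expi_step.
by apply: eq_bigr => i _; rewrite -expi_step natrM tauE [i%:R * (_ * _)]mulrA.
Qed.

Local Notation u j := (2 * eta * Lam / jsq R j).

Lemma u_ge0 j : 0 <= u j.
Proof.
by rewrite divr_ge0 ?(le_trans ler01 (jsq_ge1 R j)) // !mulr_ge0.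
Qed.

Lemma l2le_u : l2le (fun j : int => u j) (6 * eta * Lam).
Proof.
have -> : 6 * eta * Lam = 3 * (2 * eta * Lam) by ring.
by apply: l2le_jsq; rewrite !mulr_ge0.
Qed.

Lemma csg_cut_block e i l j : (l <= m)%N ->
  nc (csg e (cut (c (i + l)%N)) j - csg e (cut (c i)) j) <= u j.
Proof.
move=> lm; rewrite -csgB; apply: (@csg_le _ _ _ (fun j => u j)) => k.
  by rewrite /jsq mulrNz sqrrN.
exact: cut_block_diff.
Qed.

Lemma phase_diff e1 e2 k j (t l : R) : 0 <= l -> l <= tau ->
  nc (expi (- ((t + l) * theta R e1 e2 k j)) - expi (- (t * theta R e1 e2 k j)))
   <= 6 * eta * (wt s j * wt s (k - j)).
Proof.
move=> l0 lt; set th := theta _ _ _ _ _.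
have -> : - ((t + l) * th) = - (t * th) + - (l * th) by ring.
rewrite expiD -[X in _ - X]mulr1 -mulrBr Normc.normcM nc_expi mul1r.
pose y := Num.min (tau * `|th|) 1.
have y0 : 0 <= y by rewrite le_min ler01 andbT mulr_ge0 // ltW.
have y1 : y <= 1 by rewrite /y ge_min lexx orbT.
have yt : y <= tau * `|th| by rewrite /y ge_min lexx.
have := wt_theta Hs (ltW tau0) y0 y1 yt.
have n1 : nc (expi (- (l * th)) - 1) <= 2.
  by apply: le_trans (nc_sub _ _) _; rewrite nc_expi Normc.normc1.
have n2 : nc (expi (- (l * th)) - 1) <= tau * `|th|.
  apply: le_trans (nc_expi_sub1_le _) _.
  by rewrite normrN normrM ger0_norm // ler_wpM2r.
have n3 : nc (expi (- (l * th)) - 1) <= 2 * y.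
  rewrite /y; case: (leP (tau * `|th|) 1) => _; last lra.
  by apply: le_trans n2 _; rewrite ler_peMl ?mulr_ge0 ?(ltW tau0) // ler1n.
lra.
Qed.

Lemma lh_le_tau l : (l <= m)%N -> l%:R * h <= tau.
Proof. by move=> lm; rewrite tauE ler_wpM2r ?(ltW h0) // ler_nat. Qed.

Lemma step_time e1 e2 k j i l : (l <= m)%N ->
  nc (expi (- ((i + l)%:R * h * theta R e1 e2 k j)) *
        (csg e1 (cut (c (i + l)%N)) j * csg e2 (cut (c (i + l)%N)) (k - j))
      - expi (- (i%:R * h * theta R e1 e2 k j)) *
        (csg e1 (cut (c i)) j * csg e2 (cut (c i)) (k - j)))
  <= u j * nc (csg e2 (cut (c (i + l)%N)) (k - j))
     + nc (csg e1 (cut (c i)) j) * u (k - j)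
     + 6 * eta * ((wt s j * nc (csg e1 (cut (c i)) j)) *
                 (wt s (k - j) * nc (csg e2 (cut (c i)) (k - j)))).
Proof.
move=> lm; have h0' := ltW h0.
have lh0 : 0 <= l%:R * h by rewrite mulr_ge0.
have := @phase_diff e1 e2 k j (i%:R * h) (l%:R * h) lh0 (lh_le_tau lm).
rewrite -mulrDl -natrD.
have := csg_cut_block e1 i j lm; have := csg_cut_block e2 i (k - j) lm.
set f' := csg e1 _ _; set f := csg e1 _ _; set g' := csg e2 _ _; set g := csg e2 _ _.
set x' := expi _; set x := expi _ => Hg Hf Hx.
have -> : x' * (f' * g') - x * (f * g) =
  x' * ((f' - f) * g' + f * (g' - g)) + (x' - x) * (f * g) by ring.
apply: le_trans (le_normcD _ _) _; rewrite !Normc.normcM nc_expi mul1r.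
apply: lerD.
  apply: le_trans (le_normcD _ _) _; rewrite !Normc.normcM; apply: lerD.
    by rewrite ler_wpM2r ?nc_ge0.
  by rewrite ler_wpM2l ?nc_ge0.
have := ler_wpM2r (mulr_ge0 (nc_ge0 f) (nc_ge0 g)) Hx; lra.
Qed.

(** For [k != 0] a resonant pair has [j = 0] or [j = k], so a resonant sum has at most two terms. *)
Lemma res_sum k (F : int -> R) : chi k -> (forall j, 0 <= F j) ->
  \sum_(j <- J | ~~ nonres k j) F j <= F 0 + F k.
Proof.
move=> /andP[_ k0] F0; rewrite -big_filter.
have -> : F 0 + F k = \sum_(j <- [:: 0; k]) F j by rewrite !big_cons big_nil addr0.
apply: ler_sum_subset => //; first exact: filter_uniq.
  by rewrite /= inE eq_sym k0.
move=> j; rewrite mem_filter /nonres k0 /= negb_and !negbK => /andP[/orP[]/eqP E _].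
  by rewrite E inE eqxx.
by rewrite !inE; apply/orP; right; lia.
Qed.

Lemma blocks_le (F : nat -> R[i]) (G : nat -> R[i]) N (B : nat -> nat -> R) :
  (forall n l, (l < m)%N -> nc (F (n * m + l)%N - G n) <= B n l) ->
  nc (h%:C * \sum_(i < N * m) F i - tau%:C * \sum_(n < N) G n)
    <= \sum_(n < N) \sum_(l < m) h * B n l.
Proof.
move=> FB; rewrite (sum_blocks F) !mulr_sumr -sumrB /=.
apply: le_trans (nc_sum _ _ _) _; apply: ler_sum => n _.
have -> : tau%:C * G n = h%:C * \sum_(l < m) G n.
  rewrite sumr_const card_ord tauE -[G n *+ m]mulr_natl rmorphM /= rmorph_nat.
  by ring.
rewrite -mulrBr -sumrB Normc.normcM nc_real (gtr0_norm h0) -mulr_sumr.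
rewrite ler_wpM2l ?(ltW h0) //; apply: le_trans (nc_sum _ _ _) _.
by apply: ler_sum => l _; exact: FB.
Qed.

Lemma l2le_blocks N (B : nat -> nat -> int -> R) (K T : R) : 0 <= K ->
  (N * m)%:R * h <= T ->
  (forall n l, (l < m)%N -> l2le (B n l) K) ->
  l2le (fun k => \sum_(n < N) \sum_(l < m) h * B n l k) (T * K).
Proof.
move=> K0 NT BK.
have H : l2le (fun k => \sum_(n < N) \sum_(l < m) h * B n l k)
    (\sum_(n < N) \sum_(l < m) h * K).
  apply: (@l2le_sum_nat _ _ N (fun n k => \sum_(l < m) h * B n l k)
    (fun _ => \sum_(l < m) h * K)) => n _.
  apply: (@l2le_sum_nat _ _ m (fun l k => h * B n l k) (fun _ => h * K)) => l lm.
  by rewrite -{2}(gtr0_norm h0); exact/l2leZ/BK.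
apply: l2le_weak H.
rewrite !sumr_const !card_ord -mulrnA mulnC -mulr_natl mulrA.
by rewrite ler_wpM2r.
Qed.

Lemma wt0 : wt s 0 = 1 :> R.
Proof. by rewrite /wt /jsq mulr0z expr0n addr0 powR1. Qed.

Lemma jsq0 : jsq R 0 = 1.
Proof. by rewrite /jsq mulr0z expr0n addr0. Qed.

(** At [j = 0] and [j = k] one of the factors sits at frequency 0, where it is bounded, and the
    other one carries the dependence on [k]. The pointwise bound of [step_time] is thus
    square-summable in [k] with no help from oscillation. *)
Lemma time_res e1 e2 N (T : R) : (N * m)%:R * h <= T ->
  l2le (fun k => if chi k then
      nc (h%:C * \sum_(i < N * m) bilR e1 e2 (i%:R * h) (cut (c i)) (cut (c i)) k
        - tau%:C * \sum_(n < N) bilR e1 e2 (n%:R * tau) (cut (c (n * m)%N)) (cut (c (n * m)%N)) k)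
    else 0) (T * ((16 * Lam * A + 12 * A * A) * eta)).
Proof.
move=> NT; have A0 := A_ge0.
pose D n l k j := u j * nc (csg e2 (cut (c (n * m + l)%N)) (k - j))
     + nc (csg e1 (cut (c (n * m)%N)) j) * u (k - j)
     + 6 * eta * ((wt s j * nc (csg e1 (cut (c (n * m)%N)) j)) *
                 (wt s (k - j) * nc (csg e2 (cut (c (n * m)%N)) (k - j)))).
have w0 k := ltW (wt_gt0 Hs k : 0 < wt s k :> R).
have D0 n l k j : 0 <= D n l k j.
  by rewrite /D !addr_ge0 ?mulr_ge0 ?nc_ge0 ?u_ge0 ?w0 //;
    rewrite invr_ge0 (le_trans ler01 (jsq_ge1 _ _)).
have K0 : 0 <= (16 * Lam * A + 12 * A * A) * eta.
  by rewrite mulr_ge0 // addr_ge0 // !mulr_ge0.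
have DK n l : (l < m)%N ->
    l2le (fun k => D n l k 0 + D n l k k) ((16 * Lam * A + 12 * A * A) * eta).
  move=> lm.
  have supc e i j : nc (csg e (cut (c i)) j) <= A.
    by have := l2le_sup j (l2n_csg e (l2le_cut i)); rewrite ger0_norm ?nc_ge0.
  have l2c e i : l2le (fun k => nc (csg e (cut (c i)) k)) A by exact/l2n_csg/l2le_cut.
  have l2w e i : l2le (fun k => wt s k * nc (csg e (cut (c i)) k)) A.
    by apply: l2le_csg; [exact: wtN|exact: l2le_cut_wt].
  have eA : 0 <= 6 * eta * A by rewrite !mulr_ge0.
  have eL : 0 <= 2 * eta * Lam by rewrite !mulr_ge0.
  have step (f : int -> R) F (x y : R) : 0 <= x -> x <= y -> l2le f F ->
      l2le (fun k => f k * x) (F * y).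
    by move=> x0 xy fF; apply: l2leM => [|//|i]; [exact: le_trans xy|rewrite ger0_norm].
  have -> : (16 * Lam * A + 12 * A * A) * eta =
     (A * (2 * eta * Lam) + (6 * eta * Lam) * A + A * (6 * eta * A)) +
     ((6 * eta * Lam) * A + A * (2 * eta * Lam) + A * (6 * eta * A)) by ring.
  apply: (@l2le_mono _ _ _ (fun k =>
     (nc (csg e2 (cut (c (n * m + l)%N)) k) * (2 * eta * Lam)
      + u k * nc (csg e1 (cut (c (n * m)%N)) 0)
      + (wt s k * nc (csg e2 (cut (c (n * m)%N)) k)) *
        (6 * eta * nc (csg e1 (cut (c (n * m)%N)) 0))) +
     (u k * nc (csg e2 (cut (c (n * m + l)%N)) 0)
      + nc (csg e1 (cut (c (n * m)%N)) k) * (2 * eta * Lam)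
      + (wt s k * nc (csg e1 (cut (c (n * m)%N)) k)) *
        (6 * eta * nc (csg e2 (cut (c (n * m)%N)) 0))))).
    move=> k; rewrite le_eqVlt; apply/orP; left; apply/eqP; congr (`| _ |).
    by rewrite /D subrr subr0 !jsq0 !wt0; field; rewrite gt_eqF // (lt_le_trans ltr01 (jsq_ge1 _ _)).
  by do ?[apply: l2leD]; apply: step => //; try exact: l2le_u;
    rewrite ?nc_ge0 ?mulr_ge0 ?nc_ge0 ?ler_wpM2l ?mulr_ge0.
apply: (l2le_mono _ (l2le_blocks K0 NT DK)) => k.
have [ck|_] := boolP (chi k); last by rewrite normr0.
apply: le_trans _ (ler_norm _); rewrite ger0_norm ?nc_ge0 //.
apply: (@blocks_le (fun i => bilR e1 e2 (i%:R * h) (cut (c i)) (cut (c i)) k)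
  (fun n => bilR e1 e2 (n%:R * tau) (cut (c (n * m)%N)) (cut (c (n * m)%N)) k)
  N (fun n l => D n l k 0 + D n l k k)) => n l lm.
rewrite /bilR -sumrB; apply: le_trans (nc_sum _ _ _) _.
apply: le_trans _ (res_sum ck (D0 n l k)); apply: ler_sum => j _.
apply: le_trans _ (step_time e1 e2 k j (n * m) (ltnW lm)).
by have -> : n%:R * tau = (n * m)%:R * h by rewrite tauE natrM mulrA.
Qed.
Definition rhs t a k : R[i] := lin t a k + nonlin J t a k.

(** Uniform in [k] only, which is enough because it serves to bound increments of the error.
    Removing the high frequencies costs [eta A] in one factor; the change in time is then
    [step_time] summed by Cauchy-Schwarz. *)
Lemma nonlin_time i l k : (l <= m)%N ->
  nc (nonlin J ((i + l)%:R * h) (c (i + l)%N) k - nonlin J (i%:R * h) (cut (c i)) k)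
   <= 4 * (eta * (8 * A * A + 12 * Lam * A)).
Proof.
move=> lm; have A0 := A_ge0.
have w0 k' := ltW (wt_gt0 Hs k' : 0 < wt s k' :> R).
rewrite /nonlin -mulrBr Normc.normcM -[leRHS]mul1r.
apply: ler_pM; rewrite ?nc_ge0 ?nc_mult // -sumrB.
apply: sum_bool2_le => -[e1 e2] /=.
set c' := c (i + l)%N; set t' := (i + l)%:R * h; set t := i%:R * h.
rewrite -[X in nc X](subrKA (bil e1 e2 J t' (cut c') (cut c') k)).
apply: le_trans (le_normcD _ _) _.
have -> : eta * (8 * A * A + 12 * Lam * A) = (eta * A * A + A * (eta * A)) +
  ((6 * eta * Lam) * A + A * (6 * eta * Lam) + 6 * eta * (A * A)) by ring.
apply: lerD.
  rewrite bil_diff; apply: le_trans (le_normcD _ _) _; apply: lerD; apply: bil_sup => //.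
  - exact: l2le_high.
  - exact: l2le_c.
  - exact: l2le_cut.
  - exact: l2le_high.
rewrite /bil -sumrB; apply: le_trans (nc_sum _ _ _) _.
apply: (@le_trans _ _ (\sum_(j <- J) (u j * nc (csg e2 (cut c') (k - j))
     + nc (csg e1 (cut (c i)) j) * u (k - j)
     + 6 * eta * ((wt s j * nc (csg e1 (cut (c i)) j)) *
                 (wt s (k - j) * nc (csg e2 (cut (c i)) (k - j))))))).
  by apply: ler_sum => j _; exact: step_time.
rewrite !big_split /= -mulr_sumr.
have l2c e i' : l2le (fun k => nc (csg e (cut (c i')) k)) A by exact/l2n_csg/l2le_cut.
have l2w e : l2le (fun k => wt s k * nc (csg e (cut (c i)) k)) A.
  by apply: l2le_csg; [exact: wtN|exact: l2le_cut_wt].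
have cs (f g : int -> R) F G : (forall j, 0 <= f j) -> (forall j, 0 <= g j) ->
    l2le f F -> l2le g G -> \sum_(j <- J) f j * g (k - j) <= F * G.
  move=> f0 g0 fF gG; apply: le_trans _ (l2le_cs fF (l2le_refl k gG) uJ).
  by apply: ler_sum => j _; rewrite !ger0_norm.
apply: lerD; first apply: lerD.
- by apply: (cs (fun j => u j) (fun j => nc (csg e2 (cut c') j))) => [j|j||];
    [exact: u_ge0|exact: nc_ge0|exact: l2le_u|exact: l2c].
- by apply: (cs (fun j => nc (csg e1 (cut (c i)) j)) (fun j => u j)) => [j|j||];
    [exact: nc_ge0|exact: u_ge0|exact: l2c|exact: l2le_u].
- rewrite ler_wpM2l ?mulr_ge0 //.
  by apply: (cs (fun j => wt s j * nc (csg e1 (cut (c i)) j))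
    (fun j => wt s j * nc (csg e2 (cut (c i)) j))) => [j|j||];
    rewrite ?mulr_ge0 ?nc_ge0 ?w0.
Qed.

Lemma omega_ge_jsq k : jsq R k / 2 <= omega R k.
Proof. by have := omega_ge R k; have := omega_ge1 R k; rewrite /jsq; lra. Qed.

(** The factor [1 / omega] of [lin] does two things: it makes the uniform bound on the increments of
    [c] decay like [<k>^-2], and it cancels the frequency [2 omega] of the phase. *)
Lemma lin_time i l k : (l <= m)%N -> low k ->
  nc (lin ((i + l)%:R * h) (c (i + l)%N) k - lin (i%:R * h) (cut (c i)) k)
   <= 2 * (tau * Lam) / jsq R k + tau * nc (c i (- k)).
Proof.
move=> lm lk.
have w0 := omega_gt0 R k; have j0 := lt_le_trans ltr01 (jsq_ge1 R k).
have -> : lin (i%:R * h) (cut (c i)) k = lin (i%:R * h) (c i) k.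
  by rewrite /lin /cut lowN lk.
set t' := (i + l)%:R * h; set t := i%:R * h.
rewrite -[X in nc X](subrKA (lin t' (c i) k)).
apply: le_trans (le_normcD _ _) _; apply: lerD.
  rewrite linB; apply: le_trans (nc_lin _ _ _) _.
  have d1 := block_diff i k lm; have d2 := block_diff i (- k) lm.
  rewrite wtN in d2.
  have h1 : tau * Lam / wt s k <= tau * Lam.
    by rewrite ler_piMr ?wt_inv_le1 // mulr_ge0 // ltW.
  have h2 : (omega R k)^-1 <= 2 / jsq R k.
    rewrite -[2 / _]invf_div lef_pV2 ?posrE //; first exact: omega_ge_jsq.
    by rewrite divr_gt0.
  have n0 : 0 <= nc (c (i + l)%N k - c i k) + nc (c (i + l)%N (- k) - c i (- k)).
    by rewrite addr_ge0 ?nc_ge0.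
  apply: (@le_trans _ _ (2^-1 * (2 / jsq R k) * (2 * (tau * Lam)))); last first.
    by rewrite le_eqVlt; apply/orP; left; apply/eqP; field; rewrite gt_eqF.
  apply: ler_pM => //; first by rewrite mulr_ge0 // invr_ge0 ltW.
    by rewrite ler_wpM2l // invr_ge0.
  by rewrite mulr2n mulrDl !mul1r; apply: lerD; [apply: le_trans d1 h1|apply: le_trans d2 h1].
have lh0 : 0 <= l%:R * h by rewrite mulr_ge0 // ltW.
rewrite /lin -mulrBr opprD addrACA subrr add0r -mulrBl !Normc.normcM nc_conj.
rewrite mulrA ler_wpM2r ?nc_ge0 //.
rewrite normcN Normc.normcM nc_i Normc.normcV nc_nat mul1r nc_real ger0_norm; last first.
  by rewrite invr_ge0 ltW.
have -> : - (2 * t' * omega R k) = - (2 * t * omega R k) + - (l%:R * h * 2 * omega R k).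
  by rewrite /t' /t natrD; ring.
rewrite expiD -[X in _ - X]mulr1 -mulrBr Normc.normcM nc_expi mul1r.
apply: (@le_trans _ _ (2^-1 / omega R k * (l%:R * h * 2 * omega R k))).
  have i0 : 0 <= 2^-1 / omega R k by rewrite divr_ge0 // ltW.
  apply: ler_wpM2l => //.
  apply: le_trans (nc_expi_sub1_le _) _; rewrite normrN ger0_norm //.
  by rewrite mulr_ge0 ?mulr_ge0 // ltW.
apply: le_trans _ (lh_le_tau lm).
by rewrite le_eqVlt; apply/orP; left; apply/eqP; field; rewrite gt_eqF.
Qed.

Lemma l2le_lin_time i : l2le (fun k => 2 * (tau * Lam) / jsq R k + tau * nc (c i (- k)))
  (eta * (6 * Lam + A)).
Proof.
have A0 := A_ge0; have t0 := ltW tau0.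
apply: (@l2le_weak _ _ _ (3 * (2 * (tau * Lam)) + `|tau| * A)).
  rewrite ger0_norm //.
  have := ler_wpM2r (addr_ge0 (mulr_ge0 (ler0n R 6) Lam0) A0) tau_le_eta; lra.
apply: l2leD; first by apply: l2le_jsq; rewrite !mulr_ge0.
exact: (l2leZ tau (l2le_inj (oppr_inj (V := int)) (l2le_c i))).
Qed.

Variables (d : nat -> int -> R[i]) (eps T : R) (N : nat).
Hypothesis d0 : forall k, d 0%N k = cut (c 0%N) k.
Hypothesis dS : forall n k,
  d n.+1 k = if low k then d n k + tau%:C * rhs (n%:R * tau) (d n) k else 0.
Hypothesis cE : forall i k, (i < N * m)%N -> low k ->
  nc (c i.+1 k - c i k - h%:C * rhs (i%:R * h) (c i) k) <= h * eps.
(** The consistency error of the fine scheme is uniform in frequency; over the finitely many low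
    frequencies it amounts to at most [eta] in [l2]. *)
Hypothesis epsE : l2le (fun k => if low k then eps else 0) eta.
Hypothesis NT : (N * m)%:R * h <= T.

Definition err n k : R[i] := cut (c (n * m)%N) k - d n k.

Lemma eps_le_eta : eps <= eta.
Proof. by have := l2le_sup 0 epsE; rewrite low0; apply: le_trans; exact: ler_norm. Qed.

Lemma d_low n k : ~~ low k -> d n k = 0.
Proof.
by move=> /negbTE lk; case: n => [|n]; rewrite ?d0 ?dS /cut lk.
Qed.

Lemma err_low n k : ~~ low k -> err n k = 0.
Proof. by move=> lk; rewrite /err d_low // /cut (negbTE lk) subrr. Qed.

Lemma err0 k : err 0 k = 0.
Proof. by rewrite /err d0 mul0n subrr. Qed.

Lemma l2le_d n e : e <= 1 -> l2le (fun k => nc (err n k)) e ->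
  l2le (fun k => nc (d n k)) (A + 1).
Proof.
move=> e1 En; apply: l2le_weak (lerD (lexx A) e1) _.
apply: (l2le_mono _ (l2leD (l2le_cut (n * m)) En)) => k.
rewrite !ger0_norm ?addr_ge0 ?nc_ge0 //.
have -> : d n k = cut (c (n * m)%N) k - err n k by rewrite /err subKr.
exact: nc_sub.
Qed.

Lemma l2le_diff n e : l2le (fun k => nc (err n k)) e ->
  l2le (fun k => nc (cut (c (n * m)%N) k - d n k)) e.
Proof. by []. Qed.

Lemma rhs_sup t a F k : l2le (fun j => nc (a j)) F -> nc (rhs t a k) <= F + 4 * (F * F).
Proof.
move=> aF; apply: le_trans (le_normcD _ _) _; apply: lerD; last exact: nonlin_sup.
by have := l2le_sup k (l2le_lin t aF); rewrite ger0_norm ?nc_ge0.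
Qed.

Local Notation D := ((A + 1) + 4 * ((A + 1) * (A + 1))).

Lemma d_incr n e k : e <= 1 -> l2le (fun k => nc (err n k)) e ->
  nc (d n.+1 k - d n k) <= tau * D.
Proof.
move=> e1 En; have A0 := A_ge0; rewrite dS; case: ifPn => lk; last first.
  by rewrite d_low // subrr nc0 mulr_ge0 ?(ltW tau0) // !addr_ge0 ?mulr_ge0 ?addr_ge0.
rewrite addrAC subrr add0r Normc.normcM nc_real (gtr0_norm tau0).
rewrite ler_wpM2l ?(ltW tau0) //; exact: rhs_sup (l2le_d e1 En).
Qed.

Lemma ntau n : n%:R * tau = (n * m)%:R * h.
Proof. by rewrite tauE natrM mulrA. Qed.

Local Notation CE := (2 + (2 * Lam + A) + 4 * (8 * A * A + 12 * Lam * A) + 4 * (2 * A + 1)).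

Lemma CE_ge0 : 0 <= CE.
Proof. by have A0 := A_ge0; rewrite !addr_ge0 ?mulr_ge0 ?addr_ge0 ?mulr_ge0. Qed.

(** Over one step the error moves by [tau] times the local error plus the error itself, uniformly in
    [k]. The supremum norm is all that [l2le_variation] asks of increments, which is what allows the
    stability estimate to close in [l2]. The condition [e <= 1] bounds [d] and makes the quadratic
    term Lipschitz. *)
Lemma err_incr n e k : (n < N)%N -> e <= 1 -> l2le (fun k => nc (err n k)) e ->
  nc (err n.+1 k - err n k) <= tau * (CE * (eta + e)).
Proof.
move=> nN e1 En; have A0 := A_ge0; have e0 := l2le_ge0 En; have t0 := ltW tau0.
have [lk|lk] := boolP (low k); last first.
  by rewrite !err_low // subrr nc0 mulr_ge0 // mulr_ge0 ?CE_ge0 ?addr_ge0.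
have N0 : (0 < N)%N by exact: leq_ltn_trans nN.
(* The increment of [c] over a coarse step is the sum of its [m] fine increments. Each splits into
   the defect [rho] and the change of [rhs] since the start of the block; the last term compares
   [rhs] at the truncated solution and at [d]. *)
pose rho i := c i.+1 k - c i k - h%:C * rhs (i%:R * h) (c i) k.
have -> : err n.+1 k - err n k = \sum_(l < m) (rho (n * m + l)%N +
    h%:C * (rhs ((n * m + l)%:R * h) (c (n * m + l)%N) k -
            rhs ((n * m)%:R * h) (cut (c (n * m)%N)) k))
  + tau%:C * (rhs (n%:R * tau) (cut (c (n * m)%N)) k - rhs (n%:R * tau) (d n) k).
  have cutk i : cut (c i) k = c i k by rewrite /cut lk.
  rewrite /err dS lk !cutk mulSnr ntau.
  have -> : c (n * m + m)%N k = c (n * m)%N k +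
     \sum_(l < m) (c (n * m + l).+1 k - c (n * m + l)%N k).
    by rewrite -(telescope_ord (fun i => c i k)) addrC subrK.
  have -> : tau%:C = h%:C * \sum_(l < m) 1 :> R[i].
    by rewrite sumr_const card_ord -mulr_natr mul1r mulrC tauE rmorphM /= rmorph_nat.
  rewrite mulr_sumr !mulr_suml.
  have E (x y z w : R[i]) : x + y - (z + w) - (x - z) = y - w by ring.
  rewrite E -sumrB -big_split /=; apply: eq_bigr => l _; rewrite /rho; ring.
apply: le_trans (le_normcD _ _) _.
have tm (x : R) : tau * x = \sum_(l < m) h * x.
  by rewrite sumr_const card_ord -mulr_natl mulrA -tauE.
apply: (@le_trans _ _ (tau * (eps + (eta * (2 * Lam + A) + 4 * (eta * (8 * A * A + 12 * Lam * A))))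
   + tau * (e + 4 * (e * (A + (A + 1)))))); last first.
  rewrite -mulrDr ler_wpM2l //; have := eps_le_eta; have := eta0.
  have h2 : 0 <= e * ((2 * Lam + A) + 4 * (8 * A * A + 12 * Lam * A)).
    by rewrite mulr_ge0 // !addr_ge0 ?mulr_ge0 ?addr_ge0 ?mulr_ge0.
  have h3 : 0 <= eta * (4 * (2 * A + 1)) by rewrite !mulr_ge0 ?addr_ge0 ?mulr_ge0.
  lra.
apply: lerD.
  rewrite tm; apply: le_trans (nc_sum _ _ _) _; apply: ler_sum => l _.
  rewrite [leRHS]mulrDr.
  apply: le_trans (le_normcD _ _) _; apply: lerD.
    apply: cE lk; apply: leq_trans (leq_mul nN (leqnn m)).
    by rewrite mulSnr -addnS leq_add2l.
  rewrite Normc.normcM nc_real (gtr0_norm h0) ler_wpM2l ?(ltW h0) //.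
  rewrite /rhs opprD addrACA; apply: le_trans (le_normcD _ _) _; apply: lerD.
    apply: le_trans (lin_time (n * m) (ltnW (ltn_ord l)) lk) _.
    have j1 := jsq_ge1 R k.
    have : 2 * (tau * Lam) / jsq R k <= 2 * (tau * Lam).
      by rewrite ler_piMr ?mulr_ge0 // invf_le1 // (lt_le_trans ltr01).
    have : tau * nc (c (n * m)%N (- k)) <= tau * A.
      by rewrite ler_wpM2l //; have := l2le_sup (- k) (l2le_c (n * m)); rewrite ger0_norm ?nc_ge0.
    have := ler_wpM2r (addr_ge0 (mulr_ge0 (ler0n R 2) Lam0) A0) tau_le_eta; lra.
  exact: nonlin_time (ltnW (ltn_ord l)).
rewrite Normc.normcM nc_real (gtr0_norm tau0) ler_wpM2l //.
rewrite /rhs opprD addrACA; apply: le_trans (le_normcD _ _) _; apply: lerD.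
  by rewrite linB; have := l2le_sup k (l2le_lin (n%:R * tau) (l2le_diff En));
    rewrite ger0_norm ?nc_ge0.
apply: nonlin_diff_sup => //; [exact: l2le_cut|exact: l2le_d e1 En].
Qed.
Lemma bilN_diff e1 e2 t a b k :
  bilN e1 e2 t a a k - bilN e1 e2 t b b k =
  bilN e1 e2 t (fun i => a i - b i) a k + bilN e1 e2 t b (fun i => a i - b i) k.
Proof.
rewrite /bilN -sumrB -big_split /=; apply: eq_bigr => j _; rewrite !csgB; ring.
Qed.

Lemma bilR_diff e1 e2 t a b k :
  bilR e1 e2 t a a k - bilR e1 e2 t b b k =
  bilR e1 e2 t (fun i => a i - b i) a k + bilR e1 e2 t b (fun i => a i - b i) k.
Proof.
rewrite /bilR -sumrB -big_split /=; apply: eq_bigr => j _; rewrite !csgB; ring.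
Qed.

Lemma variation_if (b : bool) (x : nat -> R[i]) n :
  variation (fun i => if b then x i else 0) n <= variation x n.
Proof.
case: b => //; rewrite [leLHS](_ : _ = 0) ?variation_ge0 //.
by rewrite /variation nc0 big1 ?addr0 // => i _; rewrite subrr nc0.
Qed.

Lemma csg_low0 e a j : (forall k, ~~ low k -> a k = 0) -> ~~ low j -> csg e a j = 0.
Proof. by move=> a0 lj; apply: csg_eq0; apply: a0; rewrite ?lowN. Qed.

Lemma osc_bilN e1 e2 k n (a b : nat -> int -> R[i]) : chi k ->
  (forall i j, ~~ low j -> a i j = 0) -> (forall i j, ~~ low j -> b i j = 0) ->
  tau * nc (\sum_(l < n.+1) bilN e1 e2 (l%:R * tau) (a l) (b l) k) <=
  3 * \sum_(j <- J) hs R e1 e2 (k, j) *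
     variation (fun i => csg e1 (a i) j * csg e2 (b i) (k - j)) n.
Proof.
move=> ck a0 b0.
pose x i j := if nonres k j then csg e1 (a i) j * csg e2 (b i) (k - j) else 0.
have Hx j : (forall i, x i j = 0) \/ nonres k j /\ `|tau * theta R e1 e2 k j| <= 4.
  rewrite /x; have [nr|nr] := boolP (nonres k j); last by left.
  have [lj|lj] := boolP (low j); last by left=> i; rewrite (csg_low0 _ (a0 i) lj) mul0r.
  have [lkj|lkj] := boolP (low (k - j)); last first.
    by left=> i; rewrite (csg_low0 _ (b0 i) lkj) mulr0.
  by right; split=> //; exact: phase4 tau0 (lexx _) (chi_low ck) lj lkj.
have := (@osc_sum_bound e1 e2 k tau n x tau0 Hx).2.
have -> : \sum_(i < n.+1) \sum_(j <- J) expi (- (i%:R * tau * theta R e1 e2 k j)) * x i j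
   = \sum_(l < n.+1) bilN e1 e2 (l%:R * tau) (a l) (b l) k.
  apply: eq_bigr => i _; rewrite /bilN [RHS]big_mkcond; apply: eq_bigr => j _.
  by rewrite /x; case: ifP => // _; rewrite mulr0.
move=> H; apply: le_trans H _; rewrite ler_wpM2l //; apply: ler_sum => j _.
by rewrite ler_wpM2l ?hs_ge0 //; exact: variation_if.
Qed.

(** * Stability: replacing the solution by the scheme in the bilinear sums *)

Section Stability.
Variables (n : nat) (ev : nat -> R).
Hypothesis nN : (n <= N)%N.
Hypothesis ev1 : forall l, (l < n)%N -> ev l <= 1.
Hypothesis errE : forall l, (l < n)%N -> l2le (fun k => nc (err l k)) (ev l).

Let ev0 l : (l < n)%N -> 0 <= ev l.
Proof. by move=> /errE; exact: l2le_ge0. Qed.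

Let T0 : 0 <= T.
Proof. by apply: le_trans NT; rewrite mulr_ge0 // ltW. Qed.

Lemma cut_block_c l j : nc (cut (c (l.+1 * m)%N) j - cut (c (l * m)%N) j) <= tau * Lam.
Proof.
rewrite cutB; apply: le_trans (nc_cut _ _) _; rewrite mulSnr.
apply: le_trans (block_diff (l * m) j (leqnn m)) _.
by rewrite ler_piMr ?wt_inv_le1 // mulr_ge0 // ltW.
Qed.

Lemma csg_err_incr e l j : (l < n)%N ->
  nc (csg e (err l.+1) j - csg e (err l) j) <= tau * (CE * (eta + ev l)).
Proof.
move=> ln; rewrite -csgB.
apply: (@csg_le _ _ _ (fun=> tau * (CE * (eta + ev l)))) => // k.
by apply: err_incr; [exact: leq_trans nN|exact: ev1|exact: errE].
Qed.

(** Here [f] stands for the error. Its final value in the boundary term is bounded by the sum of its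
    increments from 0, not by [ev n']: the latter would carry no factor [tau] and could not be
    absorbed by Gronwall's lemma. *)
Lemma stab_part e1 e2 n' (f g : nat -> int -> int -> R[i]) (G Dg : R) : n = n'.+1 ->
  0 <= G -> 0 <= Dg ->
  (forall i k, (i < n)%N -> l2le (fun j => nc (g i k j)) G) ->
  (forall i k j, (i < n')%N -> nc (g i.+1 k j - g i k j) <= tau * Dg) ->
  (forall i k, (i < n)%N -> l2le (fun j => nc (f i k j)) (ev i)) ->
  (forall i k j, (i < n')%N -> nc (f i.+1 k j - f i k j) <= tau * (CE * (eta + ev i))) ->
  (forall k j, f 0%N k j = 0) ->
  l2le (fun k => 3 * \sum_(j <- J) hs R e1 e2 (k, j) *
     variation (fun i => f i k j * g i k j) n')
   (12 * (2 * G * CE + Dg) * \sum_(l < n) tau * (eta + ev l)).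
Proof.
move=> nE G0 Dg0 gG gi fE fi f0; have t0 := ltW tau0.
have n'n i : (i < n')%N -> (i < n)%N by rewrite nE => /ltnW; rewrite ltnS.
have del0 i : (i < n')%N -> 0 <= tau * (CE * (eta + ev i)).
  by move=> i_n; rewrite !mulr_ge0 ?CE_ge0 ?addr_ge0 ?ev0 ?n'n.
have S0 : 0 <= \sum_(i < n') tau * (CE * (eta + ev i)).
  by apply: sumr_ge0 => i _; exact: del0.
have fn k j : nc (f n' k j) <= \sum_(i < n') tau * (CE * (eta + ev i)).
  have := telescope_ord (fun i => f i k j) 0 n'.
  rewrite add0n f0 subr0 => ->; apply: le_trans (nc_sum _ _ _) _.
  by apply: ler_sum => i _; rewrite add0n; exact: fi.
have f00 k j : nc (f 0%N k j) <= 0 by rewrite f0 nc0.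
have gG' i k : (i <= n')%N -> l2le (fun j => nc (g i k j)) G.
  by move=> i_n; apply: gG; rewrite nE ltnS.
have := @l2le_variation R J e1 e2 n' f g 0 _ G ev _ _ uJ (lexx 0) S0 del0
  (fun _ _ => mulr_ge0 t0 Dg0) gG'
  (fun i k i_n => fE i k (n'n i i_n)) f00 fn fi gi.
move=> /(l2leZ 3); rewrite (ger0_norm (ler0n _ 3)); apply: l2le_weak.
rewrite mul0r addr0 mulr_suml -big_split /= nE big_ord_recr /= [leRHS]mulrDr.
have t1 : 0 <= 12 * (2 * G * CE + Dg) * (tau * (eta + ev n')).
  by rewrite !mulr_ge0 ?addr_ge0 ?mulr_ge0 ?CE_ge0 ?ev0 ?nE.
apply: le_trans (lerD (lexx _) t1); rewrite addr0 !mulr_sumr.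
apply: ler_sum => i _.
have p1 : 0 <= Dg * (tau * eta) by rewrite !mulr_ge0.
have p2 : 0 <= tau * ev i by rewrite mulr_ge0 // ev0 ?n'n.
lra.
Qed.

Lemma stab_nonres e1 e2 :
  l2le (fun k => if chi k then nc (tau%:C * \sum_(l < n)
     (bilN e1 e2 (l%:R * tau) (cut (c (l * m)%N)) (cut (c (l * m)%N)) k
      - bilN e1 e2 (l%:R * tau) (d l) (d l) k)) else 0)
   ((12 * (2 * A * CE + Lam) + 12 * (2 * (A + 1) * CE + D)) *
     \sum_(l < n) tau * (eta + ev l)).
Proof.
have A0 := A_ge0; have t0 := ltW tau0; have CE0 := CE_ge0.
have D0 : 0 <= D by rewrite !addr_ge0 ?mulr_ge0 ?addr_ge0.
have A10 : 0 <= A + 1 by rewrite addr_ge0.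
have [nE|[n' nE]] : n = 0%N \/ exists n', n = n'.+1.
  by case: n => [|n']; [left|right; exists n'].
  rewrite nE big_ord0 mulr0; apply: (@l2le_mono _ _ _ (fun=> 0)); last exact: l2le0.
  by move=> k; rewrite big_ord0 mulr0 nc0 if_same.
have l2d i : (i < n)%N -> l2le (fun k => nc (d i k)) (A + 1).
  by move=> i_n; apply: l2le_d (ev1 i_n) (errE i_n).
have n'n i : (i < n')%N -> (i < n)%N by rewrite nE => /ltnW; rewrite ltnS.
have P1 := @stab_part e1 e2 n' (fun i k j => csg e1 (err i) j)
  (fun i k j => csg e2 (cut (c (i * m)%N)) (k - j)) A Lam nE A0 Lam0.
have P2 := @stab_part e1 e2 n' (fun i k j => csg e2 (err i) (k - j))
  (fun i k j => csg e1 (d i) j) (A + 1) D nE A10 D0.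
rewrite mulrDl.
apply: (l2le_mono _ (l2leD (P1 _ _ _ _ _) (P2 _ _ _ _ _))); first last.
- by move=> k j; apply: csg_eq0; exact: err0.
- by move=> i k j i_n; apply: csg_err_incr; exact: n'n.
- by move=> i k i_n; apply: (l2le_refl (f := fun j => nc (csg e2 (err i) j)) k);
    exact/l2n_csg/errE.
- move=> i k j i_n; rewrite -csgB.
  apply: (@csg_le _ _ _ (fun=> tau * D)) => // k'.
  by apply: d_incr (ev1 (n'n _ i_n)) (errE (n'n _ i_n)).
- by move=> i k i_n; exact/l2n_csg/l2d.
- by move=> k j; apply: csg_eq0; exact: err0.
- by move=> i k j i_n; apply: csg_err_incr; exact: n'n.
- by move=> i k i_n; exact/l2n_csg/errE.
- move=> i k j i_n; rewrite -csgB.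
  by apply: (@csg_le _ _ _ (fun=> tau * Lam)) => // k'; exact: cut_block_c.
- by move=> i k i_n; apply: (l2le_refl (f := fun j => nc (csg e2 (cut (c (i * m)%N)) j)) k);
    exact/l2n_csg/l2le_cut.
move=> k; have [ck|_] := boolP (chi k); last by rewrite normr0.
apply: le_trans _ (ler_norm _).
rewrite ger0_norm ?nc_ge0 // Normc.normcM nc_real (gtr0_norm tau0).
under eq_bigr do rewrite bilN_diff.
rewrite big_split /=.
apply: le_trans (ler_wpM2l t0 (le_normcD _ _)) _.
rewrite mulrDr nE; apply: lerD.
  apply: (osc_bilN (a := err) (b := fun l => cut (c (l * m)%N)) e1 e2 n' ck).
    exact: err_low.
  by move=> i j /negbTE lj; rewrite /cut lj.
rewrite [leRHS](_ : _ = 3 * \sum_(j <- J) hs R e1 e2 (k, j) *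
  variation (fun i => csg e1 (d i) j * csg e2 (err i) (k - j)) n'); last first.
  congr (_ * _); apply: eq_bigr => j _; congr (_ * variation _ _).
  by apply/funext => i; rewrite mulrC.
apply: (osc_bilN (a := d) (b := err) e1 e2 n' ck); [exact: d_low|exact: err_low].
Qed.

Lemma stab_res e1 e2 :
  l2le (fun k => if chi k then nc (tau%:C * \sum_(l < n)
     (bilR e1 e2 (l%:R * tau) (cut (c (l * m)%N)) (cut (c (l * m)%N)) k
      - bilR e1 e2 (l%:R * tau) (d l) (d l) k)) else 0)
   (\sum_(l < n) tau * (4 * (A + 1) * ev l)).
Proof.
have A0 := A_ge0; have t0 := ltW tau0.
have A10 : 0 <= A + 1 by rewrite addr_ge0.
pose F l k j := nc (csg e1 (err l) j) * nc (csg e2 (cut (c (l * m)%N)) (k - j))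
   + nc (csg e1 (d l) j) * nc (csg e2 (err l) (k - j)).
have F0 l k j : 0 <= F l k j by rewrite /F addr_ge0 ?mulr_ge0 ?nc_ge0.
have FE l : (l < n)%N -> l2le (fun k => F l k 0 + F l k k) (4 * (A + 1) * ev l).
  move=> ln; have e0 := ev0 ln.
  have l2d e : l2le (fun k => nc (csg e (d l) k)) (A + 1).
    exact/l2n_csg/(l2le_d (ev1 ln) (errE ln)).
  have l2c e : l2le (fun k => nc (csg e (cut (c (l * m)%N)) k)) (A + 1).
    by apply: (@l2le_weak _ _ _ A); rewrite ?lerDl //; exact/l2n_csg/l2le_cut.
  have l2e e : l2le (fun k => nc (csg e (err l) k)) (ev l) by exact/l2n_csg/errE.
  have step (f g : int -> R[i]) (X Y : R) j : l2le (fun k => nc (f k)) X ->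
     l2le (fun k => nc (g k)) Y -> l2le (fun k => nc (f k) * nc (g j)) (X * Y).
    move=> fX gY; apply: l2leM => [|//|i]; first exact: l2le_ge0 gY.
    exact: (l2le_sup j gY).
  have -> : 4 * (A + 1) * ev l = ((A + 1) * ev l + ev l * (A + 1)) +
     (ev l * (A + 1) + (A + 1) * ev l) by ring.
  apply: (@l2le_mono _ _ _ (fun k =>
    (nc (csg e2 (cut (c (l * m)%N)) k) * nc (csg e1 (err l) 0)
     + nc (csg e2 (err l) k) * nc (csg e1 (d l) 0))
    + (nc (csg e1 (err l) k) * nc (csg e2 (cut (c (l * m)%N)) 0)
     + nc (csg e1 (d l) k) * nc (csg e2 (err l) 0)))).
    move=> k; rewrite le_eqVlt; apply/orP; left; apply/eqP; congr (`| _ |).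
    by rewrite /F subrr subr0; ring.
  by apply: l2leD; apply: l2leD; apply: step.
apply: (l2le_mono _ (@l2le_sum_nat _ _ n (fun l k => tau * (F l k 0 + F l k k))
   (fun l => tau * (4 * (A + 1) * ev l)) _)); last first.
  by move=> l ln; rewrite -{2}(gtr0_norm tau0); exact/l2leZ/FE.
move=> k; have [ck|_] := boolP (chi k); last by rewrite normr0.
apply: le_trans _ (ler_norm _).
rewrite ger0_norm ?nc_ge0 // Normc.normcM nc_real (gtr0_norm tau0) -mulr_sumr.
rewrite ler_wpM2l //; apply: le_trans (nc_sum _ _ _) _; apply: ler_sum => l _.
rewrite bilR_diff; apply: le_trans _ (res_sum ck (F0 l k)).
apply: le_trans (le_normcD _ _) _; rewrite /F big_split /=; apply: lerD;
  rewrite /bilR; apply: le_trans (nc_sum _ _ _) _; apply: ler_sum => j _;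
  by rewrite !Normc.normcM nc_expi mul1r.
Qed.

Lemma nT : (n * m)%:R * h <= T.
Proof.
by apply: le_trans NT; rewrite ler_wpM2r ?(ltW h0) // ler_nat leq_mul2r nN orbT.
Qed.

Lemma lin_sum :
  l2le (fun k => if low k then nc (h%:C * \sum_(i < n * m) lin (i%:R * h) (c i) k
     - tau%:C * \sum_(l < n) lin (l%:R * tau) (d l) k) else 0)
   (T * (eta * (6 * Lam + A)) + \sum_(l < n) tau * ev l).
Proof.
have A0 := A_ge0; have t0 := ltW tau0.
have K0 : 0 <= eta * (6 * Lam + A) by rewrite mulr_ge0 // addr_ge0 // mulr_ge0.
have B1 := @l2le_blocks n (fun n l k => 2 * (tau * Lam) / jsq R k
   + tau * nc (c (n * m)%N (- k))) _ T K0 nT (fun n l _ => l2le_lin_time (n * m)).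
have B2 := @l2le_sum_nat R _ n (fun l k => tau * nc (lin (l%:R * tau) (err l) k))
   (fun l => tau * ev l).
apply: (l2le_mono _ (l2leD B1 (B2 _))); last first.
  move=> l ln; have -> : tau * ev l = `|tau| * ev l by rewrite gtr0_norm.
  exact/l2leZ/l2le_lin/errE.
move=> k; have [lk|_] := boolP (low k); last by rewrite normr0.
apply: le_trans _ (ler_norm _); rewrite ger0_norm ?nc_ge0 //.
rewrite -(subrKA (tau%:C * \sum_(l < n) lin (l%:R * tau) (cut (c (l * m)%N)) k)).
apply: le_trans (le_normcD _ _) _; apply: lerD.
  apply: (@blocks_le (fun i => lin (i%:R * h) (c i) k)
    (fun l => lin (l%:R * tau) (cut (c (l * m)%N)) k) n
    (fun n l => 2 * (tau * Lam) / jsq R k + tau * nc (c (n * m)%N (- k)))) => p l lm.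
  by rewrite ntau; exact: lin_time (ltnW lm) lk.
rewrite -mulrBr -sumrB Normc.normcM nc_real (gtr0_norm tau0) -mulr_sumr.
rewrite ler_wpM2l //; apply: le_trans (nc_sum _ _ _) _; apply: ler_sum => l _.
by rewrite linB.
Qed.

Lemma err_sum k : low k -> err n k =
  \sum_(i < n * m) (c i.+1 k - c i k - h%:C * rhs (i%:R * h) (c i) k)
  + (h%:C * \sum_(i < n * m) rhs (i%:R * h) (c i) k
     - tau%:C * \sum_(l < n) rhs (l%:R * tau) (d l) k).
Proof.
move=> lk; rewrite /err /cut lk.
have cs : \sum_(i < n * m) (c i.+1 k - c i k) = c (n * m)%N k - c 0%N k.
  have := telescope_ord (fun i => c i k) 0 (n * m); rewrite add0n => ->.
  by apply: eq_bigr => i _; rewrite add0n.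
have ds : tau%:C * (\sum_(l < n) rhs (l%:R * tau) (d l) k) = d n k - c 0%N k.
  have := telescope_ord (fun l => d l k) 0 n; rewrite add0n d0 /cut lk => ->.
  by rewrite mulr_sumr; apply: eq_bigr => l _; rewrite add0n dS lk addrAC subrr add0r.
rewrite sumrB -mulr_sumr ds cs; ring.
Qed.

Local Notation K0 := (1 * T + T * (6 * Lam + A) +
  4 * (24 * (A * A + A * Lam * T + (A * A + A * Lam * T))
     + 144 * (A * A + A * Lam * T) + T * (16 * Lam * A + 12 * A * A))).
Local Notation K1 := (1 + 4 * ((12 * (2 * A * CE + Lam) + 12 * (2 * (A + 1) * CE + D))
   + 4 * (A + 1))).

Lemma err_bound : l2le (fun k => nc (err n k))
  (K0 * eta + K1 * \sum_(l < n) tau * (eta + ev l)).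
Proof.
have A0 := A_ge0; have t0 := ltW tau0; have T0' := T0.
pose X e k := h%:C * \sum_(i < n * m) bil e.1 e.2 J (i%:R * h) (c i) (c i) k
   - tau%:C * \sum_(l < n) bil e.1 e.2 J (l%:R * tau) (d l) (d l) k : R[i].
have XE (e : bool * bool) : l2le (fun k => if chi k then nc (X e k) else 0)
   (24 * (A * A + A * Lam * T + (A * A + A * Lam * T)) * eta +
    (144 * (A * A + A * Lam * T) * eta + T * ((16 * Lam * A + 12 * A * A) * eta)) +
    ((12 * (2 * A * CE + Lam) + 12 * (2 * (A + 1) * CE + D)) *
     (\sum_(l < n) tau * (eta + ev l)) + \sum_(l < n) tau * (4 * (A + 1) * ev l))).
  case: e => e1 e2.
  apply: (l2le_mono _ (l2leD (l2leD (trunc_bound e1 e2 nT)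
    (l2leD (time_nonres e1 e2 nT) (time_res e1 e2 nT)))
    (l2leD (stab_nonres e1 e2) (stab_res e1 e2)))) => k.
  have [ck|_] := boolP (chi k); last by rewrite !addr0.
  apply: le_trans _ (ler_norm _); rewrite ger0_norm ?nc_ge0 //.
  have -> : X (e1, e2) k =
     (h%:C * \sum_(i < n * m) (bil e1 e2 J (i%:R * h) (c i) (c i) k -
        bil e1 e2 J (i%:R * h) (cut (c i)) (cut (c i)) k)) +
     ((h%:C * \sum_(i < n * m) bilN e1 e2 (i%:R * h) (cut (c i)) (cut (c i)) k -
       tau%:C * \sum_(l < n) bilN e1 e2 (l%:R * tau) (cut (c (l * m)%N)) (cut (c (l * m)%N)) k) +
      (h%:C * \sum_(i < n * m) bilR e1 e2 (i%:R * h) (cut (c i)) (cut (c i)) k -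
       tau%:C * \sum_(l < n) bilR e1 e2 (l%:R * tau) (cut (c (l * m)%N)) (cut (c (l * m)%N)) k)) +
     (tau%:C * \sum_(l < n)
       (bilN e1 e2 (l%:R * tau) (cut (c (l * m)%N)) (cut (c (l * m)%N)) k -
        bilN e1 e2 (l%:R * tau) (d l) (d l) k) +
      tau%:C * \sum_(l < n)
       (bilR e1 e2 (l%:R * tau) (cut (c (l * m)%N)) (cut (c (l * m)%N)) k -
        bilR e1 e2 (l%:R * tau) (d l) (d l) k)).
    rewrite /X /= !sumrB.
    under [\sum_(i < n * m) bil _ _ _ _ (cut _) _ _]eq_bigr do rewrite bilE.
    under [\sum_(l < n) bil _ _ _ _ (d _) _ _]eq_bigr do rewrite bilE.
    rewrite !big_split /=; ring.
  apply: le_trans (le_normcD _ _) _; apply: lerD; last exact: le_normcD.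
  apply: le_trans (le_normcD _ _) _; apply: lerD => //; exact: le_normcD.
have XS := l2le_sum (index_enum (bool * bool)%type) XE.
have RS : l2le (fun k => if low k then nc (\sum_(i < n * m)
    (c i.+1 k - c i k - h%:C * rhs (i%:R * h) (c i) k)) else 0) (T * eta).
  apply: (@l2le_weak _ _ _ (`|(n * m)%:R * h| * eta)).
    by rewrite ger0_norm ?mulr_ge0 ?(ltW h0) // ler_wpM2r // nT.
  apply: (l2le_mono _ (l2leZ _ epsE)) => k.
  have [lk|_] := boolP (low k); last by rewrite mulr0.
  apply: le_trans _ (ler_norm _); rewrite ger0_norm ?nc_ge0 //.
  apply: le_trans (nc_sum _ _ _) _.
  rewrite -mulrA mulr_natl -[X in _ *+ X]card_ord -sumr_const.
  apply: ler_sum => i _; apply: cE lk.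
  by apply: leq_trans (ltn_ord i) _; rewrite leq_mul2r nN orbT.
apply: (l2le_mono _ (l2le_weak _ (l2leD (l2leD RS lin_sum) XS))); last first.
  have E4 (y : R) : y *+ (2 * 2) = 4 * y by exact: esym (mulr_natl y 4).
  rewrite sumr_const card_prod card_bool E4.
  set S2 := \sum_(l < n) tau * (eta + ev l).
  have -> : \sum_(l < n) tau * (4 * (A + 1) * ev l) =
      4 * (A + 1) * \sum_(l < n) tau * ev l.
    by rewrite mulr_sumr; apply: eq_bigr => l _; ring.
  have S12 : \sum_(l < n) tau * ev l <= S2.
    by apply: ler_sum => l _; rewrite ler_wpM2l // lerDr.
  have A10 : 0 <= A + 1 by rewrite addr_ge0.
  have := ler_wpM2l A10 S12.
  set S1 := \sum_(l < n) tau * ev l in S12 *; lra.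
move=> k; have [lk|lk] := boolP (low k); last first.
  by rewrite err_low // nc0 normr0.
apply: le_trans _ (ler_norm _); rewrite ger0_norm ?nc_ge0 // err_sum //.
rewrite -addrA; apply: le_trans (le_normcD _ _) _; rewrite lerD2l.
have -> : h%:C * (\sum_(i < n * m) rhs (i%:R * h) (c i) k) -
    tau%:C * (\sum_(l < n) rhs (l%:R * tau) (d l) k) =
  (h%:C * (\sum_(i < n * m) lin (i%:R * h) (c i) k)
     - tau%:C * (\sum_(l < n) lin (l%:R * tau) (d l) k))
  + mult R k * \sum_e X e k.
  have -> : mult R k * \sum_e X e k = h%:C * (\sum_(i < n * m) nonlin J (i%:R * h) (c i) k)
      - tau%:C * (\sum_(l < n) nonlin J (l%:R * tau) (d l) k).
    rewrite /X sumrB -!mulr_sumr mulrBr; congr (_ - _).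
      by rewrite mulrCA exchange_big /= [mult R k * _]mulr_sumr.
    by rewrite mulrCA exchange_big /= [mult R k * _]mulr_sumr.
  rewrite /rhs !big_split /=; ring.
apply: le_trans (le_normcD _ _) _; rewrite lerD2l Normc.normcM.
(* The estimates on [X] hold for [chi k] only; at frequency 0 the multiplier removes the quadratic
   term. *)
have [->|k0] := eqVneq k 0.
  rewrite mult0 nc0 mul0r; apply: sumr_ge0 => e _.
  by case: ifP => // _; exact: nc_ge0.
rewrite -[leRHS]mul1r; apply: ler_pM; rewrite ?nc_ge0 ?nc_mult //.
apply: le_trans (nc_sum _ _ _) _; apply: ler_sum => e _.
by rewrite /chi lk k0.
Qed.

End Stability.

Local Notation K0 := (1 * T + T * (6 * Lam + A) +
  4 * (24 * (A * A + A * Lam * T + (A * A + A * Lam * T))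
     + 144 * (A * A + A * Lam * T) + T * (16 * Lam * A + 12 * A * A))).
Local Notation K1 := (1 + 4 * ((12 * (2 * A * CE + Lam) + 12 * (2 * (A + 1) * CE + D))
   + 4 * (A + 1))).

Lemma geometric_sum (a : R) n : a * \sum_(l < n) (1 + a) ^+ l = (1 + a) ^+ n - 1.
Proof.
elim: n => [|n IH]; first by rewrite big_ord0 mulr0 expr0 subrr.
by rewrite big_ord_recr /= mulrDr IH exprS; ring.
Qed.

Lemma pow_le_expR (a : R) n : 0 <= a -> (1 + a) ^+ n <= expR (n%:R * a).
Proof.
move=> a0; rewrite expRM_natl lerXn2r ?nnegrE ?expR_ge0 ?addr_ge0 //.
exact: expR_ge1Dx.
Qed.

(** Strong induction with the majorant [B (1 + K1 tau)^l], which solves the recursion obtained from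
    [err_bound] by a geometric sum. The smallness assumption keeps the majorant below 1, the a
    priori bound under which [err_bound] applies to the earlier times. *)
Lemma discrete_convergence n : (n <= N)%N ->
  (K0 + K1 * T) * expR (K1 * T) * eta <= 1 ->
  l2le (fun k => nc (err n k)) ((K0 + K1 * T) * expR (K1 * T) * eta).
Proof.
move=> nN small; have A0 := A_ge0; have t0 := ltW tau0.
have T0 : 0 <= T by apply: le_trans NT; rewrite mulr_ge0 // ltW.
have CE0 := CE_ge0.
have K00 : 0 <= K0 by do ?[apply: addr_ge0 => //|apply: mulr_ge0 => //].
have K10 : 0 <= K1 by do ?[apply: addr_ge0 => //|apply: mulr_ge0 => //].
move: err_bound K00 K10 small; set k0 := K0; set k1 := K1 => EB k00 k10 small.
pose B := (k0 + k1 * T) * eta.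
have B0 : 0 <= B by rewrite mulr_ge0 // addr_ge0 // mulr_ge0.
have a0 : 0 <= k1 * tau by rewrite mulr_ge0.
have grow l : (l <= N)%N -> B * (1 + k1 * tau) ^+ l <= B * expR (k1 * T).
  move=> lN; rewrite ler_wpM2l //; apply: le_trans (pow_le_expR l a0) _.
  rewrite ler_expR mulrCA ler_wpM2l //; apply: le_trans NT.
  by rewrite ntau ler_wpM2r ?(ltW h0) // ler_nat leq_mul2r lN orbT.
have BE : B * expR (k1 * T) = (k0 + k1 * T) * expR (k1 * T) * eta by rewrite /B; ring.
rewrite -BE in small *.
suff H : forall p l, (l < p)%N -> (l <= N)%N ->
    l2le (fun k => nc (err l k)) (B * (1 + k1 * tau) ^+ l).
  by apply: l2le_weak (grow n nN) (H n.+1 n (ltnSn n) nN).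
elim=> [//|p IH] l; rewrite ltnS => lp lN.
have := EB l (fun i => B * (1 + k1 * tau) ^+ i) lN.
have il i : (i < l)%N -> (i < p)%N /\ (i <= N)%N.
  by move=> i_l; split; [exact: leq_trans i_l lp|exact: leq_trans (ltnW i_l) lN].
move=> /(_ (fun i i_l => le_trans (grow i (il i i_l).2) small)).
move=> /(_ (fun i i_l => IH i (il i i_l).1 (il i i_l).2)); apply: l2le_weak.
have -> : \sum_(i < l) tau * (eta + B * (1 + k1 * tau) ^+ i) =
    l%:R * tau * eta + B * (tau * \sum_(i < l) (1 + k1 * tau) ^+ i).
  under eq_bigr do rewrite mulrDr.
  rewrite big_split /= sumr_const card_ord -[X in X + _ = _]mulr_natl mulrA.
  by congr (_ + _); rewrite !mulr_sumr; apply: eq_bigr => i _; ring.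
have gs := geometric_sum (k1 * tau) l.
have ltT : l%:R * tau <= T.
  apply: le_trans NT.
  by rewrite ntau ler_wpM2r ?(ltW h0) // ler_nat leq_mul2r lN orbT.
have h1 := ler_wpM2l (mulr_ge0 k10 eta0) ltT.
set S := \sum_(i < l) _ in gs *.
have -> : k1 * (l%:R * tau * eta + B * (tau * S)) =
  k1 * eta * (l%:R * tau) + B * (k1 * tau * S) by ring.
rewrite gs /B; lra.
Qed.
End FineTrajectory.

(** The order of the quantifiers is the point: [C] is chosen before the steps, the list of
    frequencies and the tolerance, so the fine grid may be refined at will afterwards. *)
Theorem lie_trotter_coefficients (R : realType) (s A Lam T : R) :
  0 < s <= 2 -> 0 <= Lam ->
  exists C : R, forall (tau h : R) (m N : nat) (J : seq int)
      (c d : nat -> int -> R[i]) (eps : R) (n : nat),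
    0 < h -> 0 < tau -> tau <= 3^-1 -> tau = m%:R * h -> uniq J ->
    (forall i, l2le (fun j => wt s j * nc (c i j)) A) ->
    (forall i j, nc (c i.+1 j - c i j) <= h * Lam / wt s j) ->
    (forall i j, 1 < h * (j%:~R : R) ^+ 2 -> c i j = 0) ->
    (forall k, d 0%N k = cut tau (c 0%N) k) ->
    (forall n k, d n.+1 k =
       if low tau k then d n k + tau%:C * rhs J (n%:R * tau) (d n) k else 0) ->
    (forall i k, (i < N * m)%N -> low tau k ->
       nc (c i.+1 k - c i k - h%:C * rhs J (i%:R * h) (c i) k) <= h * eps) ->
    l2le (fun k => if low tau k then eps else 0) (tau `^ (s / 2)) ->
    (N * m)%:R * h <= T -> (n <= N)%N -> C * tau `^ (s / 2) <= 1 ->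
    l2le (fun k => nc (cut tau (c (n * m)%N) k - d n k)) (C * tau `^ (s / 2)).
Proof.
move=> Hs Lam0; eexists => tau h m N J c d eps n h0 t0 t3 tE uJ cA cL cJ d0 dS cE eE NT nN.
exact: (discrete_convergence Hs h0 t0 t3 tE uJ Lam0 cA cL cJ d0 dS cE eE NT nN).
Qed.

(** * Integration of complex-valued functions *)

Section ComplexIntegral.
Variable R : realType.
Implicit Types (D : set R) (f g : R -> R[i]) (c : R[i]).
Local Notation mu := (@lebesgue_measure R).
Local Notation Rint D F := (mu.-integrable D (EFin \o (F : R -> R))).

Lemma ReD (z w : R[i]) : complex.Re (z + w) = complex.Re z + complex.Re w.
Proof. by case: z; case: w. Qed.
Lemma ImD (z w : R[i]) : complex.Im (z + w) = complex.Im z + complex.Im w.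
Proof. by case: z; case: w. Qed.
Lemma ReM (z w : R[i]) : complex.Re (z * w) =
  complex.Re z * complex.Re w - complex.Im z * complex.Im w.
Proof. by case: z; case: w. Qed.
Lemma ImM (z w : R[i]) : complex.Im (z * w) =
  complex.Re z * complex.Im w + complex.Im z * complex.Re w.
Proof. by case: z; case: w. Qed.

Lemma normr_Re (z : R[i]) : `|complex.Re z| <= nc z.
Proof.
case: z => a b /=; rewrite -sqrtr_sqr ler_sqrt ?lerDl ?sqr_ge0 //.
by rewrite addr_ge0 ?sqr_ge0.
Qed.

Lemma normr_Im (z : R[i]) : `|complex.Im z| <= nc z.
Proof.
case: z => a b /=; rewrite -sqrtr_sqr ler_sqrt ?lerDr ?sqr_ge0 //.
by rewrite addr_ge0 ?sqr_ge0.
Qed.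

Lemma cmeasurableD D f g : cmeasurable D f -> cmeasurable D g ->
  cmeasurable D (fun x => f x + g x).
Proof.
move=> [f1 f2] [g1 g2]; split.
  by under eq_fun do rewrite ReD; exact: measurable_funD.
by under eq_fun do rewrite ImD; exact: measurable_funD.
Qed.

Lemma cmeasurableM D f g : cmeasurable D f -> cmeasurable D g ->
  cmeasurable D (fun x => f x * g x).
Proof.
move=> [f1 f2] [g1 g2]; split.
  under eq_fun do rewrite ReM.
  by apply: measurable_funB; exact: measurable_funM.
under eq_fun do rewrite ImM.
by apply: measurable_funD; exact: measurable_funM.
Qed.

Lemma cmeasurable_cst D c : cmeasurable D (fun=> c).
Proof. by split; exact: measurable_cst. Qed.

Lemma cmeasurableZ D c f : cmeasurable D f -> cmeasurable D (fun x => c * f x).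
Proof. by apply: cmeasurableM; exact: cmeasurable_cst. Qed.

Lemma cmeasurable_conj D f : cmeasurable D f -> cmeasurable D (fun x => (f x)^*%C).
Proof.
move=> [f1 f2]; split.
  have -> : (fun x => complex.Re (f x)^*%C) = (fun x => complex.Re (f x)).
    by apply/funext => x; case: (f x).
  exact: f1.
have -> : (fun x => complex.Im (f x)^*%C) = (fun x => - complex.Im (f x)).
  by apply/funext => x; case: (f x).
exact: measurableT_comp.
Qed.

Lemma cmeasurable_sum D (I : Type) (s : seq I) (F : I -> R -> R[i]) :
  (forall i, cmeasurable D (F i)) -> cmeasurable D (fun x => \sum_(i <- s) F i x).
Proof.
move=> mF; elim: s => [|i s IH].
  by under eq_fun do rewrite big_nil; exact: cmeasurable_cst.
by under eq_fun do rewrite big_cons; exact: cmeasurableD.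
Qed.

Lemma cmeasurable_real D (F : R -> R) : measurable_fun D F ->
  cmeasurable D (fun x => (F x)%:C).
Proof. by move=> mF; split => //=; exact: measurable_cst. Qed.

Lemma measurable_nc2 D f : cmeasurable D f -> measurable_fun D (fun x => nc (f x) ^+ 2).
Proof.
move=> [f1 f2]; under eq_fun do rewrite nc_sqr.
by apply: measurable_funD; exact: measurable_funX.
Qed.

Lemma cmeasurable_expi D (a : R) : cmeasurable D (fun x => expi (a * x)).
Proof.
have cm : continuous (fun x : R => a * x) by move=> x; exact: mulrl_continuous.
split; rewrite /expi /=.
  apply: measurable_funTS.
  apply: continuous_measurable_fun => x.
  by apply: (@continuous_comp _ _ _ (fun y : R => a * y) cos); [exact: cm|exact: continuous_cos].
apply: measurable_funTS.
apply: continuous_measurable_fun => x.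
by apply: (@continuous_comp _ _ _ (fun y : R => a * y) sin); [exact: cm|exact: continuous_sin].
Qed.

Definition cint D f : Prop :=
  Rint D (fun x => complex.Re (f x)) /\ Rint D (fun x => complex.Im (f x)).

Lemma Rint_le D (F G : R -> R) : @measurable _ (measurableTypeR R) D -> measurable_fun D F ->
  (forall x, D x -> `|F x| <= G x) -> Rint D G -> Rint D F.
Proof.
move=> mD mF FG; apply: (le_integrable mD).
  by apply/measurable_EFinP; exact: mF.
by move=> x Dx; rewrite /= lee_fin (le_trans (FG x Dx)) // ler_norm.
Qed.

Lemma cint_le D f (G : R -> R) : @measurable _ (measurableTypeR R) D -> cmeasurable D f ->
  (forall x, D x -> nc (f x) <= G x) -> Rint D G -> cint D f.
Proof.
move=> mD [f1 f2] fG iG; split; apply: Rint_le iG => // x Dx.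
  exact: le_trans (normr_Re _) (fG x Dx).
exact: le_trans (normr_Im _) (fG x Dx).
Qed.

Section Linear.
Variable D : set R.
Hypothesis mD : @measurable _ (measurableTypeR R) D.

Lemma RintD (F G : R -> R) : Rint D F -> Rint D G -> Rint D (fun x => F x + G x).
Proof. by move=> iF iG; exact: (integrableD mD iF iG). Qed.

Lemma RintZ (F : R -> R) (a : R) : Rint D F -> Rint D (fun x => a * F x).
Proof. by move=> iF; exact: (integrableZl mD a iF). Qed.

Lemma RintB (F G : R -> R) : Rint D F -> Rint D G -> Rint D (fun x => F x - G x).
Proof. by move=> iF iG; exact: (integrableB mD iF iG). Qed.

Lemma cintD f g : cint D f -> cint D g -> cint D (fun x => f x + g x).
Proof.
move=> [f1 f2] [g1 g2]; split.
  by under eq_fun do rewrite ReD; exact: RintD.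
by under eq_fun do rewrite ImD; exact: RintD.
Qed.

Lemma cintZ c f : cint D f -> cint D (fun x => c * f x).
Proof.
move=> [f1 f2]; split.
  by under eq_fun do rewrite ReM; apply: RintB; exact: RintZ.
by under eq_fun do rewrite ImM; apply: RintD; exact: RintZ.
Qed.

Lemma cintegralD f g : cint D f -> cint D g ->
  cintegral D (fun x => f x + g x) = cintegral D f + cintegral D g.
Proof.
move=> [f1 f2] [g1 g2]; rewrite /cintegral /=.
rewrite -[RHS]/(_ +i* _); congr (_ +i* _).
  by under eq_Rintegral do rewrite ReD; exact: RintegralD.
by under eq_Rintegral do rewrite ImD; exact: RintegralD.
Qed.

Lemma cintegralZ c f : cint D f ->
  cintegral D (fun x => c * f x) = c * cintegral D f.
Proof.
move=> [f1 f2]; rewrite /cintegral; case: c => a b.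
rewrite -[RHS]/(_ +i* _); congr (_ +i* _).
  under eq_Rintegral do rewrite ReM /=.
  by rewrite RintegralB ?RintegralZl //; exact: RintZ.
under eq_Rintegral do rewrite ImM /=.
by rewrite RintegralD ?RintegralZl //; exact: RintZ.
Qed.

Lemma cintB f g : cint D f -> cint D g -> cint D (fun x => f x - g x).
Proof.
by move=> cf cg; under eq_fun do rewrite -mulN1r; exact/cintD/cintZ.
Qed.

Lemma cintegralB f g : cint D f -> cint D g ->
  cintegral D (fun x => f x - g x) = cintegral D f - cintegral D g.
Proof.
move=> cf cg; have -> : (fun x => f x - g x) = (fun x => f x + (- 1) * g x).
  by apply/funext => x; rewrite mulN1r.
by rewrite cintegralD ?cintegralZ ?mulN1r //; exact: cintZ.
Qed.

Lemma cintegral_conj f : cint D f ->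
  cintegral D (fun x => (f x)^*%C) = (cintegral D f)^*%C.
Proof.
move=> [f1 f2]; rewrite /cintegral -[RHS]/(_ +i* _); congr (_ +i* _).
  by apply: eq_Rintegral => x _; case: (f x).
rewrite -mulN1r -RintegralZl //.
by apply: eq_Rintegral => x _; rewrite mulN1r; case: (f x).
Qed.

Lemma cint0 : cint D (fun=> 0).
Proof. by split; exact: integrable0. Qed.

Lemma cintegral0 : cintegral D (fun=> 0) = 0.
Proof.
have H : \int[mu]_(x in D) (0 : R) = 0 by rewrite /Rintegral integral0_eq.
by rewrite /cintegral /= H.
Qed.

Lemma cint_sum (I : Type) (s : seq I) (F : I -> R -> R[i]) :
  (forall i, cint D (F i)) -> cint D (fun x => \sum_(i <- s) F i x).
Proof.
move=> mF; elim: s => [|i s IH].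
  by under eq_fun do rewrite big_nil; exact: cint0.
by under eq_fun do rewrite big_cons; exact: cintD.
Qed.

Lemma cintegral_sum (I : Type) (s : seq I) (F : I -> R -> R[i]) :
  (forall i, cint D (F i)) ->
  cintegral D (fun x => \sum_(i <- s) F i x) = \sum_(i <- s) cintegral D (F i).
Proof.
move=> mF; elim: s => [|i s IH].
  by rewrite big_nil; under eq_fun do rewrite big_nil; exact: cintegral0.
rewrite big_cons -IH -cintegralD //; last exact: cint_sum.
by congr cintegral; apply/funext => x; rewrite big_cons.
Qed.

(* Rotating the integrand makes its integral real. *)
Lemma nc_cintegral_le f (G : R -> R) : cint D f -> Rint D G ->
  (forall x, D x -> nc (f x) <= G x) ->
  nc (cintegral D f) <= \int[mu]_(x in D) G x.
Proof.
move=> cf iG fG; set z := cintegral D f.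
have [z0|z0] := eqVneq (nc z) 0.
  by rewrite z0; apply: Rintegral_ge0 => x Dx; exact: le_trans (nc_ge0 _) (fG x Dx).
pose w := z^*%C * ((nc z)^-1)%:C.
have zw : w * z = (nc z)%:C.
  rewrite /w; case: z z0 w => a b z0 w; rewrite mulrAC.
  have -> : (a +i* b)^*%C * (a +i* b) = (nc (a +i* b) ^+ 2)%:C.
    rewrite nc_sqr /=; apply/eqP; rewrite eq_complex /=; apply/andP; split.
      by rewrite mulNr opprK -!expr2.
    by rewrite mulNr [b * a]mulrC subrr.
  by rewrite -rmorphM /= expr2 mulfK.
have nw : nc w = 1.
  rewrite /w Normc.normcM nc_conj nc_real ger0_norm ?invr_ge0 ?nc_ge0 //.
  by rewrite divff.
have cwf := cintZ w cf.
have : complex.Re (w * z) = nc z by rewrite zw.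
rewrite /z -cintegralZ // /cintegral /= => <-.
apply: le_Rintegral => //; first by case: cwf.
move=> x Dx; apply: le_trans (ler_norm _) _; apply: le_trans (normr_Re _) _.
by rewrite Normc.normcM nw mul1r fG.
Qed.

End Linear.

End ComplexIntegral.

(** * Square-integrable functions on the torus *)

Section TorusL2.
Variable R : realType.
Implicit Types (f g : R -> R[i]) (c : R[i]).
Local Notation mu := (@lebesgue_measure R).
Local Notation T := (torus R).
Local Notation Rint D F := (mu.-integrable D (EFin \o (F : R -> R))).

Lemma measurable_torus : @measurable _ (measurableTypeR R) T.
Proof. exact: measurable_itv. Qed.
Local Notation mT := measurable_torus.

Lemma mu_torus : mu T = (2 * pi)%:E.
Proof.
rewrite /torus lebesgue_measure_itv /= lte_fin.
have p0 := @pi_gt0 R; have -> : - pi < pi :> R by lra.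
by rewrite -EFinB; congr (_%:E); ring.
Qed.

Lemma mu_torus_fin : (mu T < +oo)%E.
Proof. by rewrite mu_torus ltry. Qed.

Lemma Rint_cst (a : R) : Rint T (fun=> a).
Proof.
apply: measurable_bounded_integrable; first exact: mT.
- exact: mu_torus_fin.
- exact: measurable_cst.
- by exists `|a|; split; rewrite ?num_real // => y ay x _ /=; exact: ltW.
Qed.

Lemma Rintegral_cst_torus (a : R) : \int[mu]_(x in T) a = a * (2 * pi).
Proof. by rewrite Rintegral_cst; [congr (a * _); exact: (congr1 fine mu_torus)|exact: mT]. Qed.

Definition sq f := cmeasurable T f /\ Rint T (fun x => nc (f x) ^+ 2).

(** The squared norm as a real number. Working with squares replaces Minkowski's inequality by
    [enD], at the price of a factor 2. *)
Definition en f : R := \int[mu]_(x in T) (nc (f x) ^+ 2).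

Lemma en_ge0 f : 0 <= en f.
Proof. by apply: Rintegral_ge0 => x _; exact: sqr_ge0. Qed.

Lemma sq_le f (G : R -> R) : cmeasurable T f -> (forall x, T x -> nc (f x) ^+ 2 <= G x) ->
  Rint T G -> sq f.
Proof.
move=> mf fG iG; split=> //.
apply: Rint_le mT (measurable_nc2 mf) _ iG => x Tx.
by rewrite ger0_norm ?sqr_ge0 ?fG.
Qed.

Lemma sq_bounded f (M : R) : cmeasurable T f -> (forall x, T x -> nc (f x) <= M) -> sq f.
Proof.
move=> mf fM; apply: (sq_le mf _ (Rint_cst (M ^+ 2))) => x Tx.
by rewrite lerXn2r ?nnegrE ?nc_ge0 ?fM // (le_trans (nc_ge0 _) (fM x Tx)).
Qed.

Lemma nc2D (z w : R[i]) : nc (z + w) ^+ 2 <= 2 * nc z ^+ 2 + 2 * nc w ^+ 2.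
Proof.
have h := le_normcD z w; have h0 := nc_ge0 (z + w).
apply: (@le_trans _ _ ((nc z + nc w) ^+ 2)).
  by rewrite lerXn2r ?nnegrE ?addr_ge0 ?nc_ge0.
have := sqr_ge0 (nc z - nc w); lra.
Qed.

Lemma sqD f g : sq f -> sq g -> sq (fun x => f x + g x).
Proof.
move=> [mf f2] [mg g2].
apply: (@sq_le _ (fun x => 2 * nc (f x) ^+ 2 + 2 * nc (g x) ^+ 2)).
- exact: cmeasurableD.
- by move=> x _; exact: nc2D.
- by apply: RintD; [exact: mT|exact: (RintZ mT _ f2)|exact: (RintZ mT _ g2)].
Qed.

Lemma sqZ c f : sq f -> sq (fun x => c * f x).
Proof.
move=> [mf f2]; apply: (@sq_le _ (fun x => nc c ^+ 2 * nc (f x) ^+ 2)).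
- exact: cmeasurableZ.
- by move=> x _; rewrite Normc.normcM exprMn.
- exact: (RintZ mT _ f2).
Qed.

Lemma sqB f g : sq f -> sq g -> sq (fun x => f x - g x).
Proof.
move=> sf sg; have -> : (fun x => f x - g x) = (fun x => f x + (- 1) * g x).
  by apply/funext => x; rewrite mulN1r.
exact/sqD/sqZ.
Qed.

Lemma sq_conj f : sq f -> sq (fun x => (f x)^*%C).
Proof.
move=> [mf f2]; split; first exact: cmeasurable_conj.
by under eq_fun do rewrite nc_conj.
Qed.

Lemma sqM_bounded f g (M : R) : sq f -> cmeasurable T g -> (forall x, nc (g x) <= M) ->
  sq (fun x => f x * g x).
Proof.
move=> [mf f2] mg gM; apply: (@sq_le _ (fun x => M ^+ 2 * nc (f x) ^+ 2)).
- exact: cmeasurableM.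
- move=> x _; rewrite Normc.normcM exprMn mulrC ler_wpM2r ?sqr_ge0 //.
  by rewrite lerXn2r ?nnegrE ?nc_ge0 // (le_trans (nc_ge0 (g x))).
- exact: (RintZ mT _ f2).
Qed.

Lemma enD f g : sq f -> sq g -> en (fun x => f x + g x) <= 2 * en f + 2 * en g.
Proof.
move=> sf sg; have [mf f2] := sf; have [mg g2] := sg; have [_ fg2] := sqD sf sg.
rewrite /en -!RintegralZl //; try exact: mT.
rewrite -RintegralD //; first last.
- exact: (RintZ mT _ g2).
- exact: (RintZ mT _ f2).
- exact: mT.
apply: le_Rintegral => //; first exact: mT.
  by apply: RintD; [exact: mT|exact: (RintZ mT _ f2)|exact: (RintZ mT _ g2)].
by move=> x _; exact: nc2D.
Qed.

Lemma enZ c f : sq f -> en (fun x => c * f x) = nc c ^+ 2 * en f.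
Proof.
move=> [mf f2]; rewrite /en -RintegralZl //; last exact: mT.
by apply: eq_Rintegral => x _; rewrite Normc.normcM exprMn.
Qed.

Lemma nc_amgm (z w : R[i]) (t : R) : 0 < t ->
  nc (z * w) <= t / 2 * nc z ^+ 2 + t^-1 / 2 * nc w ^+ 2.
Proof.
move=> t0; rewrite Normc.normcM.
have := sqr_ge0 (t * nc z - nc w); move: (nc z) (nc w) => a b h.
rewrite -subr_ge0.
have -> : t / 2 * a ^+ 2 + t^-1 / 2 * b ^+ 2 - a * b = (t * a - b) ^+ 2 / (2 * t).
  by field; rewrite gt_eqF.
by rewrite divr_ge0 // mulr_ge0 // ltW.
Qed.

Lemma sq_cintM f g : sq f -> sq g -> cint T (fun x => f x * g x).
Proof.
move=> [mf f2] [mg g2].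
apply: (@cint_le _ _ _ (fun x => 1 / 2 * nc (f x) ^+ 2 + 1^-1 / 2 * nc (g x) ^+ 2)).
- exact: mT.
- exact: cmeasurableM.
- by move=> x _; exact: nc_amgm.
- by apply: RintD; [exact: mT|exact: (RintZ mT _ f2)|exact: (RintZ mT _ g2)].
Qed.

(** Cauchy-Schwarz before optimization: leaving [t] free avoids square roots and the case of a
    vanishing norm. *)
Lemma nc_cintegralM f g (t : R) : sq f -> sq g -> 0 < t ->
  nc (cintegral T (fun x => f x * g x)) <= t / 2 * en f + t^-1 / 2 * en g.
Proof.
move=> sf sg t0; have [mf f2] := sf; have [mg g2] := sg.
rewrite /en -!RintegralZl //; try exact: mT.
rewrite -RintegralD //; first last.
- exact: (RintZ mT _ g2).
- exact: (RintZ mT _ f2).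
- exact: mT.
apply: nc_cintegral_le; first exact: mT.
- exact: sq_cintM.
- by apply: RintD; [exact: mT|exact: (RintZ mT _ f2)|exact: (RintZ mT _ g2)].
- by move=> x _; exact: nc_amgm.
Qed.

Lemma sq_cst c : sq (fun=> c).
Proof. by apply: (@sq_bounded _ (nc c)) => //; exact: cmeasurable_cst. Qed.

Lemma sq_cint f : sq f -> cint T f.
Proof.
move=> sf; have := sq_cintM sf (sq_cst 1).
by congr cint; apply/funext => x; rewrite mulr1.
Qed.

Lemma en_inner f : sq f -> (en f)%:C = cintegral T (fun x => f x * (f x)^*%C).
Proof.
move=> sf; rewrite /cintegral /en; apply/eqP; rewrite eq_complex /=; apply/andP; split.
  apply/eqP; apply: eq_Rintegral => x _; rewrite nc_sqr.
  by case: (f x) => a b /=; rewrite mulrN opprK -!expr2.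
apply/eqP; rewrite [RHS](_ : _ = \int[mu]_(x in T) (0 : R)).
  by rewrite Rintegral_cst_torus mul0r.
apply: eq_Rintegral => x _; case: (f x) => a b /=; ring.
Qed.

(* Trigonometric polynomials, as lists of (frequency, coefficient) pairs *)
Definition tp (s : seq (int * R[i])) (x : R) : R[i] :=
  \sum_(p <- s) p.2 * expi (p.1%:~R * x).

Definition istp f := exists s, f = tp s.

Lemma cmeasurable_tp D s : cmeasurable D (tp s).
Proof.
by apply: cmeasurable_sum => p; apply: cmeasurableZ; exact: cmeasurable_expi.
Qed.

Lemma tp_bounded s x : nc (tp s x) <= \sum_(p <- s) nc p.2.
Proof.
apply: le_trans (nc_sum _ _ _) _; apply: ler_sum => p _.
by rewrite Normc.normcM nc_expi mulr1.
Qed.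

Lemma sq_tp s : sq (tp s).
Proof.
apply: sq_bounded (cmeasurable_tp _ _) _ => x _; exact: tp_bounded.
Qed.

Lemma istp_cst c : istp (fun=> c).
Proof.
exists [:: (0, c)]; apply/funext => x.
by rewrite /tp big_seq1 /= mulr0z mul0r expi0 mulr1.
Qed.

Lemma istpD f g : istp f -> istp g -> istp (fun x => f x + g x).
Proof.
move=> [s ->] [t ->]; exists (s ++ t); apply/funext => x.
by rewrite /tp big_cat.
Qed.

Lemma istpM f g : istp f -> istp g -> istp (fun x => f x * g x).
Proof.
move=> [s ->] [t ->].
exists [seq (p.1 + q.1, p.2 * q.2) | p <- s, q <- t]; apply/funext => x.
rewrite /tp big_allpairs_dep /= mulr_suml; apply: eq_bigr => p _.
rewrite mulr_sumr; apply: eq_bigr => q _ /=.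
by rewrite rmorphD /= mulrDl expiD; ring.
Qed.

Lemma istpB f g : istp f -> istp g -> istp (fun x => f x - g x).
Proof.
move=> fT gT; have -> : (fun x => f x - g x) = (fun x => f x + (- 1) * g x).
  by apply/funext => x; rewrite mulN1r.
by apply: istpD => //; apply: istpM => //; exact: istp_cst.
Qed.

Lemma istpX f n : istp f -> istp (fun x => f x ^+ n).
Proof.
move=> fT; elim: n => [|n IH].
  by under eq_fun do rewrite expr0; exact: istp_cst.
by under eq_fun do rewrite exprS; exact: istpM.
Qed.

Lemma istp_cos (a : R) : istp (fun x => (cos (x - a))%:C).
Proof.
exists [:: (1, expi (- a) / 2); (- 1, expi a / 2)]; apply/funext => x.
rewrite /tp !big_cons big_nil /= addr0 mulr1z mul1r mulrNz mulr1z mulN1r.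
rewrite mulrAC -expiD mulrAC -expiD.
have -> : a - x = - (x - a) by ring.
have -> : - a + x = x - a by ring.
rewrite /expi cosN sinN -mulrDl.
have -> : (cos (x - a) +i* sin (x - a)) + (cos (x - a) +i* - sin (x - a)) =
   2 * (cos (x - a))%:C :> R[i].
  by apply/eqP; rewrite eq_complex /=; apply/andP; split; apply/eqP; ring.
by rewrite mulrAC divff ?mul1r // pnatr_eq0.
Qed.

Lemma sq_istp f : istp f -> sq f.
Proof. by move=> [s ->]; exact: sq_tp. Qed.

(** The closure of trigonometric polynomials in L2, with the squared distance. *)
Definition apx f := sq f /\ forall e, 0 < e -> exists2 p, istp p & en (fun x => f x - p x) <= e.

Lemma apx_istp f : istp f -> apx f.
Proof.
move=> fT; split; first exact: sq_istp.
move=> e e0; exists f => //; rewrite /en.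
rewrite (_ : \int[mu]_(x in T) _ = \int[mu]_(x in T) (0 : R)).
  by rewrite Rintegral_cst_torus mul0r ltW.
by apply: eq_Rintegral => x _; rewrite subrr nc0 expr0n.
Qed.

Lemma apx_lim f : sq f ->
  (forall e, 0 < e -> exists2 g, apx g & en (fun x => f x - g x) <= e) -> apx f.
Proof.
move=> sf H; split=> // e e0.
have e4 : 0 < e / 4 by rewrite divr_gt0.
have [g [sg gA] fg] := H _ e4; have [p pT gp] := gA _ e4.
exists p => //; have sp := sq_istp pT.
have -> : (fun x => f x - p x) = (fun x => (f x - g x) + (g x - p x)).
  by apply/funext => x; rewrite subrKA.
apply: le_trans (enD (sqB sf sg) (sqB sg sp)) _; lra.
Qed.

Lemma apxD f g : apx f -> apx g -> apx (fun x => f x + g x).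
Proof.
move=> [sf fA] [sg gA]; split=> [|e e0]; first exact: sqD.
have e4 : 0 < e / 4 by rewrite divr_gt0.
have [p pT fp] := fA _ e4; have [q qT gq] := gA _ e4.
exists (fun x => p x + q x); first exact: istpD.
have -> : (fun x => f x + g x - (p x + q x)) = (fun x => (f x - p x) + (g x - q x)).
  by apply/funext => x; ring.
apply: le_trans (enD (sqB sf (sq_istp pT)) (sqB sg (sq_istp qT))) _; lra.
Qed.

Lemma apxZ c f : apx f -> apx (fun x => c * f x).
Proof.
move=> [sf fA]; split=> [|e e0]; first exact: sqZ.
have c0 : 0 < nc c ^+ 2 + 1 by rewrite ltr_wpDl ?sqr_ge0.
have [p pT fp] := fA (e / (nc c ^+ 2 + 1)) (divr_gt0 e0 c0).
exists (fun x => c * p x); first by apply: istpM => //; exact: istp_cst.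
have -> : (fun x => c * f x - c * p x) = (fun x => c * (f x - p x)).
  by apply/funext => x; ring.
rewrite (enZ _ (sqB sf (sq_istp pT))).
move: fp; rewrite ler_pdivlMr // => fp; apply: le_trans _ fp.
have := en_ge0 (fun x => f x - p x); lra.
Qed.

Lemma apx_sum (I : Type) (r : seq I) (F : I -> R -> R[i]) :
  (forall i, apx (F i)) -> apx (fun x => \sum_(i <- r) F i x).
Proof.
move=> FA; elim: r => [|i r IH].
  by under eq_fun do rewrite big_nil; apply: apx_istp; exact: istp_cst.
by under eq_fun do rewrite big_cons; exact: apxD.
Qed.

Lemma en_cvg0 (r_ : nat -> R -> R) (r G : R -> R) :
  (forall n, measurable_fun T (r_ n)) -> measurable_fun T r ->
  {ae mu, forall x, T x -> r_ n x @[n --> \oo] --> r x} ->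
  Rint T G -> (forall n x, T x -> (r x - r_ n x) ^+ 2 <= G x) ->
  en (fun x => (r x)%:C - (r_ n x)%:C) @[n --> \oo] --> 0.
Proof.
move=> mr_ mr cv iG rG.
pose f_ n x := ((r x - r_ n x) ^+ 2)%:E.
have [] := @dominated_convergence _ _ R mu T mT f_ (fun=> 0%E) (EFin \o G).
- move=> n; apply/measurable_EFinP; apply: (measurable_funX 2).
  exact: (measurable_funB mr (mr_ n)).
- exact: measurable_cst.
- case: cv => N [mN N0 cvN]; exists N; split=> // x /= K; apply: cvN => /= H.
  apply: K => Tx; rewrite /f_; apply: cvg_EFin; first exact: nearW.
  move: (H Tx) => {}H.
  have -> : (0 : R) = (r x - r x) ^+ 2 by rewrite subrr expr0n.
  have cB : (r x - r_ n x) @[n --> \oo] --> r x - r x.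
    by apply: cvgB; [exact: cvg_cst|exact: H].
  by under eq_fun do rewrite expr2; rewrite expr2; exact: cvgM.
- exact: iG.
- apply: aeW => x Tx n; rewrite /f_ /= lee_fin ger0_norm ?sqr_ge0 //; exact: rG.
move=> _ _; rewrite integral0 => /fine_cvg /=.
rewrite /fine /=; apply: cvg_trans; apply: near_eq_cvg; apply: nearW => n.
rewrite /en /Rintegral /=; congr fine; apply: eq_integral => x _.
rewrite /f_; congr (_%:E); rewrite subrr expr0n addr0 sqr_sqrtr //.
exact: sqr_ge0.
Qed.

Lemma apx_dct (r_ : nat -> R -> R) (r G : R -> R) :
  (forall n, apx (fun x => (r_ n x)%:C)) -> sq (fun x => (r x)%:C) ->
  {ae mu, forall x, T x -> r_ n x @[n --> \oo] --> r x} ->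
  Rint T G -> (forall n x, T x -> (r x - r_ n x) ^+ 2 <= G x) ->
  apx (fun x => (r x)%:C).
Proof.
move=> rA sr cv iG rG; apply: apx_lim => // e e0.
have mr_ n : measurable_fun T (r_ n) by have [[[]]] := rA n.
have mr : measurable_fun T r by have [[]] := sr.
have := en_cvg0 mr_ mr cv iG rG.
move=> /cvgr0Pnorm_le /(_ e e0) [N _ HN].
exists (fun x => (r_ N x)%:C) => //.
by have := HN N (leqnn N); rewrite /= ger0_norm ?en_ge0.
Qed.

End TorusL2.

(** * Density of trigonometric polynomials in L2 *)

Section Density.
Variable R : realType.
Local Notation mu := (@lebesgue_measure R).
Local Notation T := (torus R).
Local Notation Rint D F := (mu.-integrable D (EFin \o (F : R -> R))).

Lemma bernoulli (z : R) N : 0 <= z -> 1 + N%:R * z <= (1 + z) ^+ N.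
Proof.
move=> z0; elim: N => [|N IH]; first by rewrite mul0r addr0 expr0.
rewrite exprS; apply: le_trans (ler_wpM2l _ IH); last by rewrite addr_ge0.
have : 0 <= N%:R * z ^+ 2 by rewrite mulr_ge0 ?sqr_ge0.
rewrite -natr1; lra.
Qed.

Lemma bernoulliN (w : R) N : 0 <= w -> w <= 1 -> 1 - N%:R * w <= (1 - w) ^+ N.
Proof.
move=> w0 w1; elim: N => [|N IH]; first by rewrite mul0r subr0 expr0.
rewrite exprS; apply: le_trans (ler_wpM2l _ IH); last by rewrite subr_ge0.
have : 0 <= N%:R * w ^+ 2 by rewrite mulr_ge0 ?sqr_ge0.
rewrite -natr1; lra.
Qed.

(** The polynomials of the Brosowski-Deutsch proof of the Stone-Weierstrass theorem. They tend to a
    step at [1/2], since by Bernoulli's inequality they are governed by [2^n x^n = (2 x)^n], which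
    tends to 0 or to infinity. *)
Definition bump (x : R) n : R := (1 - x ^+ n) ^+ (2 ^ n).

Lemma bump_bounds x n : 0 <= x -> x <= 1 -> 0 <= bump x n <= 1.
Proof.
move=> x0 x1; have h1 : x ^+ n <= 1 by rewrite exprn_ile1.
have h0 : 0 <= x ^+ n by rewrite exprn_ge0.
by rewrite /bump exprn_ge0 ?exprn_ile1 ?subr_ge0 // lerBlDr lerDl.
Qed.

Lemma bump_cvg1 x : 0 <= x -> x < 2^-1 -> bump x n @[n --> \oo] --> (1 : R).
Proof.
move=> x0 x2; have x1 : x <= 1 by lra.
apply: (@squeeze_cvgr _ _ _ _ (fun n => 1 - (2 * x) ^+ n) (fun=> 1)).
- apply: nearW => n; have /andP[_ ->] := bump_bounds n x0 x1; rewrite andbT.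
  have := @bernoulliN (x ^+ n) (2 ^ n) (exprn_ge0 n x0) (exprn_ile1 n x0 x1).
  by rewrite natrX -exprMn.
- have cx : (2 * x) ^+ n @[n --> \oo] --> (0 : R).
    by apply: cvg_expr; rewrite ger0_norm ?mulr_ge0 //; lra.
  have c1 : (fun=> 1 : R) @ \oo --> (1 : R) by exact: cvg_cst.
  by have := cvgB c1 cx; rewrite subr0; exact.
- exact: cvg_cst.
Qed.

Lemma bump_cvg0 x : 2^-1 < x -> x <= 1 -> bump x n @[n --> \oo] --> (0 : R).
Proof.
move=> x2 x1; have x0 : 0 < x by apply: lt_trans x2.
apply: (@squeeze_cvgr _ _ _ _ (fun=> 0) (fun n => (2 * x)^-1 ^+ n)).
- apply: nearW => n; have /andP[-> _] := bump_bounds n (ltW x0) x1 => /=.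
  have xn0 : 0 <= x ^+ n by rewrite exprn_ge0 // ltW.
  have xn1 : x ^+ n <= 1 by rewrite exprn_ile1 // ltW.
  have h := @bernoulli (x ^+ n) (2 ^ n) xn0.
  rewrite natrX -exprMn in h.
  have p0 : 0 < (2 * x) ^+ n by rewrite exprn_gt0 // mulr_gt0.
  rewrite exprVn -[leRHS]mul1r ler_pdivlMr //.
  (* Bernoulli bounds [(2 x)^n] by the second factor, and the product is
     [(1 - x^(2n))^(2^n) <= 1]. *)
  apply: (@le_trans _ _ (bump x n * (1 + x ^+ n) ^+ (2 ^ n))).
    rewrite ler_wpM2l //; first by have /andP[] := bump_bounds n (ltW x0) x1.
    apply: le_trans h; lra.
  rewrite /bump -exprMn exprn_ile1 //.
    by rewrite mulr_ge0 ?subr_ge0 // addr_ge0.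
  have := sqr_ge0 (x ^+ n); lra.
- exact: cvg_cst.
- have t0 : 0 < 2 * x by rewrite mulr_gt0.
  apply: cvg_expr; rewrite ger0_norm ?invr_ge0 ?ltW // invf_lt1 //; lra.
Qed.

Lemma sq_indic (A : set R) : @measurable _ (measurableTypeR R) A ->
  sq (fun x => (\1_A x)%:C : R[i]).
Proof.
move=> mA; apply: (@sq_bounded _ _ 1).
  by apply: cmeasurable_real; exact: (@measurable_indic _ (measurableTypeR R) R T A mA).
by move=> x _; rewrite nc_real indicE; case: (_ \in _); rewrite ?normr1 ?normr0.
Qed.

(* The arc ]a, pi[ is the set where a translate of the cosine exceeds a
   threshold, so its indicator is a limit of polynomials in that cosine. *)
Lemma apx_ray a : apx (fun x => (\1_(`]a, +oo[ : set R) x)%:C : R[i]).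
Proof.
have p0 := @pi_gt0 R.
have mA : @measurable _ (measurableTypeR R) (`]a, +oo[ : set R) by exact: measurable_itv.
(* [c] is the midpoint of the arc and [r] the cosine of half its length. The affine map [y] of the
   cosine takes values in [[0, 1]] and moves the threshold [r] to [1/2]; the product formula [yE]
   then decides on which side [x] lies. *)
pose c := (a + pi) / 2; pose r := cos ((pi - a) / 2).
pose y x := 2^-1 + (r - cos (x - c)) / 4.
have yE x : y x = 2^-1 - sin ((x - a) / 2) * sin ((pi - x) / 2) / 2.
  have -> : sin ((x - a) / 2) * sin ((pi - x) / 2) = (cos (x - c) - r) / 2.
    rewrite /r; have -> : x - c = (x - a) / 2 - (pi - x) / 2 by rewrite /c; field.
    have -> : (pi - a) / 2 = (x - a) / 2 + (pi - x) / 2 by field.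
    by rewrite cosB cosD; field.
  by rewrite /y; field.
have y01 v : 0 <= y v <= 1.
  have h1 := cos_le1 (v - c); have h2 := cos_geN1 (v - c).
  have h3 := cos_le1 ((pi - a) / 2); have h4 := cos_geN1 ((pi - a) / 2).
  by rewrite /y /r; apply/andP; split; lra.
have [api|api] := ltP a (- pi).
  have H : sq (fun x => (\1_(`]a, +oo[ : set R) x)%:C : R[i]) by exact: sq_indic.
  apply: (apx_lim H) => e e0; exists (fun=> 1); first by apply: apx_istp; exact: istp_cst.
  rewrite /en (_ : Rintegral _ _ _ = \int[mu]_(x in T) (0 : R)).
    by rewrite Rintegral_cst_torus mul0r ltW.
  apply: eq_Rintegral => x; rewrite inE /torus /= in_itv /= => /andP[x1 x2].
  have ax : `]a, +oo[%classic x by rewrite /= in_itv /= andbT (lt_le_trans api).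
  by rewrite indicE mem_set //= !subrr expr0n addr0 sqrtr0 expr0n.
have [api'|api'] := ltP a pi; last first.
  have H : sq (fun x => (\1_(`]a, +oo[ : set R) x)%:C : R[i]) by exact: sq_indic.
  apply: (apx_lim H) => e e0; exists (fun=> 0); first by apply: apx_istp; exact: istp_cst.
  rewrite /en (_ : Rintegral _ _ _ = \int[mu]_(x in T) (0 : R)).
    by rewrite Rintegral_cst_torus mul0r ltW.
  apply: eq_Rintegral => x; rewrite inE /torus /= in_itv /= => /andP[x1 x2].
  have ax : ~ `]a, +oo[%classic x.
    rewrite /= in_itv /= andbT => ax.
    by have := lt_le_trans ax (le_trans x2 api'); rewrite ltxx.
  by rewrite indicE memNset //= !subrr expr0n addr0 sqrtr0 expr0n.
apply: (@apx_dct _ (fun n x => bump (y x) n) _ (fun=> 1)).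
- move=> n; apply: apx_istp.
  have -> : (fun x => (bump (y x) n)%:C : R[i]) =
    (fun x => (1 - ((2^-1 + r / 4)%:C + (- 4^-1)%:C * (cos (x - c))%:C) ^+ n) ^+ (2 ^ n)).
    apply/funext => x; rewrite -[_ * _%:C]rmorphM -rmorphD.
    rewrite (_ : 2^-1 + r / 4 + _ = y x); last by rewrite /y; field.
    by rewrite /bump !(rmorphXn, rmorphB, rmorph1).
  apply: istpX; apply: istpB; first exact: istp_cst.
  apply: istpX; apply: istpD; first exact: istp_cst.
  by apply: istpM; [exact: istp_cst|exact: istp_cos].
- exact: sq_indic.
(* At these points one of the sines in [yE] vanishes, so [y] equals the threshold [1/2] and no
   convergence to 0 or 1 is claimed. *)
- exists ([set a; pi] `|` [set - pi]); split.
  + by apply: measurableU => //; exact: measurableU.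
  + apply: countable_lebesgue_measure0; apply: finite_set_countable.
    by rewrite finite_setU; split; [exact: finite_set2|exact: finite_set1].
  move=> x /= K; apply: contrapT => /not_orP[/not_orP[xa xpi] xNpi]; apply: K => Tx.
  have /andP[x1 x2] : - pi <= x <= pi by move: Tx; rewrite /torus /= in_itv.
  have xN : - pi < x by rewrite lt_neqAle x1 andbT eq_sym; apply/eqP.
  have xp : x < pi by rewrite lt_neqAle x2 andbT; apply/eqP.
  have s2 : 0 < sin ((pi - x) / 2) by apply: sin_gt0_pi; apply/andP; split; lra.
  have [ax|xa'] := ltP a x.
    rewrite indicE mem_set /=; last by rewrite in_itv /= andbT.
    have s1 : 0 < sin ((x - a) / 2) by apply: sin_gt0_pi; apply/andP; split; lra.
    apply: bump_cvg1; first by have /andP[] := y01 x.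
    by rewrite yE; have := mulr_gt0 s1 s2; lra.
  have xa2 : x < a by rewrite lt_neqAle xa' andbT; apply/eqP.
  rewrite indicE memNset /=; last by rewrite in_itv /= andbT => /(lt_trans xa2); rewrite ltxx.
  have s1 : 0 < sin ((a - x) / 2) by apply: sin_gt0_pi; apply/andP; split; lra.
  apply: bump_cvg0; last by have /andP[] := y01 x.
  rewrite yE; have -> : (x - a) / 2 = - ((a - x) / 2) by field.
  by rewrite sinN mulNr; have := mulr_gt0 s1 s2; lra.
- exact: Rint_cst.
- move=> n x _; have /andP[b0 b1] := y01 x; have /andP[c0 c1] := bump_bounds n b0 b1.
  rewrite indicE; case: (_ \in _) => /=; nra.
Qed.

(** The pi-lambda theorem: open rays generate the Borel sets and are stable under intersection,
    while complements and, by dominated convergence, countable disjoint unions preserve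
    approximability. *)
Lemma apx_indic (A : set R) : @measurable _ (measurableTypeR R) A ->
  apx (fun x => (\1_A x)%:C : R[i]).
Proof.
move=> mA.
apply: (@dynkin_induction _ (measurableTypeR R) (@RGenOInfty.G R)
  (fun A => apx (fun x => (\1_A x)%:C : R[i]))).
- exact: RGenOInfty.measurableE.
- move=> _ _ [a ->] [b ->]; exists (Num.max a b).
  apply/seteqP; split => x /=; rewrite !in_itv /= !andbT gt_max.
    by case=> -> ->.
  by move=> /andP[].
- have -> : (fun x : R => (\1_[set: R] x)%:C : R[i]) = (fun=> 1).
    by apply/funext => x; rewrite indicT.
  by apply: apx_istp; exact: istp_cst.
- by move=> _ [a ->]; exact: apx_ray.
- move=> S mS SA.
  have -> : (fun x => (\1_(~` S) x)%:C : R[i]) = (fun x => 1 + (- 1) * (\1_S x)%:C).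
    apply/funext => x; rewrite !indicE in_setC; case: (x \in S) => /=.
      by rewrite mulN1r subrr.
    by rewrite mulr0 addr0.
  by apply: apxD; [apply: apx_istp; exact: istp_cst|exact: apxZ].
- move=> F mF tF FA.
  have sumE n x k : F k x -> \sum_(i < n) (\1_(F i) x : R) = (k < n)%:R.
    move=> Fkx; elim: n => [|n IH]; first by rewrite big_ord0 ltn0.
    rewrite big_ord_recr /= IH indicE.
    have [<-|kn] := eqVneq k n; first by rewrite mem_set // ltnn ltnSn add0r.
    rewrite memNset; first by rewrite addr0 ltnS [(k <= n)%N]leq_eqVlt (negbTE kn).
    by move=> Fnx; move/eqP: kn; apply; apply: (tF k n I I); exists x.
  have sum0 n x : ~ (\bigcup_k F k) x -> \sum_(i < n) (\1_(F i) x : R) = 0.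
    move=> Nx; rewrite big1 // => i _; rewrite indicE memNset // => Fx.
    by apply: Nx; exists i.
  apply: (@apx_dct _ (fun n x => \sum_(i < n) \1_(F i) x) _ (fun=> 1)).
  + move=> n; have -> : (fun x => (\sum_(i < n) \1_(F i) x)%:C : R[i]) =
      (fun x => \sum_(i <- index_enum 'I_n) (\1_(F i) x)%:C).
      by apply/funext => x; rewrite rmorph_sum.
    by apply: apx_sum => i; exact: FA.
  + by apply: sq_indic; exact: bigcupT_measurable.
  + apply: aeW => x Tx; have [[k _ Fkx]|Nx] := pselect ((\bigcup_k F k) x).
      rewrite [X in _ --> X]indicE mem_set /=; last by exists k.
      apply: cvg_near_cst; exists k.+1 => // n /= kn.
      by rewrite (sumE n x k Fkx) kn.
    rewrite [X in _ --> X]indicE memNset //=.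
    by apply: cvg_near_cst; apply: nearW => n; rewrite sum0.
  + exact: Rint_cst.
  + move=> n x Tx; have [[k _ Fkx]|Nx] := pselect ((\bigcup_k F k) x).
      rewrite indicE mem_set /=; last by exists k.
      by rewrite (sumE n x k Fkx); case: (k < n)%N; rewrite ?subrr ?subr0 ?expr0n ?expr1n.
    by rewrite indicE memNset //= sum0 // subrr expr0n.
- exact: (eq_ind _ (fun P => P A) mA _ (RGenOInfty.measurableE R)).
Qed.

Import HBSimple HBNNSimple.

Lemma apx_nnsfun (f : {nnsfun (measurableTypeR R) >-> R}) :
  apx (fun x => (f x)%:C : R[i]).
Proof.
have -> : (fun x : R => (f x)%:C : R[i]) = (fun x =>
  \sum_(y <- finmap.enum_fset (fset_set (range f))) y%:C * (\1_(f @^-1` [set y]) x)%:C).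
  apply/funext => x; rewrite [in LHS]fimfunE fsbig_finite //= rmorph_sum.
  by apply: eq_bigr => y _; rewrite -rmorphM.
apply: apx_sum => y; apply: apxZ; apply: apx_indic.
exact: measurable_sfunP.
Qed.

Lemma apx_nonneg (r : R -> R) : (forall x, 0 <= r x) -> sq (fun x => (r x)%:C) ->
  apx (fun x => (r x)%:C : R[i]).
Proof.
move=> r0 sr; have [[mr _] r2] := sr.
have mr' : @measurable_fun _ _ (measurableTypeR R) _ T (EFin \o r).
  by apply/measurable_EFinP; exact: mr.
pose f_ := nnsfun_approx (@measurable_torus R) mr'.
have rpos x : T x -> (0 <= (EFin \o r) x)%E by move=> _; rewrite lee_fin.
have fle n x : T x -> f_ n x <= r x.
  by move=> Tx; rewrite /f_ nnsfun_approxE -lee_fin; exact: (le_approx n rpos Tx).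
apply: (@apx_dct _ (fun n x => f_ n x) _ (fun x => nc ((r x)%:C : R[i]) ^+ 2)).
- by move=> n; exact: apx_nnsfun.
- exact: sr.
- apply: aeW => x Tx.
  have H := cvg_nnsfun_approx (@measurable_torus R) mr' rpos Tx.
  exact: (fine_cvg H).
- exact: r2.
- move=> n x Tx; rewrite nc_real real_normK ?num_real //.
  have f0 : 0 <= f_ n x by exact: fun_ge0.
  by rewrite lerXn2r ?nnegrE ?subr_ge0 ?fle // lerBlDr lerDl.
Qed.

Theorem apx_sq (f : R -> R[i]) : sq f -> apx f.
Proof.
move=> sf; have [[m1 m2] f2] := sf.
have real_apx (r : R -> R) : measurable_fun T r ->
    (forall x, `|r x| <= nc (f x)) -> apx (fun x => (r x)%:C : R[i]).
  move=> mr rf.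
  have mn : measurable_fun T (fun x => `|r x|) by exact: measurableT_comp.
  have part (e : R) : `|e| = 1 -> apx (fun x => ((`|r x| + e * r x) / 2)%:C : R[i]).
    move=> e1; apply: apx_nonneg => [x|].
      rewrite divr_ge0 //; have := ler_norm (- (e * r x)).
      by rewrite normrN normrM e1 mul1r; lra.
    apply: (@sq_le _ _ (fun x => nc (f x) ^+ 2)) => //.
      apply: cmeasurable_real.
      have -> : (fun x => (`|r x| + e * r x) / 2) = (fun x => (`|r x| + e * r x) * (cst 2^-1 x)) by [].
      apply: measurable_funM; last exact: measurable_cst.
      apply: measurable_funD => //.
      by apply: measurable_funM => //; exact: measurable_cst.
    move=> x _; rewrite nc_real lerXn2r ?nnegrE ?nc_ge0 //.
    apply: le_trans _ (rf x); rewrite normrM normfV [`|2|]ger0_norm //.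
    rewrite ler_pdivrMr //; apply: le_trans (ler_normD _ _) _.
    rewrite normrM e1 mul1r normr_id; lra.
  have p1 := part 1 (normr1 _).
  have p2 : apx (fun x => (- 1) * ((`|r x| + - 1 * r x) / 2)%:C : R[i]).
    by apply: apxZ; apply: part; rewrite normrN normr1.
  have := apxD p1 p2; congr apx; apply/funext => x.
  by rewrite mulN1r -rmorphB; congr (_%:C); field.
have -> : f = (fun x => (complex.Re (f x))%:C + 'i * (complex.Im (f x))%:C).
  by apply/funext => x; rewrite -complexE.
have p1 := real_apx _ m1 (fun x => normr_Re (f x)).
have p2 := real_apx _ m2 (fun x => normr_Im (f x)).
exact: (apxD p1 (apxZ 'i p2)).
Qed.

End Density.

(** * Fourier coefficients and Parseval *)

Section FourierSeries.
Variable R : realType.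
Implicit Types (f g : R -> R[i]) (c : R[i]) (k : int).
Local Notation mu := (@lebesgue_measure R).
Local Notation T := (torus R).
Local Notation mT := (@measurable_torus R).
Local Notation e_ k := (fun x : R => expi ((k : int)%:~R * x)).

Lemma sin_npi n : sin (n%:R * pi : R) = 0.
Proof.
elim: n => [|n IH]; first by rewrite mul0r sin0.
by rewrite -natr1 mulrDl mul1r sinD IH sinpi mul0r mulr0 addr0.
Qed.

Lemma sin_kpi k : sin (k%:~R * pi : R) = 0.
Proof.
case: (intP k) => [|n|n]; first by rewrite mulr0z mul0r sin0.
  exact: sin_npi.
by rewrite mulrNz mulNr sinN sin_npi oppr0.
Qed.

Lemma pi2_gt0 : 0 < 2 * pi :> R.
Proof. by rewrite mulr_gt0 // pi_gt0. Qed.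

Lemma Rintegral_derive (F f : R -> R) :
  (forall x : R, is_derive x (1 : R) F (f x)) ->
  continuous f -> \int[mu]_(x in T) f x = F pi - F (- pi).
Proof.
move=> dF cf; have p0 := @pi_gt0 R.
have cF : continuous F.
  move=> x; apply: differentiable_continuous; apply/derivable1_diffP.
  by have [] := dF x.
rewrite /Rintegral /torus (@continuous_FTC2 _ f F) //.
- by lra.
- exact: continuous_subspaceT.
- split.
  + by move=> x _; have [] := dF x.
  + by apply: cvg_at_right_filter; exact: cF.
  + by apply: cvg_at_left_filter; exact: cF.
- by move=> x _; rewrite derive1E; exact: derive_val.
Qed.

Lemma cintegral_expi k : cintegral T (e_ k) = if k == 0 then (2 * pi)%:C else 0.
Proof.
rewrite /cintegral /expi /=; case: eqP => [->|/eqP k0].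
  apply/eqP; rewrite eq_complex /=; apply/andP; split; apply/eqP.
    under eq_Rintegral do rewrite mulr0z mul0r cos0.
    by rewrite Rintegral_cst_torus mul1r.
  under eq_Rintegral do rewrite mulr0z mul0r sin0.
  by rewrite Rintegral_cst_torus mul0r.
set a : R := k%:~R; have a0 : a != 0 by rewrite intr_eq0.
have cl : continuous (fun x : R => a * x) by move=> x; exact: mulrl_continuous.
have ccos : continuous (fun x : R => cos (a * x)).
  move=> x; apply: (@continuous_comp _ _ _ (fun y : R => a * y) cos); first exact: cl.
  exact: continuous_cos.
have csin : continuous (fun x : R => sin (a * x)).
  move=> x; apply: (@continuous_comp _ _ _ (fun y : R => a * y) sin); first exact: cl.
  exact: continuous_sin.
have dl (x : R) : is_derive x (1 : R) (fun x : R => a * x) a.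
  by apply: is_derive_eq; rewrite /GRing.scale /= mulr1.
have dsin (x : R) : is_derive x (1 : R) (fun x => a^-1 * sin (a * x)) (cos (a * x)).
  have ds : is_derive x (1 : R) (fun x => sin (a * x)) (cos (a * x) * a).
    exact: (@is_derive1_comp _ sin (fun x => a * x) x (cos (a * x)) a).
  apply: (@is_derive_eq _ _ _ _ _ _ _ _ (is_deriveZ a^-1 ds)).
  by rewrite /GRing.scale /=; field.
have dcos (x : R) : is_derive x (1 : R) (fun x => - a^-1 * cos (a * x)) (sin (a * x)).
  have ds : is_derive x (1 : R) (fun x => cos (a * x)) (- sin (a * x) * a).
    exact: (@is_derive1_comp _ cos (fun x => a * x) x (- sin (a * x)) a).
  apply: (@is_derive_eq _ _ _ _ _ _ _ _ (is_deriveZ (- a^-1) ds)).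
  by rewrite /GRing.scale /=; field.
rewrite (Rintegral_derive dsin ccos) (Rintegral_derive dcos csin).
by rewrite mulrN sinN sin_kpi cosN oppr0 !mulr0 !subrr.
Qed.

Lemma fourierE f k : fourier f k =
  ((2 * pi)^-1)%:C * cintegral T (fun x => f x * e_ (- k) x).
Proof. by rewrite /fourier; congr (_ * cintegral _ _); apply/funext => x; rewrite mulrNz mulNr. Qed.

Lemma sq_e k : sq (e_ k).
Proof.
apply: (@sq_bounded _ _ 1); first exact: cmeasurable_expi.
by move=> x _; rewrite nc_expi.
Qed.

Lemma sqMe f k : sq f -> sq (fun x => f x * e_ k x).
Proof.
move=> sf; apply: (@sqM_bounded _ _ _ 1) => //; first exact: cmeasurable_expi.
by move=> x; rewrite nc_expi.
Qed.

Lemma fourierD f g k : sq f -> sq g ->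
  fourier (fun x => f x + g x) k = fourier f k + fourier g k.
Proof.
move=> sf sg; rewrite !fourierE -mulrDr; congr (_ * _).
rewrite -cintegralD; [|exact: mT|exact/sq_cint/sqMe|exact/sq_cint/sqMe].
by congr cintegral; apply/funext => x; rewrite mulrDl.
Qed.

Lemma fourierZ c f k : sq f -> fourier (fun x => c * f x) k = c * fourier f k.
Proof.
move=> sf; rewrite !fourierE mulrCA; congr (_ * _).
rewrite -cintegralZ; [|exact: mT|exact/sq_cint/sqMe].
by congr cintegral; apply/funext => x; rewrite mulrA.
Qed.

Lemma fourierB f g k : sq f -> sq g ->
  fourier (fun x => f x - g x) k = fourier f k - fourier g k.
Proof.
move=> sf sg; have -> : (fun x => f x - g x) = (fun x => f x + (- 1) * g x).
  by apply/funext => x; rewrite mulN1r.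
by rewrite fourierD ?fourierZ ?mulN1r //; exact: sqZ.
Qed.

Lemma fourier_sum (I : Type) (s : seq I) (F : I -> R -> R[i]) k :
  (forall i, sq (F i)) ->
  fourier (fun x => \sum_(i <- s) F i x) k = \sum_(i <- s) fourier (F i) k.
Proof.
move=> sF; rewrite fourierE.
under eq_bigr do rewrite fourierE; rewrite -mulr_sumr; congr (_ * _).
rewrite -cintegral_sum; [|exact: mT|by move=> i; exact/sq_cint/sqMe].
by congr cintegral; apply/funext => x; rewrite mulr_suml.
Qed.

Lemma conjcM (z w : R[i]) : (z * w)^*%C = z^*%C * w^*%C.
Proof. exact: rmorphM. Qed.

Lemma conjc_sum (I : Type) (s : seq I) (F : I -> R[i]) :
  (\sum_(i <- s) F i)^*%C = \sum_(i <- s) (F i)^*%C.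
Proof. exact: rmorph_sum. Qed.

Lemma conjcD (z w : R[i]) : (z + w)^*%C = z^*%C + w^*%C.
Proof. exact: rmorphD. Qed.

Lemma fourier_conj f k : sq f -> fourier (fun x => (f x)^*%C) k = (fourier f (- k))^*%C.
Proof.
move=> sf; rewrite !fourierE opprK conjcM; congr (_ * _); first by rewrite conjc_real.
rewrite -cintegral_conj; [|exact: mT|exact/sq_cint/sqMe].
by congr cintegral; apply/funext => x; rewrite conjcM conj_expi mulrNz mulNr.
Qed.

Lemma fourier_shift f j k : sq f -> fourier (fun x => e_ j x * f x) k = fourier f (k - j).
Proof.
move=> sf; rewrite !fourierE; congr (_ * cintegral _ _); apply/funext => x.
rewrite mulrAC -expiD mulrC -mulrDl -rmorphD; congr (_ * expi (_%:~R * _)); lia.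
Qed.

Lemma fourier_e j k : fourier (e_ j) k = (j == k)%:R.
Proof.
rewrite fourierE; have -> : (fun x => e_ j x * e_ (- k) x) = e_ (j - k).
  by apply/funext => x; rewrite -expiD -mulrDl -rmorphD.
rewrite cintegral_expi subr_eq0; case: eqP => _; last by rewrite mulr0.
by rewrite -rmorphM /= mulVf // gt_eqF // pi2_gt0.
Qed.

Definition partial (J : seq int) (a : int -> R[i]) (x : R) : R[i] :=
  \sum_(j <- J) a j * e_ j x.

Lemma sq_partial J a : sq (partial J a).
Proof.
have -> : partial J a = tp [seq (j, a j) | j <- J].
  by apply/funext => x; rewrite /partial /tp big_map.
exact: sq_tp.
Qed.

Lemma fourier_partial J a k : uniq J ->
  fourier (partial J a) k = if k \in J then a k else 0.
Proof.
move=> uJ; rewrite fourier_sum; last by move=> j; exact/sqZ/sq_e.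
under eq_bigr do rewrite (fourierZ _ _ (sq_e _)) fourier_e.
case: ifPn => kJ.
  rewrite (bigD1_seq k) //= eqxx mulr1 big1 ?addr0 // => j /negbTE ->.
  by rewrite mulr0.
rewrite big_seq big1 // => j jJ; case: eqP => [jk|]; last by rewrite mulr0.
by move: kJ; rewrite -jk jJ.
Qed.

Lemma inner_tp f (s : seq (int * R[i])) : sq f ->
  cintegral T (fun x => f x * (tp s x)^*%C) =
  (2 * pi)%:C * \sum_(p <- s) p.2^*%C * fourier f p.1.
Proof.
move=> sf; have -> : (fun x => f x * (tp s x)^*%C) =
    (fun x => \sum_(p <- s) p.2^*%C * (f x * e_ (- p.1) x)).
  apply/funext => x; rewrite conjc_sum mulr_sumr; apply: eq_bigr => p _.
  by rewrite conjcM conj_expi mulrNz mulNr mulrCA.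
rewrite cintegral_sum; [|exact: mT|by move=> p; apply: cintZ; [exact: mT|exact/sq_cint/sqMe]].
rewrite mulr_sumr; apply: eq_bigr => p _.
rewrite cintegralZ; [|exact: mT|exact/sq_cint/sqMe].
rewrite fourierE [RHS]mulrCA; congr (_ * _).
by rewrite mulrA -rmorphM /= divff ?mul1r // gt_eqF // pi2_gt0.
Qed.

Lemma en_orthogonal f g : sq f -> sq g -> cintegral T (fun x => f x * (g x)^*%C) = 0 ->
  en (fun x => f x + g x) = en f + en g.
Proof.
move=> sf sg fg; apply: complexI; rewrite [RHS](rmorphD (real_complex R)) /= !en_inner //; last exact: sqD.
have cM a b : sq a -> sq b -> cint T (fun x => a x * (b x)^*%C).
  by move=> sa sb; apply: sq_cintM => //; exact: sq_conj.
have gf : cintegral T (fun x => g x * (f x)^*%C) = 0.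
  have -> : (fun x => g x * (f x)^*%C) = (fun x => (f x * (g x)^*%C)^*%C).
    by apply/funext => x; rewrite conjcM conjcK mulrC.
  by rewrite cintegral_conj ?fg ?rmorph0 //; [exact: mT|exact: cM].
have -> : (fun x => (f x + g x) * (f x + g x)^*%C) =
   (fun x => (f x * (f x)^*%C + f x * (g x)^*%C) + (g x * (f x)^*%C + g x * (g x)^*%C)).
  by apply/funext => x; rewrite conjcD; ring.
rewrite !cintegralD; try exact: mT; try (exact: cM); try (apply: cintD; [exact: mT|exact: cM|exact: cM]).
by rewrite fg gf addr0 add0r.
Qed.

Lemma tp_partial (s : seq (int * R[i])) (J : seq int) : uniq J ->
  {subset map fst s <= J} -> exists a, tp s = partial J a.
Proof.
move=> uJ; elim: s => [|p s IH] sJ.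
  exists (fun=> 0); apply/funext => x; rewrite /tp big_nil /partial big1 // => j _.
  by rewrite mul0r.
have [|a aE] := IH; first by move=> j js; apply: sJ; rewrite inE js orbT.
exists (fun j => a j + (j == p.1)%:R * p.2); apply/funext => x.
rewrite /tp big_cons -/(tp s x) aE /partial.
have pJ : p.1 \in J by apply: sJ; rewrite inE eqxx.
under [RHS]eq_bigr do rewrite mulrDl.
rewrite big_split /= addrC; congr (_ + _).
rewrite (bigD1_seq p.1) //= eqxx mul1r big1 ?addr0 // => j /negbTE ->.
by rewrite !mul0r.
Qed.

Lemma en_partial (J : seq int) (a : int -> R[i]) : uniq J ->
  en (partial J a) = 2 * pi * \sum_(j <- J) nc (a j) ^+ 2.
Proof.
move=> uJ; apply: complexI; rewrite en_inner; last exact: sq_partial.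
have E : partial J a = tp [seq (j, a j) | j <- J].
  by apply/funext => x; rewrite /partial /tp big_map.
rewrite {2}E inner_tp; last exact: sq_partial.
rewrite big_map [RHS](rmorphM (real_complex R)) /=; congr (_ * _).
rewrite (rmorph_sum (real_complex R)) /=.
apply: eq_big_seq => j jJ /=; rewrite fourier_partial // jJ nc_sqr.
case: (a j) => u v /=; apply/eqP; rewrite eq_complex /=; apply/andP.
by split; apply/eqP; ring.
Qed.

(** The partial Fourier sum over [J] is the best approximation with frequencies in [J], hence at
    least as good as the polynomial given by density. Its remainder is orthogonal to it and has
    energy at most [e], and its own energy is a finite sum. *)
Theorem parseval_le f (B : R) : sq f -> l2le (fun k => nc (fourier f k)) B ->
  en f <= 2 * pi * B ^+ 2.
Proof.
move=> sf [B0 fB]; apply/ler_addgt0Pr => e e0.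
have [_ /(_ e e0)[p [s ->] fp]] := apx_sq sf.
pose J := undup (map fst s); have uJ : uniq J by exact: undup_uniq.
have [|a aE] := @tp_partial s J uJ; first by move=> j; rewrite mem_undup.
pose P := partial J (fourier f).
pose g x := f x - P x.
have sP : sq P by exact: sq_partial.
have sg : sq g by exact: sqB.
have gJ k : k \in J -> fourier g k = 0.
  by move=> kJ; rewrite fourierB // fourier_partial // kJ subrr.
have orth b : cintegral T (fun x => g x * (partial J b x)^*%C) = 0.
  have -> : partial J b = tp [seq (j, b j) | j <- J].
    by apply/funext => x; rewrite /partial /tp big_map.
  rewrite inner_tp // big_map big_seq big1 ?mulr0 // => j jJ /=.
  by rewrite gJ // mulr0.
have fE : en f = en g + en P.
  rewrite -en_orthogonal //; last exact: orth.
  by congr en; apply/funext => x; rewrite /g subrK.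
have gle : en g <= e.
  apply: le_trans fp.
  have -> : (fun x => f x - tp s x) =
      (fun x => g x + partial J (fun j => fourier f j - a j) x).
    apply/funext => x; rewrite aE /g /P /partial.
    have -> : \sum_(j <- J) (fourier f j - a j) * e_ j x =
        \sum_(j <- J) fourier f j * e_ j x - \sum_(j <- J) a j * e_ j x.
      by rewrite -sumrB; apply: eq_bigr => j _; rewrite mulrBl.
    by rewrite addrA subrK.
  rewrite en_orthogonal //; [by rewrite lerDl en_ge0|exact: sq_partial].
rewrite fE addrC; apply: lerD gle.
by rewrite en_partial // ler_wpM2l ?(ltW pi2_gt0) // fB.
Qed.

Lemma fourier_partial_sqr (J : seq int) (a : int -> R[i]) k : uniq J ->
  fourier (fun x => partial J a x * partial J a x) k =
    \sum_(j <- J) a j * (if k - j \in J then a (k - j) else 0).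
Proof.
move=> uJ; have sP := sq_partial J a.
have -> : (fun x => partial J a x * partial J a x) =
   (fun x => \sum_(j <- J) a j * (e_ j x * partial J a x)).
  apply/funext => x; rewrite {1}/partial mulr_suml; apply: eq_bigr => j _.
  by rewrite mulrA.
have se j : sq (fun x => e_ j x * partial J a x).
  by have := sqMe j sP; congr sq; apply/funext => x; rewrite mulrC.
rewrite fourier_sum; last by move=> j; exact: sqZ.
by apply: eq_bigr => j _; rewrite fourierZ // fourier_shift // fourier_partial.
Qed.

(** With [P] the partial sum, [w^2 - P^2 = (w - P) (w + P)], and Parseval bounds the factors by
    [eta] and [2 B]. A quantitative finite convolution formula thus takes the place of an infinite
    series. *)
Theorem fourier_sqr (w : R -> R[i]) (J : seq int) (B eta : R) k : sq w -> uniq J ->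
  0 < B -> 0 < eta -> l2le (fun j => nc (fourier w j)) B ->
  l2le (fun j => if j \in J then 0 else nc (fourier w j)) eta ->
  nc (fourier (fun x => w x ^+ 2) k -
      \sum_(j <- J) fourier w j * (if k - j \in J then fourier w (k - j) else 0))
    <= 2 * B * eta.
Proof.
move=> sw uJ B0 e0 wB we.
pose P := partial J (fourier w).
have sP : sq P by exact: sq_partial.
rewrite -fourier_partial_sqr // !fourierE -mulrBr Normc.normcM nc_real.
have p0 := pi2_gt0.
rewrite ger0_norm ?invr_ge0 ?(ltW p0) // mulrC ler_pdivrMr //.
have cM f g : sq f -> sq g -> cint T (fun x => f x * g x * e_ (- k) x).
  move=> sf sg; have := sq_cintM sf (sqMe (- k) sg).
  by congr cint; apply/funext => x; rewrite mulrA.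
rewrite -cintegralB; [|exact: mT| |exact: cM]; last first.
  by have := cM _ _ sw sw; congr cint; apply/funext => x; rewrite expr2.
have -> : (fun x => w x ^+ 2 * e_ (- k) x - P x * P x * e_ (- k) x) =
   (fun x => (w x - P x) * ((w x + P x) * e_ (- k) x)).
  by apply/funext => x; ring.
have sD := sqB sw sP; have sS := sqD sw sP.
(* The ratio of the two norm bounds, which makes both terms of [nc_cintegralM] equal. *)
have t0 : 0 < 2 * B / eta by rewrite divr_gt0 // mulr_gt0.
apply: le_trans (nc_cintegralM sD (sqMe (- k) sS) t0) _.
have eD : en (fun x => w x - P x) <= 2 * pi * eta ^+ 2.
  apply: parseval_le => //; apply: (l2le_mono _ we) => j.
  rewrite fourierB // fourier_partial //; case: ifP => _.
    by rewrite subrr nc0.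
  by rewrite subr0.
have eS : en (fun x => (w x + P x) * e_ (- k) x) <= 2 * pi * (2 * B) ^+ 2.
  have -> : en (fun x => (w x + P x) * e_ (- k) x) = en (fun x => w x + P x).
    by apply: eq_Rintegral => x _; rewrite Normc.normcM nc_expi mulr1.
  apply: parseval_le => //.
  have -> : 2 * B = `|2| * B by rewrite ger0_norm.
  apply: (l2le_mono _ (l2leZ 2 wB)) => j.
  rewrite ger0_norm ?nc_ge0 // fourierD // fourier_partial //.
  apply: le_trans _ (ler_norm _); case: ifP => _.
    by apply: le_trans (le_normcD _ _) _; lra.
  by rewrite addr0 ler_peMl ?nc_ge0 // ler1n.
apply: (@le_trans _ _ (2 * B / eta / 2 * (2 * pi * eta ^+ 2) +
   (2 * B / eta)^-1 / 2 * (2 * pi * (2 * B) ^+ 2))).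
  by apply: lerD; rewrite ler_wpM2l // divr_ge0 // ?invr_ge0 ltW.
rewrite le_eqVlt; apply/orP; left; apply/eqP; field.
by rewrite !gt_eqF.
Qed.

End FourierSeries.

(** * The forcing term in Fourier variables *)

Definition ints (L : nat) : seq int := [seq i%:Z - L%:Z | i <- iota 0 (2 * L).+1].

Lemma mem_ints L k : (k \in ints L) = (`|k| <= L)%N.
Proof.
apply/mapP/idP => [[j] | kL]; first by rewrite mem_iota => /andP[_ iL] ->; lia.
exists `|(k + L%:Z)%R|%N; first by rewrite mem_iota; lia.
by lia.
Qed.

Lemma ints_uniq L : uniq (ints L).
Proof. by rewrite map_inj_uniq ?iota_uniq // => i j; lia. Qed.

Section Forcing.
Variable R : realType.
Implicit Types (a : int -> R[i]) (j k : int) (t : R) (J : seq int).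
Local Notation r k := ((k : int)%:~R : R).
Local Notation e_ k := (fun x : R => expi ((k : int)%:~R * x)).

Definition symm a k : R[i] := a k + (a (- k))^*%C.

Definition trunc_sqr J a k : R[i] :=
  \sum_(j <- J) a j * (if k - j \in J then a (k - j) else 0).

Definition tforc J a k : R[i] :=
  - ('i / 2) * ((omega R k)^-1)%:C * symm a k + mult R k * trunc_sqr J (symm a) k.

Lemma sum_bool2 (F : bool * bool -> R[i]) :
  \sum_e F e = F (true, true) + F (true, false) + F (false, true) + F (false, false).
Proof.
rewrite (eq_bigr (fun e => F (e.1, e.2))); last by case.
by rewrite -(pair_bigA _ (fun e1 e2 => F (e1, e2))) /= !big_bool /= !addrA.
Qed.

Lemma csg_twist e t J a j : (forall i, (- i \in J) = (i \in J)) ->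
  csg e (fun i => if i \in J then expi (- (t * omega R i)) * a i else 0) j =
  if j \in J then expi (- (t * (sgb R e * omega R j))) * csg e a j else 0.
Proof.
move=> JN; case: e => /=; first by rewrite mul1r.
rewrite JN; case: ifP => _; last by rewrite rmorph0.
by rewrite conjcM conj_expi omegaN opprK mulN1r mulrN opprK.
Qed.

(* The phases of the interaction picture combine to those of [rhs]. *)
Lemma rhs_forcing J t a k : (forall i, (- i \in J) = (i \in J)) -> k \in J ->
  rhs J t (fun j => if j \in J then expi (- (t * omega R j)) * a j else 0) k =
  expi (- (t * omega R k)) * tforc J a k.
Proof.
move=> JN kJ; rewrite /rhs /tforc mulrDr; congr (_ + _).
  rewrite /lin kJ JN kJ omegaN mulrCA; congr (_ * _).
  rewrite /symm conjcM conj_expi opprK mulrDr mulrA -expiD; congr (_ + expi _ * _).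
  by ring.
rewrite /nonlin mulrCA; congr (_ * _).
rewrite /bil exchange_big /trunc_sqr mulr_sumr; apply: eq_big_seq => j jJ.
rewrite (eq_bigr (fun e : bool * bool => (csg e.1 a j) *
   (if k - j \in J then expi (- (t * omega R k)) * csg e.2 a (k - j) else 0))); last first.
  move=> [e1 e2] _ /=; rewrite !csg_twist // jJ; case: ifP => _; last by rewrite !mulr0.
  rewrite mulrACA [LHS]mulrA -!expiD [RHS]mulrCA; congr (expi _ * _).
  by rewrite /theta; ring.
rewrite sum_bool2 /= /symm; case: ifP => _; last by rewrite !mulr0 !addr0.
by ring.
Qed.

Lemma nc_symm a k : nc (symm a k) <= nc (a k) + nc (a (- k)).
Proof. by apply: le_trans (le_normcD _ _) _; rewrite nc_conj. Qed.

Variable s : R.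
Hypothesis Hs : 0 < s <= 2.

Lemma l2le_symm a A : l2le (fun k => wt s k * nc (a k)) A ->
  l2le (fun k => wt s k * nc (symm a k)) (2 * A).
Proof.
move=> aA; have aN := l2le_inj (@oppr_inj int) aA.
have -> : 2 * A = A + A by ring.
apply: (l2le_mono _ (l2leD aA aN)) => k /=.
have w0 := wt_gt0 Hs; have wk i : 0 <= wt s i :> R by exact: ltW.
rewrite !ger0_norm ?addr_ge0 ?mulr_ge0 ?nc_ge0 //.
by rewrite wtN -mulrDr ler_wpM2l // nc_symm.
Qed.

Lemma l2le_unwt a A : l2le (fun k => wt s k * nc (a k)) A -> l2le (fun k => nc (a k)) A.
Proof.
apply: l2le_mono => k; have w1 := wt_ge1 Hs k.
by rewrite normrM ler_peMl // ger0_norm // (le_trans ler01).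
Qed.

(** The threshold depends on [e] and not on the sequence, so the truncation of the forcing is
    accurate uniformly in time. *)
Lemma l2le_tail (e : R) : 0 < e -> exists L0, forall L a A, (L0 <= L)%N ->
  l2le (fun k => wt s k * nc (a k)) A ->
  l2le (fun k => if k \in ints L then 0 else nc (a k)) (e * A).
Proof.
move=> e0; have s0 : s != 0 by have /andP[h _] := Hs; rewrite gt_eqF.
(* Chosen so that [t^(s/2) = e]; beyond [|k| > 1 / t] one has [t k^2 >= 1] and [wt_high] applies. *)
pose t : R := e `^ (2 / s); have t0 : 0 < t by exact: powR_gt0.
have te : t `^ (s / 2) = e.
  rewrite -powRrM (_ : _ * _ = 1) ?powRr1 ?(ltW e0) //.
  by field.
exists (Num.truncn t^-1) => L a A LL aA.
have e0n : `|e| = e by rewrite gtr0_norm.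
apply: (l2le_mono _ (_ : l2le (fun k => e * (wt s k * nc (a k))) (e * A))).
  move=> k; rewrite mem_ints; case: leqP => [_|Lk]; first by rewrite normr0.
  have tk : 1 <= t * r k ^+ 2.
    have : t^-1 < r k ^+ 2.
      have h1 := truncnS_gt t^-1.
      apply: lt_le_trans h1 _; rewrite -(real_normK (num_real _)) -intr_norm.
      have h2 : (Num.truncn t^-1).+1%:R <= `|k|%:~R :> R.
        by rewrite -[X in X <= _]/((Posz _)%:~R : R) ler_int; lia.
      apply: le_trans h2 _; rewrite expr2 ler_peMl ?ler0z // ler1z; lia.
    by move=> /ltW; rewrite -[t^-1]mul1r ler_pdivrMr // mulrC.
  have wh := wt_high Hs t0 tk; rewrite te in wh.
  have n0 := nc_ge0 (a k).
  by rewrite mulrA !ger0_norm ?ler_peMl ?mulr_ge0 ?(ltW e0) ?(ltW (wt_gt0 Hs k)).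
by rewrite -{2}e0n; exact: l2leZ.
Qed.

(** The weight is submultiplicative up to a factor 2, so it can be distributed over the two factors
    before Cauchy-Schwarz. *)
Lemma trunc_sqr_le J a B k : uniq J -> l2le (fun j => wt s j * nc (a j)) B ->
  nc (trunc_sqr J a k) <= 2 * (B * B) / wt s k.
Proof.
move=> uJ aB; have w0 j := wt_gt0 Hs j.
rewrite ler_pdivlMr //; apply: le_trans (ler_wpM2r (ltW (w0 k)) (nc_sum _ _ _)) _.
have inj : injective (fun j => k - j) by move=> i j /addrI/oppr_inj.
have := l2le_cs aB (l2le_inj inj aB) uJ.
move/(ler_wpM2l (ler0n R 2)); apply: le_trans.
rewrite mulr_suml mulr_sumr; apply: ler_sum => j _.
have := wt_submul Hs k j.
rewrite Normc.normcM !ger0_norm ?mulr_ge0 ?nc_ge0 ?(ltW (w0 _)) //.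
case: ifP => _; last first.
  by rewrite nc0 mulr0 mul0r !mulr_ge0 ?nc_ge0 ?(ltW (w0 _)).
move=> wk; rewrite mulrC.
apply: le_trans (ler_wpM2r _ wk) _; first by rewrite mulr_ge0 ?nc_ge0.
by rewrite le_eqVlt; apply/orP; left; apply/eqP; ring.
Qed.

Section Snapshot.
Variables (v : R -> R[i]) (A : R).
Hypothesis sv : sq v.
Hypothesis vA : l2le (fun k => wt s k * nc (fourier v k)) A.
Let w x := v x + fconj v x.

Lemma sq_symm : sq w.
Proof. by apply: sqD => //; exact: sq_conj. Qed.

Lemma fourier_symm k : fourier w k = symm (fourier v) k.
Proof. by rewrite fourierD //; [rewrite fourier_conj|exact: sq_conj]. Qed.

Lemma forcingE k : forcing v k = - ('i / 2) * ((omega R k)^-1)%:C * symm (fourier v) k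
  + mult R k * fourier (fun x => w x ^+ 2) k.
Proof.
rewrite /forcing /bdx2_inv /dx2 -/w fourier_symm /mult.
have -> : (r k ^+ 2 / omega R k)%:C = k%:~R ^+ 2 * ((omega R k)^-1)%:C :> R[i].
  by rewrite rmorphM rmorphXn /= rmorph_int.
have -> : 'i / 2 = 2 * ('i / 4) :> R[i].
  have -> : 4 = 2 * 2 :> R[i] by ring.
  by field.
by ring.
Qed.

Lemma forcing_trunc (e : R) J k : 0 < e -> uniq J ->
  l2le (fun j => if j \in J then 0 else nc (symm (fourier v) j)) e ->
  nc (forcing v k - tforc J (fourier v) k) <= 2 * (2 * A + 1) * e.
Proof.
move=> e0 uJ we; have A0 := l2le_ge0 vA.
rewrite forcingE /tforc opprD addrACA subrr add0r -mulrBr Normc.normcM.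
have B0 : 0 < 2 * A + 1 by lra.
have wB : l2le (fun j => nc (symm (fourier v) j)) (2 * A + 1).
  by apply: l2le_weak (l2le_unwt (l2le_symm vA)); lra.
have := fourier_sqr k sq_symm uJ B0 e0.
have -> : fourier w = symm (fourier v) by apply/funext => j; exact: fourier_symm.
move=> /(_ wB we) h.
by apply: le_trans h; rewrite ler_piMl ?nc_ge0 // nc_mult.
Qed.

(** The origin of [Lam]: the linear part gives [A], and [trunc_sqr_le] applied to [symm], of norm at
    most [2 A], gives [2 (2 A)^2 = 8 A^2]. The bound holds for every truncation up to an error which
    is arbitrarily small. *)
Lemma forcing_le k : nc (forcing v k) <= (A + 8 * (A * A)) / wt s k.
Proof.
have w0 := wt_gt0 Hs k; have A0 := l2le_ge0 vA.
have wA := l2le_symm vA.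
apply/ler_addgt0Pr => e e0.
pose e' := e / (2 * (2 * A + 1)).
have e'0 : 0 < e' by rewrite divr_gt0 // mulr_gt0 //; lra.
pose e2 := e' / (2 * A + 1).
have e20 : 0 < e2 by rewrite divr_gt0 //; lra.
have [L0 /(_ L0 _ _ (leqnn _) wA) tl] := l2le_tail e20.
have tl' : l2le (fun j => if j \in ints L0 then 0 else nc (symm (fourier v) j)) e'.
  apply: l2le_weak tl; rewrite /e2 mulrAC ler_pdivrMr; last by lra.
  by rewrite ler_wpM2l ?(ltW e'0) //; lra.
have := forcing_trunc k e'0 (ints_uniq L0) tl'.
have -> : 2 * (2 * A + 1) * e' = e.
  by rewrite /e' mulrC divfK // gt_eqF // mulr_gt0 //; lra.
move=> h; have -> : forcing v k = tforc (ints L0) (fourier v) k +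
   (forcing v k - tforc (ints L0) (fourier v) k) by ring.
apply: le_trans (le_normcD _ _) _; apply: lerD h.
rewrite mulrDl; apply: le_trans (le_normcD _ _) _; apply: lerD.
  rewrite Normc.normcM Normc.normcM normcN Normc.normcM nc_i Normc.normcV nc_nat nc_real.
  have := l2le_sup k wA; rewrite ger0_norm ?mulr_ge0 ?nc_ge0 ?(ltW w0) //.
  rewrite mulrC -ler_pdivlMr // => h1.
  have o1 := omega_ge1 R k; have o0 := omega_gt0 R k.
  rewrite ger0_norm ?invr_ge0 ?(ltW o0) // mul1r.
  have o2 : (omega R k)^-1 <= 1 by rewrite invf_le1.
  have -> : A / wt s k = 2^-1 * 1 * (2 * A / wt s k) by field; rewrite gt_eqF.
  apply: ler_pM; rewrite ?nc_ge0 ?mulr_ge0 ?invr_ge0 ?(ltW o0) //.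
  by rewrite ler_wpM2l.
rewrite Normc.normcM.
apply: le_trans (ler_wpM2r (nc_ge0 _) (nc_mult R k)) _; rewrite mul1r.
apply: le_trans (trunc_sqr_le k (ints_uniq L0) wA) _.
by rewrite ler_wpM2r ?invr_ge0 ?(ltW w0) //; nra.
Qed.

End Snapshot.
End Forcing.

Section Norms.
Variable R : realType.
Implicit Types (a : int -> R[i]) (f : R -> R[i]) (k j : int) (M : R).
Local Notation r k := ((k : int)%:~R : R).
Local Notation mu := (@lebesgue_measure R).
Local Notation T := (torus R).

Lemma poweR_half_le (x : \bar R) M : (0 <= x)%E -> 0 <= M ->
  (x `^ 2^-1 <= M%:E)%E = (x <= (M ^+ 2)%:E)%E.
Proof.
move=> x0 M0; case: x x0 => [x|_|//]; last first.
  by rewrite poweRyr // invr_neq0.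
rewrite !lee_fin => x0; rewrite powR12_sqrt //.
by rewrite -[RHS](ler_sqrt _ (sqr_ge0 M)) sqrtr_sqr ger0_norm.
Qed.

Lemma esum_sqr_le (g : int -> R) M : l2le g M ->
  (\esum_(k in [set: int]) (g k ^+ 2)%:E <= (M ^+ 2)%:E)%E.
Proof.
move=> [M0 gM]; apply: ge_ereal_sup => _ [F [finF _] <-].
by rewrite fsbig_finite //= sumEFin lee_fin; apply: gM; exact: finmap.fset_uniq.
Qed.

Lemma l2le_esum (g : int -> R) M : 0 <= M ->
  (\esum_(k in [set: int]) (g k ^+ 2)%:E <= (M ^+ 2)%:E)%E -> l2le g M.
Proof.
move=> M0 gM; split=> // t ut; rewrite -lee_fin; apply: le_trans gM.
apply: esum_ge; exists [set` t]; first by split => //; apply/finite_seqP; exists t.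
by rewrite -fsbig_seq // sumEFin.
Qed.

Lemma esum_sqr_ge0 (g : int -> R) : (0 <= \esum_(k in [set: int]) (g k ^+ 2)%:E)%E.
Proof. by apply: esum_ge0 => k _; rewrite lee_fin sqr_ge0. Qed.

Lemma jap_sqr k : jap (r k) ^+ 2 = jsq R k.
Proof. by rewrite /jap sqr_sqrtr ?real_normK ?num_real // addr_ge0 ?sqr_ge0. Qed.

Lemma HnormE (p : R) a : (Hnorm p a =
  ((\esum_(k in [set: int]) ((jsq R k `^ (p / 2) * nc (a k)) ^+ 2)%:E) `^ 2^-1)%E)%E.
Proof.
rewrite /Hnorm; congr (_ `^ _)%E; apply: eq_esum => k _; congr EFin.
have j0 : 0 <= jap (r k) by exact: sqrtr_ge0.
rewrite exprMn; congr (_ * _); rewrite -jap_sqr -!powR_mulrn ?powR_ge0 // -!powRrM.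
by congr (_ `^ _); field.
Qed.

Lemma Hnorm_le (p : R) a M : l2le (fun k => jsq R k `^ (p / 2) * nc (a k)) M ->
  (Hnorm p a <= M%:E)%E.
Proof.
move=> aM; rewrite HnormE poweR_half_le ?(l2le_ge0 aM) ?esum_sqr_ge0 //.
exact: esum_sqr_le aM.
Qed.

Lemma l2le_Hnorm (p : R) a M : 0 <= M -> (Hnorm p a <= M%:E)%E ->
  l2le (fun k => jsq R k `^ (p / 2) * nc (a k)) M.
Proof.
move=> M0; rewrite HnormE poweR_half_le ?esum_sqr_ge0 // => aM.
exact: l2le_esum.
Qed.

Lemma Hnorm_lty (p : R) a : (Hnorm p a < +oo)%E ->
  l2le (fun k => jsq R k `^ (p / 2) * nc (a k)) (fine (Hnorm p a)).
Proof.
have h0 : (0 <= Hnorm p a)%E by exact: poweR_ge0.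
move=> hy; apply: l2le_Hnorm; first exact: fine_ge0.
by rewrite fineK // ge0_fin_numE.
Qed.

Lemma sq_L2 f : L2 f -> sq f.
Proof.
move=> [mf fy]; split => //; apply/integrableP; split.
  apply/measurable_EFinP; exact: measurable_nc2.
have /lty_poweRy : (2^-1 : R) != 0 by rewrite invr_neq0.
move=> /(_ _ fy); congr (_ < _)%E; apply: eq_integral => x _ /=.
by rewrite ger0_norm ?sqr_ge0.
Qed.

Lemma L2norm_le f M : 0 <= M -> sq f -> en f <= M ^+ 2 -> (L2norm f <= M%:E)%E.
Proof.
move=> M0 [mf If] fM; rewrite /L2norm poweR_half_le //; last first.
  by apply: integral_ge0 => x _; rewrite lee_fin sqr_ge0.
have fin := integrable_fin_num (@measurable_torus R) If.
by rewrite -(fineK fin) lee_fin.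
Qed.

End Norms.

(** * The solution in the interaction picture *)

(** Compactness of [[0, T]], for bounds expressed by a predicate monotone in the bound rather than
    by a numerical function. *)
Lemma near_segment_bounded (R : realType) (T : R) (N : R -> R -> Prop) :
  (forall t M M', M <= M' -> N t M -> N t M') ->
  (forall t0, 0 <= t0 <= T -> exists M, \forall t \near within `[0, T] (nbhs t0), N t M) ->
  exists M, forall t, 0 <= t <= T -> N t M.
Proof.
move=> Nmono Nloc.
have /compact_near_coveringP /(_ R (pinfty_nbhs R)
  (fun M t => `[0, T]%classic t -> N t M) _) := @segment_compact R 0 T.
case=> [t0|M [_ MN]].
  rewrite /= in_itv /= => /Nloc[M NM].
  near=> t M' => /= tT; apply: (Nmono t M); first by near: M'; apply: nbhs_pinfty_ge; exact: num_real.
  by move: tT; rewrite -/(`[0, T]%classic t); near: t.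
exists (M + 1) => t tT; apply: (MN (M + 1)); rewrite ?ltrDl //=; by rewrite in_itv.
Unshelve. all: by end_near. Qed.

Section Solution.
Variables (R : realType) (s T : R) (u : R -> R -> R[i]).
Hypothesis Hs : 0 < s <= 2.
Hypothesis uT : cont_in_H s T u.
Local Notation a t := (fourier (u t)).

Lemma sol_sq t : 0 <= t <= T -> sq (u t).
Proof. by move=> tT; apply: sq_L2; have [/(_ t tT)[]] := uT. Qed.

Lemma sol_near t0 e : 0 <= t0 <= T -> 0 < e -> \forall t \near within `[0, T] (nbhs t0),
  l2le (fun k => wt s k * nc (a t k - a t0 k)) e.
Proof.
move=> tT e0; have [_ /(_ t0 tT) cu] := uT.
have n0 : nbhs (0%E : \bar R) [set y | (y < e%:E)%E].
  by apply: open_nbhs_nbhs; split; [exact: open_ereal_lt_ereal|rewrite /= lte_fin].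
have h : \forall t \near within `[0, T] (nbhs t0),
    (Hnorm s (fun k => a t k - a t0 k)%R < e%:E)%E := cu _ n0.
by apply: filterS h => t /ltW h; exact: (l2le_Hnorm (ltW e0) h).
Qed.

Lemma sol_bounded : exists A, forall t, 0 <= t <= T ->
  l2le (fun k => wt s k * nc (a t k)) A.
Proof.
apply: near_segment_bounded => [t M M'|t0 t0T]; first exact: l2le_weak.
have [/(_ t0 t0T)[_ /Hnorm_lty a0] _] := uT.
exists (1 + fine (Hnorm s (a t0))); apply: filterS (sol_near t0T ltr01) => t tt0.
apply: (l2le_mono _ (l2leD tt0 a0)) => k.
have w0 := wt_gt0 Hs k; rewrite -/(wt s k) -mulrDr.
rewrite !ger0_norm ?mulr_ge0 ?addr_ge0 ?nc_ge0 ?(ltW w0) // ler_wpM2l ?(ltW w0) //.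
by rewrite -{1}(subrK (a t0 k) (a t k)) le_normcD.
Qed.

Lemma sol_continuous k t0 : 0 <= t0 <= T -> forall e, 0 < e ->
  \forall t \near within `[0, T] (nbhs t0), nc (a t0 k - a t k) <= e.
Proof.
move=> t0T e e0; apply: filterS (sol_near t0T e0) => t /l2le_unwt - /(_ Hs).
by move=> /(l2le_sup k); rewrite ger0_norm ?nc_ge0 // nc_distC.
Qed.

Lemma sol_measurable k : cmeasurable `[0, T] (fun t => a t k).
Proof.
have m : measurable (`[0, T]%classic : set (measurableTypeR R)) by exact: measurable_itv.
have ReB (z w : R[i]) : complex.Re z - complex.Re w = complex.Re (z - w).
  by case: z => ? ?; case: w.
have ImB (z w : R[i]) : complex.Im z - complex.Im w = complex.Im (z - w).
  by case: z => ? ?; case: w.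
have in0T t0 : `[0, T]%classic t0 -> 0 <= t0 <= T by rewrite /= in_itv.
split; apply: subspace_continuous_measurable_fun; [exact: m| |exact: m|];
  apply/subspace_continuousP => t0 /in0T t0T;
  apply/cvgrPdist_le => e e0; apply: filterS (sol_continuous k t0T e0) => t h;
  apply: le_trans h.
  by rewrite ReB normr_Re.
by rewrite ImB normr_Im.
Qed.

End Solution.

Section Intervals.
Variable R : realType.
Local Notation mu := (@lebesgue_measure R).
Local Notation Rint D F := (mu.-integrable D (EFin \o (F : R -> R))).

Lemma mu_segment (i : interval R) (t t' : R) : t <= t' ->
  i = `]t, t'] \/ i = `[t, t'] -> mu [set` i] = (t' - t)%:E.
Proof.
rewrite le_eqVlt => tt' iE; rewrite lebesgue_measure_itv.
have -> : (i.1 < i.2)%E = (t < t') by case: iE => -> /=; rewrite lte_fin.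
have -> : (i.2 - i.1)%E = (t' - t)%:E by case: iE => -> /=.
by move/orP: tt' => [/eqP ->|->] //; rewrite ltxx subrr.
Qed.

Lemma Rint_segment (t t' M : R) : t <= t' -> Rint `[t, t'] (fun=> M).
Proof.
move=> tt'; have fin : (mu `[t, t'] < +oo)%E.
  by rewrite (mu_segment tt') ?ltry //; right.
apply: measurable_bounded_integrable; first exact: measurable_itv.
- exact: fin.
- exact: measurable_cst.
- by exists `|M|; split; rewrite ?num_real // => y ay x _ /=; exact: ltW.
Qed.

Lemma cint_sub (D E : set R) (f : R -> R[i]) :
  @measurable _ (measurableTypeR R) E -> @measurable _ (measurableTypeR R) D ->
  D `<=` E -> cint E f -> cint D f.
Proof. by move=> mE mD DE [f1 f2]; split; [apply: integrableS f1|apply: integrableS f2]. Qed.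

Lemma cintegral_itvB (t t' T : R) (f : R -> R[i]) : 0 <= t -> t <= t' -> t' <= T ->
  cint `[0, T] f ->
  cintegral `[0, t'] f - cintegral `[0, t] f = cintegral `]t, t'] f.
Proof.
move=> t0 tt' t'T fT.
have [f1 f2] : cint `[0, t'] f.
  apply: cint_sub fT; [exact: measurable_itv|exact: measurable_itv|].
  by apply: subset_itvl; rewrite bnd_simp.
have h1 := Rintegral_itvB (x := t) f1; have h2 := Rintegral_itvB (x := t) f2.
rewrite !bnd_simp in h1 h2.
rewrite /cintegral -(h1 t0 tt') -(h2 t0 tt') //.
Qed.

(** The error of the rectangle rule. [Z = 0] gives the Lipschitz bound in time; [Z] equal to the
    truncated right-hand side at the left endpoint gives the consistency of the fine Euler
    scheme. *)
Lemma cintegral_le (t t' T M : R) (f : R -> R[i]) (Z : R[i]) : 0 <= t -> t <= t' -> t' <= T ->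
  cint `[0, T] f -> (forall r, t <= r <= t' -> nc (f r - Z) <= M) ->
  nc (cintegral `]t, t'] f - (t' - t)%:C * Z) <= M * (t' - t).
Proof.
move=> t0 tt' t'T fT fZ.
have m : @measurable _ (measurableTypeR R) `]t, t']%classic by exact: measurable_itv.
have mT : @measurable _ (measurableTypeR R) `[0, T]%classic by exact: measurable_itv.
have sub : `]t, t']%classic `<=` `[0, T]%classic.
  by apply: subset_itv; rewrite bnd_simp.
have T0 : 0 <= T by exact: le_trans (le_trans tt' t'T).
have cf : cint `]t, t'] f := cint_sub mT m sub fT.
have Ic (c : R) : Rint `]t, t'] (fun=> c) by exact: integrableS (Rint_segment c T0).
have Ip (c : R) : \int[mu]_(x in `]t, t']) c = c * (t' - t).
  rewrite Rintegral_cst; [congr (c * _)|exact: m].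
  exact: (congr1 fine (mu_segment tt' (or_introl erefl))).
have cZ : cint `]t, t'] (fun=> Z) by split; exact: Ic.
have ZE : cintegral `]t, t'] (fun=> Z) = (t' - t)%:C * Z.
  rewrite /cintegral !Ip; case: (Z) => x y; apply/eqP.
  by rewrite eq_complex /=; apply/andP; split; apply/eqP; ring.
rewrite -ZE -cintegralB // -Ip.
apply: nc_cintegral_le => [| | |r]; [exact: m|exact: cintB|exact: Ic|].
by rewrite /= in_itv /= => /andP[/ltW tr rt]; apply: fZ; rewrite tr.
Qed.

End Intervals.

Section Interaction.
Variables (R : realType) (s T A : R) (u0 : distr R) (u : R -> R -> R[i]).
Hypothesis Hs : 0 < s <= 2.
Hypothesis T0 : 0 <= T.
Hypothesis uT : cont_in_H s T u.
Hypothesis uA : forall t, 0 <= t <= T -> l2le (fun k => wt s k * nc (fourier (u t) k)) A.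
Hypothesis uD : duhamel T u0 u.
Local Notation a t := (fourier (u t)).
Local Notation mu := (@lebesgue_measure R).
Let mT : @measurable _ (measurableTypeR R) `[0, T]%classic.
Proof. exact: measurable_itv. Qed.

(* The coefficients of the solution in the interaction picture *)
Definition fint (t : R) (k : int) : R[i] := expi (- (t * omega R k)) * a t k.

Lemma tforc_cvg (e : R) : 0 < e -> exists L0, forall L t k, (L0 <= L)%N -> 0 <= t <= T ->
  nc (forcing (u t) k - tforc (ints L) (a t) k) <= e.
Proof.
move=> e0; have A0 : 0 <= A by have := uA; move/(_ 0); rewrite lexx T0 => /(_ isT)/l2le_ge0.
have B0 : 0 < 2 * A + 1 by lra.
pose e' := e / (2 * (2 * A + 1)).
have e'0 : 0 < e' by rewrite divr_gt0 // mulr_gt0.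
have [L0 tl] := l2le_tail Hs (divr_gt0 e'0 B0).
exists L0 => L t k L0L tT.
have wA := l2le_symm Hs (uA tT).
have tl' : l2le (fun j => if j \in ints L then 0 else nc (symm (a t) j)) e'.
  apply: l2le_weak (tl L _ _ L0L wA); rewrite mulrAC ler_pdivrMr //.
  by rewrite ler_wpM2l ?(ltW e'0) //; lra.
have := forcing_trunc Hs (sol_sq uT tT) (uA tT) k e'0 (ints_uniq L) tl'.
by rewrite /e' mulrC divfK // gt_eqF // mulr_gt0.
Qed.

(** The truncated forcings are polynomials in finitely many coefficients and their conjugates, which
    are continuous in time, and they converge pointwise in time. *)
Lemma forcing_measurable k : cmeasurable `[0, T] (fun t => forcing (u t) k).
Proof.
have ma := sol_measurable Hs uT.
have ms j : cmeasurable `[0, T] (fun t => symm (a t) j).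
  by apply: cmeasurableD => //; exact: cmeasurable_conj.
have mt L : cmeasurable `[0, T] (fun t => tforc (ints L) (a t) k).
  apply: cmeasurableD; first exact: cmeasurableZ.
  apply: cmeasurableZ; apply: cmeasurable_sum => j; apply: cmeasurableM => //.
  by case: (k - j \in _) => //; exact: cmeasurable_cst.
have cv (P : R[i] -> R) t : (forall z w, `|P z - P w| <= nc (z - w)) -> 0 <= t <= T ->
    P (tforc (ints L) (a t) k) @[L --> \oo] --> P (forcing (u t) k).
  move=> PL tT; apply/cvgrPdist_le => e e0; have [L0 H] := tforc_cvg e0.
  by exists L0 => // L /= L0L; apply: le_trans (PL _ _) _; exact: H.
have in0T t : `[0, T]%classic t -> 0 <= t <= T by rewrite /= in_itv.
split.
  apply: (@measurable_fun_cvg _ _ _ _ (fun L t => complex.Re (tforc (ints L) (a t) k))).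
    by move=> L; have [] := mt L.
  move=> t /in0T tT; apply: (cv (@complex.Re R)) => // z w.
  by have := normr_Re (z - w); case: z => ? ?; case: w.
apply: (@measurable_fun_cvg _ _ _ _ (fun L t => complex.Im (tforc (ints L) (a t) k))).
  by move=> L; have [] := mt L.
move=> t /in0T tT; apply: (cv (@complex.Im R)) => // z w.
by have := normr_Im (z - w); case: z => ? ?; case: w.
Qed.

Local Notation Lam := (A + 8 * (A * A)).
Local Notation G k := (fun r => expi (- (r * omega R k)) * forcing (u r) k).

Lemma G_cint k : cint `[0, T] (G k).
Proof.
apply: (cint_le _ _ (G := fun=> Lam / wt s k)); [exact: mT| | |exact: Rint_segment].
  apply: cmeasurableM; last exact: forcing_measurable.
  have -> : (fun r => expi (- (r * omega R k))) = (fun r => expi (- omega R k * r)).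
    by apply/funext => r; congr expi; ring.
  exact: cmeasurable_expi.
move=> r; rewrite /= in_itv /= => rT.
rewrite Normc.normcM nc_expi mul1r.
exact: (forcing_le Hs (sol_sq uT rT) (uA rT)).
Qed.

Lemma fintE t k : 0 <= t <= T -> fint t k = u0 k + cintegral `[0, t] (G k).
Proof.
move=> tT; have /andP[t0 tT'] := tT.
rewrite /fint (uD tT) mulrDr /propag mulrA expiNl mul1r; congr (_ + _).
have c0 : cint `[0, t] (G k).
  apply: cint_sub (G_cint k); [exact: mT|exact: measurable_itv|].
  by apply: subset_itvl; rewrite bnd_simp.
have -> : (fun r => expi ((t - r) * omega R k) * forcing (u r) k) =
   (fun r => expi (t * omega R k) * (G k r)).
  by apply/funext => r; rewrite mulrA -expiD; congr (expi _ * _); ring.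
rewrite cintegralZ; [|exact: measurable_itv|exact: c0].
by rewrite mulrA expiNl mul1r.
Qed.

Lemma fintB t t' k : 0 <= t -> t <= t' -> t' <= T ->
  fint t' k - fint t k = cintegral `]t, t'] (G k).
Proof.
move=> t0 tt' t'T; rewrite !fintE ?t0 ?(le_trans t0 tt') ?(le_trans tt' t'T) //.
by rewrite opprD addrACA subrr add0r (cintegral_itvB t0 tt' t'T (G_cint k)).
Qed.

Lemma fint_lip t t' k : 0 <= t -> t <= t' -> t' <= T ->
  nc (fint t' k - fint t k) <= (t' - t) * Lam / wt s k.
Proof.
move=> t0 tt' t'T; rewrite fintB //.
have := cintegral_le (M := Lam / wt s k) (Z := 0) t0 tt' t'T (G_cint k).
have -> : (t' - t) * Lam / wt s k = Lam / wt s k * (t' - t) by ring.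
rewrite mulr0 subr0; apply => r /andP[tr rt].
have rT : 0 <= r <= T by rewrite (le_trans t0 tr) (le_trans rt).
rewrite subr0 Normc.normcM nc_expi mul1r.
exact: (forcing_le Hs (sol_sq uT rT) (uA rT)).
Qed.

End Interaction.

(** * The algebra of bounded Lipschitz functions of time *)

Section LipschitzBounded.
Variables (R : realType) (T : R).
Hypothesis T0 : 0 <= T.
Implicit Types (f g : R -> R[i]).

(** The constant is existential because it depends on the truncation and serves only to choose the
    fine step; it never enters the final estimate. Boundedness is included to make the class stable
    under products. *)
Definition lipb f := exists M : R, forall r t, 0 <= r <= T -> 0 <= t <= T ->
  nc (f r) <= M /\ nc (f r - f t) <= M * `|r - t|.

Let zT : (0 : R) <= 0 <= T. Proof. by rewrite lexx. Qed.

Lemma lipb_eq f g : (forall t, 0 <= t <= T -> f t = g t) -> lipb f -> lipb g.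
Proof. by move=> fg [M fM]; exists M => r t rT tT; rewrite -!fg //; exact: fM. Qed.

Lemma lipb_cst c : lipb (fun=> c).
Proof.
exists (nc c) => r t _ _; split => //.
by rewrite subrr nc0 mulr_ge0 ?nc_ge0.
Qed.

Lemma lipbD f g : lipb f -> lipb g -> lipb (fun t => f t + g t).
Proof.
move=> [M fM] [N gN]; exists (M + N) => r t rT tT.
have [f1 f2] := fM r t rT tT; have [g1 g2] := gN r t rT tT; split.
  by apply: le_trans (le_normcD _ _) _; exact: lerD.
by rewrite opprD addrACA mulrDl; apply: le_trans (le_normcD _ _) _; exact: lerD.
Qed.

Lemma lipbM f g : lipb f -> lipb g -> lipb (fun t => f t * g t).
Proof.
move=> [M fM] [N gN]; exists (2 * (M * N)) => r t rT tT.
have [f1 f2] := fM r t rT tT; have [g1 g2] := gN r t rT tT.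
have [f3 _] := fM t t tT tT; have M0 := le_trans (nc_ge0 _) f1.
have N0 := le_trans (nc_ge0 _) g1.
have MN : 0 <= M * N by rewrite mulr_ge0.
split.
  rewrite Normc.normcM; apply: le_trans (ler_pM (nc_ge0 _) (nc_ge0 _) f1 g1) _; lra.
have -> : f r * g r - f t * g t = (f r - f t) * g r + f t * (g r - g t) by ring.
apply: le_trans (le_normcD _ _) _; rewrite !Normc.normcM.
have -> : 2 * (M * N) * `|r - t| = M * `|r - t| * N + M * (N * `|r - t|) by ring.
by apply: lerD; apply: ler_pM; rewrite ?nc_ge0.
Qed.

Lemma lipb_conj f : lipb f -> lipb (fun t => (f t)^*%C).
Proof.
by move=> [M fM]; exists M => r t rT tT; rewrite -rmorphB !nc_conj; exact: fM.
Qed.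

Lemma lipb_sum (I : Type) (J : seq I) (F : I -> R -> R[i]) :
  (forall i, lipb (F i)) -> lipb (fun t => \sum_(i <- J) F i t).
Proof.
move=> FL; elim: J => [|i J IH].
  by apply: lipb_eq (lipb_cst 0) => t _; rewrite big_nil.
by apply: lipb_eq (lipbD (FL i) IH) => t _; rewrite big_cons.
Qed.

Lemma lipb_expi (b : R) : lipb (fun t => expi (t * b)).
Proof.
exists (1 + `|b|) => r t _ _; rewrite nc_expi; split; first by rewrite lerDl.
have -> : expi (r * b) - expi (t * b) = expi (t * b) * (expi ((r - t) * b) - 1) :> R[i].
  by rewrite mulrBr -expiD mulr1; congr (expi _ - _); ring.
rewrite Normc.normcM nc_expi mul1r; apply: le_trans (nc_expi_sub1_le _) _.
by rewrite normrM mulrC ler_wpM2r // lerDr.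
Qed.

Lemma lipb_seq (I : eqType) (J : seq I) (F : I -> R -> R[i]) :
  (forall i, lipb (F i)) -> exists M : R, 0 <= M /\ forall i r t, i \in J ->
    0 <= r <= T -> 0 <= t <= T -> nc (F i r - F i t) <= M * `|r - t|.
Proof.
move=> FL; elim: J => [|i J [M [M0 IH]]]; first by exists 0.
have [N FN] := FL i.
have N0 : 0 <= N by have [h _] := FN 0 0 zT zT; exact: le_trans (nc_ge0 _) h.
exists (N + M); split=> [|j r t]; first by rewrite addr_ge0.
rewrite inE => /orP[/eqP ->|jJ] rT tT.
  by have [_ h] := FN r t rT tT; apply: le_trans h _; rewrite ler_wpM2r // lerDl.
by apply: le_trans (IH j r t jJ rT tT) _; rewrite ler_wpM2r // lerDr.
Qed.

Lemma lipb_csg e (F : int -> R -> R[i]) j : (forall i, lipb (F i)) ->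
  lipb (fun t => csg e (F^~ t) j).
Proof. by move=> FL; case: e => //=; exact: lipb_conj. Qed.

Lemma lipb_rhs J (F : int -> R -> R[i]) k : (forall i, lipb (F i)) ->
  lipb (fun t => rhs J t (F^~ t) k).
Proof.
move=> FL; apply: lipbD.
  apply: lipbM; first exact: lipb_cst.
  apply: lipbD => //; apply: lipbM; last exact: lipb_conj.
  by apply: lipb_eq (lipb_expi (- (2 * omega R k))) => t _; congr expi; ring.
apply: lipbM; first exact: lipb_cst.
apply: lipb_sum => -[e1 e2] /=; apply: lipb_sum => j.
apply: lipbM; last by apply: lipbM; exact: lipb_csg.
by apply: lipb_eq (lipb_expi (- theta R e1 e2 k j)) => t _; congr expi; ring.
Qed.

End LipschitzBounded.

Lemma l2le_support (R : realType) (I : eqType) (J : seq I) (f : I -> R) (e : R) :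
  uniq J -> (forall i, `|f i| <= e) -> (forall i, i \notin J -> f i = 0) ->
  l2le f ((size J)%:R * e).
Proof.
move=> uJ fe f0; case: J => [|i0 J] in uJ f0 *.
  rewrite mul0r; apply: (l2le_mono _ (l2le0 _ (lexx 0))) => i.
  by rewrite f0 // !normr0.
set K := i0 :: J in uJ f0 *.
have e0 : 0 <= e by exact: le_trans (normr_ge0 _) (fe i0).
split=> [|t ut]; first by rewrite mulr_ge0.
apply: (@le_trans _ _ (\sum_(i <- [seq i <- t | i \in K]) f i ^+ 2)).
  rewrite big_filter [X in X <= _](bigID (mem K)) /= [X in _ + X]big1 ?addr0 //.
  by move=> i /f0 ->; rewrite expr0n.
apply: (@le_trans _ _ (\sum_(i <- K) f i ^+ 2)).
  apply: ler_sum_subset => //; [exact: filter_uniq| |by move=> i; exact: sqr_ge0].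
  by move=> i; rewrite mem_filter => /andP[].
apply: (@le_trans _ _ (\sum_(i <- K) e ^+ 2)).
  apply: ler_sum => i _; rewrite -(real_normK (num_real _)).
  by rewrite ler_pXn2r ?nnegrE.
rewrite big_const_seq count_predT iter_addr_0 -[X in X <= _]mulr_natl exprMn ler_wpM2r ?sqr_ge0 //.
by rewrite expr2 ler_peMl // ler1n.
Qed.

(** * The sampled solution as a fine explicit Euler scheme *)

Section Bridge.
Variables (R : realType) (s T A : R) (u0 : distr R) (u : R -> R -> R[i]).
Hypothesis Hs : 0 < s <= 2.
Hypothesis T0 : 0 <= T.
Hypothesis uT : cont_in_H s T u.
Hypothesis uA : forall t, 0 <= t <= T -> l2le (fun k => wt s k * nc (fourier (u t) k)) A.
Hypothesis uD : duhamel T u0 u.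
Local Notation a t := (fourier (u t)).
Local Notation Lam := (A + 8 * (A * A)).
Local Notation r k := ((k : int)%:~R : R).

Let A0 : 0 <= A.
Proof. by have := @uA 0; rewrite lexx T0 => /(_ isT)/l2le_ge0. Qed.

Let Lam0 : 0 <= Lam. Proof. by rewrite addr_ge0 ?mulr_ge0. Qed.

Lemma nc_fint t k : nc (fint u t k) = nc (a t k).
Proof. by rewrite /fint (Normc.normcM (expi _)) nc_expi mul1r. Qed.

Lemma fint_lipb k : lipb T (fun t => fint u t k).
Proof.
have w1 := wt_ge1 Hs k; have w0 := wt_gt0 Hs k.
have wi : Lam / wt s k <= Lam by rewrite ler_pdivrMr // ler_peMr.
exists (A + Lam) => x y xT yT; split.
  have := l2le_sup k (l2le_unwt Hs (uA xT)); rewrite ger0_norm ?nc_ge0 //.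
  by rewrite nc_fint => h; apply: le_trans h _; rewrite lerDl.
wlog xy : x y xT yT / y <= x => [H|].
  case/orP: (le_total y x) => h; first exact: H.
  by rewrite nc_distC distrC; exact: H.
have /andP[y0 _] := yT; have /andP[_ xT'] := xT.
apply: le_trans (fint_lip Hs T0 uT uA uD k y0 xy xT') _.
rewrite ger0_norm ?subr_ge0 // -mulrA mulrC ler_wpM2r ?subr_ge0 //.
by apply: le_trans wi _; rewrite lerDr.
Qed.

Lemma fint0 k : fint u 0 k = u0 k.
Proof.
rewrite (fintE Hs T0 uT uA uD) ?lexx //.
by rewrite /cintegral set_itv1 !Rintegral_set1 addr0.
Qed.

Lemma low_ints (tau : R) k L : 0 < tau -> (Num.truncn tau^-1 <= L)%N -> low tau k -> k \in ints L.
Proof.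
move=> t0 tL; rewrite /low mem_ints -ler_pdivlMl // mulr1 => kt.
have [->//|k0] := eqVneq k 0; apply: leq_trans tL.
rewrite -ltnS -(ltr_nat R); apply: le_lt_trans (truncnS_gt tau^-1).
apply: le_trans kt; rewrite -(real_normK (num_real _)) -intr_norm.
have -> : `|k|%:~R = (`|k|%N)%:R :> R by rewrite -[RHS]/((Posz _)%:~R) abszE.
by rewrite expr2 ler_peMl // ler1n absz_gt0.
Qed.

(** For a given [tau] the choices depend on each other in this order: tolerance [eps], truncation
    [L], Lipschitz constant [M] of the truncated system, number [m] of substeps. None of them enters
    [C]. The recursion for [d] is assumed for every admissible [L] because [L] is only chosen in the
    proof. *)
Theorem scheme_coefficients : exists C : R, forall (tau : R) (n : nat) (d : nat -> int -> R[i]),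
  0 < tau -> tau <= 3^-1 -> n%:R * tau <= T ->
  (forall k, d 0%N k = cut tau u0 k) ->
  (forall L, (forall k, low tau k -> k \in ints L) -> forall i k,
     d i.+1 k = if low tau k then d i k + tau%:C * rhs (ints L) (i%:R * tau) (d i) k else 0) ->
  C * tau `^ (s / 2) <= 1 ->
  l2le (fun k => nc (cut tau (fint u (n%:R * tau)) k - d n k)) (C * tau `^ (s / 2)).
Proof.
have [C CP] := lie_trotter_coefficients A T Hs Lam0; exists C => tau n d t0 t3 nT d0 dS small.
set eta := tau `^ (s / 2) in small *; have eta0 : 0 < eta by exact: powR_gt0.
pose K := Num.truncn tau^-1.
have sz : 0 < (size (ints K))%:R :> R by rewrite ltr0n /ints size_map size_iota.
(* All low frequencies lie in [ints K], so a constant [eps] on them has [l2] norm at most [eta] by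
   the crude bound of [l2le_support]. *)
pose eps := eta / (size (ints K))%:R; have eps0 : 0 < eps by rewrite divr_gt0.
have epsE : l2le (fun k => if low tau k then eps else 0) eta.
  have -> : eta = (size (ints K))%:R * eps by rewrite /eps mulrC divfK ?gt_eqF.
  apply: l2le_support => [|k|k]; first exact: ints_uniq.
    by case: ifP => _; rewrite ?normr0 ?ger0_norm // ltW.
  by case: ifP => // /(low_ints t0 (leqnn _)) ->.
have [L0 L0P] := tforc_cvg Hs T0 uT uA (divr_gt0 eps0 (ltr0Sn _ 1)).
pose L := maxn L0 K; pose J := ints L.
have uJ : uniq J := ints_uniq L.
have JN i : (- i \in J) = (i \in J) by rewrite !mem_ints abszN.
have lowJ k : low tau k -> k \in J by apply: low_ints => //; exact: leq_maxr.
pose F j t := if j \in J then fint u t j else 0.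
have FL j : lipb T (F j).
  by rewrite /F; case: (j \in J); [exact: fint_lipb|exact: lipb_cst].
have [M [M0 MP]] := lipb_seq T0 J (fun k => lipb_rhs J k FL).
(* With [m >= X], the first term gives [h L^2 <= 1], so that all retained frequencies satisfy the
   phase restriction, and the second gives [M h <= eps / 2]. *)
pose X := tau * L%:R ^+ 2 + tau * M * 2 / eps.
have X1 : 0 <= tau * L%:R ^+ 2 by rewrite mulr_ge0 ?sqr_ge0 ?(ltW t0).
have X2 : 0 <= tau * M * 2 / eps by rewrite divr_ge0 ?(ltW eps0) // !mulr_ge0 // ltW.
pose m := (Num.truncn X).+1; pose h := tau / m%:R.
have m0 : 0 < m%:R :> R by rewrite ltr0n.
have Xm : X <= m%:R by apply: ltW; exact: truncnS_gt.
have h0 : 0 < h by rewrite divr_gt0.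
have tE : tau = m%:R * h by rewrite /h mulrC divfK ?gt_eqF.
have hL : h * L%:R ^+ 2 <= 1.
  by rewrite /h mulrAC ler_pdivrMr // mul1r; apply: le_trans Xm; rewrite lerDl.
have hM : M * h <= eps / 2.
  rewrite /h mulrA ler_pdivrMr // mulrC.
  have -> : tau * M = tau * M * 2 / eps * (eps / 2) by field; rewrite gt_eqF.
  rewrite [X in _ <= X]mulrC; apply: ler_wpM2r; first by rewrite divr_ge0 // ltW.
  by apply: le_trans Xm; rewrite lerDr.
(* Sampling stops at [T]: the bounds on [c] are required for all indices, the solution is given on
   [[0, T]] only. Consistency is asked before [T], where the minimum is [i h]. *)
pose ti (i : nat) := Num.min (i%:R * h) T.
have tiT i : 0 <= ti i <= T.
  by rewrite ge_min lexx orbT andbT le_min T0 mulr_ge0 ?(ltW h0).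
have tiS i : ti i <= ti i.+1 /\ ti i.+1 - ti i <= h.
  rewrite /ti -natr1 mulrDl mul1r /Order.min; case: ltP => h1; case: ltP => h2; split; lra.
pose c i j := F j (ti i).
have cA i : l2le (fun j => wt s j * nc (c i j)) A.
  apply: (l2le_mono _ (uA (tiT i))) => j; rewrite !normrM ler_wpM2l //.
  rewrite !ger0_norm ?nc_ge0 // /c /F; case: ifP => _; last by rewrite nc0 nc_ge0.
  by rewrite nc_fint.
have cL i j : nc (c i.+1 j - c i j) <= h * Lam / wt s j.
  have w0 := wt_gt0 Hs j; rewrite /c /F; case: ifP => _; last first.
    by rewrite subrr nc0; apply: divr_ge0 (ltW w0); exact: mulr_ge0 (ltW h0) Lam0.
  have [t1 t2] := tiS i; have /andP[p0 _] := tiT i; have /andP[_ p1] := tiT i.+1.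
  apply: le_trans (fint_lip Hs T0 uT uA uD j p0 t1 p1) _.
  by apply: ler_wpM2r; [rewrite invr_ge0 ltW|exact: ler_wpM2r].
have cJ i j : 1 < h * r j ^+ 2 -> c i j = 0.
  move=> hj; rewrite /c /F; case: ifP => //; rewrite mem_ints => jL.
  suff : h * r j ^+ 2 <= 1 by rewrite leNgt hj.
  apply: le_trans hL; rewrite ler_wpM2l ?(ltW h0) //.
  rewrite -(real_normK (num_real (r j))) -intr_norm.
  have -> : `|j|%:~R = (`|j|%N)%:R :> R by rewrite -[RHS]/((Posz _)%:~R) abszE.
  by rewrite ler_pXn2r ?nnegrE ?ler_nat.
have ti_le i : (i <= n * m)%N -> ti i = i%:R * h.
  move=> im; rewrite /ti min_l //; apply: le_trans nT; rewrite tE mulrA -natrM.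
  by rewrite ler_wpM2r ?(ltW h0) // ler_nat.
have d0' k : d 0%N k = cut tau (c 0%N) k.
  rewrite d0 /cut; case: ifP => // lk; rewrite /c /F lowJ // ti_le // mul0r.
  by rewrite fint0.
have cE i k : (i < n * m)%N -> low tau k ->
    nc (c i.+1 k - c i k - h%:C * rhs J (i%:R * h) (c i) k) <= h * eps.
  move=> im lk; have kJ := lowJ k lk.
  have tiE := ti_le i (ltnW im); have tjE := ti_le i.+1 im.
  have /andP[p0 _] := tiT i; have /andP[_ p1] := tiT i.+1; have [t1 _] := tiS i.
  have dt : ti i.+1 - ti i = h by rewrite tiE tjE -natr1; ring.
  have cF j : c j k = fint u (ti j) k by rewrite /c /F kJ.
  rewrite !cF -tiE -{1 2}dt [X in _ <= X]mulrC.
  rewrite (fintB Hs T0 uT uA uD k p0 t1 p1).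
  apply: (cintegral_le p0 t1 p1 (G_cint Hs T0 uT uA k)) => x xt.
  have xT : 0 <= x <= T by have /andP[x1 x2] := xt; rewrite (le_trans p0 x1) (le_trans x2 p1).
  have RE t : rhs J t (F^~ t) k = expi (- (t * omega R k)) * tforc J (a t) k.
    exact: rhs_forcing.
  have -> : eps = eps / 2 + eps / 2 by field.
  (* One half of [eps] pays for truncating the forcing at time [x], the other for freezing the
     truncated right-hand side at the start of the fine step. *)
  rewrite -(subrK (rhs J x (F^~ x) k) (expi _ * _)) -addrA.
  apply: le_trans (le_normcD _ _) _; apply: lerD.
    rewrite RE -mulrBr Normc.normcM nc_expi mul1r; apply: L0P => //; exact: leq_maxl.
  apply: le_trans (MP k x (ti i) kJ xT (tiT i)) _.
  apply: le_trans hM; rewrite ler_wpM2l //.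
  by have /andP[x1 x2] := xt; rewrite ger0_norm ?subr_ge0 // -dt lerB.
have NT : (n * m)%:R * h <= T by rewrite natrM -mulrA -tE.
have := CP tau h m n J c d eps n h0 t0 t3 tE uJ cA cL cJ d0' (dS L lowJ) cE epsE NT (leqnn n) small.
apply: l2le_mono => k; rewrite !ger0_norm ?nc_ge0 //.
rewrite /cut; case: ifP => // lk; rewrite /c /F lowJ // ti_le //.
by rewrite natrM -mulrA -tE.
Qed.

End Bridge.

(** * The numerical scheme in Fourier variables *)

Section Scheme.
Variables (R : realType) (tau : R) (L : nat).
Hypothesis t0 : 0 < tau.
Hypothesis low_J : forall k, low tau k -> k \in ints L.
Implicit Types (a b : int -> R[i]) (v : R -> R[i]) (k : int).
Local Notation r k := ((k : int)%:~R : R).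
Local Notation J := (ints L).

Lemma proj_cut b : proj tau b = cut tau b.
Proof.
apply/funext => k; rewrite /proj /cut /low powRN powR12_sqrt ?(ltW t0) //.
have q0 : 0 < Num.sqrt tau by rewrite sqrtr_gt0.
rewrite -[(Num.sqrt tau)^-1]mul1r ler_pdivlMr //; congr (if _ then _ else _).
rewrite -[LHS](@ler_pXn2r _ 2%N) ?nnegrE ?mulr_ge0 ?(ltW q0) //.
rewrite expr1n exprMn sqr_sqrtr ?(ltW t0) //.
by rewrite real_normK ?num_real // mulrC.
Qed.

(** A truncated sequence has finite support, so the sum defining [trigpoly] is the genuine one and
    not its default value 0. *)
Lemma trigpoly_cut a : trigpoly (cut tau a) = partial J (cut tau a).
Proof.
apply/funext => x; rewrite /trigpoly /partial (fsbig_seq _ _ (ints_uniq _)).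
apply/esym/fsbig_widen => // k [_ /= kJ]; rewrite /cut.
by case: ifP => [/low_J //|]; rewrite mul0r.
Qed.

Lemma sq_trigpoly_cut a : sq (trigpoly (cut tau a)).
Proof. by rewrite trigpoly_cut; exact: sq_partial. Qed.

Lemma fourier_trigpoly_cut a k : fourier (trigpoly (cut tau a)) k = cut tau a k.
Proof.
rewrite trigpoly_cut fourier_partial ?ints_uniq //; case: ifPn => // kJ.
by rewrite /cut; case: ifP => // /low_J; rewrite (negbTE kJ).
Qed.

(** For an iterate, whose frequencies are low, the truncated forcing is exact: [J] contains all
    frequencies of the trigonometric polynomial being squared. *)
Lemma fourier_Phi v k : sq v -> (forall k, fourier v k = cut tau (fourier v) k) ->
  fourier (Phi tau v) k =
  cut tau (fun k => expi (tau * omega R k) *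
    (fourier v k + tau%:C * tforc J (fourier v) k)) k.
Proof.
move=> sv vcut.
have sc : sq (fconj v) by exact: sq_conj.
have symE : fourier (fun x => v x + fconj v x) = symm (fourier v).
  by apply/funext => j; exact: fourier_symm.
rewrite /Phi proj_cut.
set X := (fun j => _ - _ - _).
have -> : propag tau (cut tau X) = cut tau (propag tau X).
  by apply/funext => j; rewrite /propag /cut; case: ifP => _; rewrite ?mulr0.
rewrite fourier_trigpoly_cut /cut; case: ifP => // lk.
rewrite /propag /X; congr (_ * _).
have cutE j : cut tau (fourier v) j + cut tau (fourier (fconj v)) j = symm (fourier v) j.
  rewrite /symm -(fourier_conj _ sv) /cut; case: ifP => // jl.
  rewrite vcut fourier_conj // vcut /cut jl lowN jl rmorph0.
  by [].
have -> : (fun x => (trigpoly (proj tau (fourier v)) x +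
     trigpoly (proj tau (fourier (fconj v))) x) ^+ 2) =
   (fun x => partial J (symm (fourier v)) x * partial J (symm (fourier v)) x).
  apply/funext => x; rewrite !proj_cut !trigpoly_cut expr2.
  suff -> : partial J (cut tau (fourier v)) x + partial J (cut tau (fourier (fconj v))) x =
    partial J (symm (fourier v)) x by [].
  rewrite /partial -big_split /=; apply: eq_bigr => j _.
  by rewrite -mulrDl cutE.
rewrite symE /bdx2_inv /dx2 fourier_partial_sqr ?ints_uniq // /tforc /mult.
rewrite -/(trunc_sqr J (symm (fourier v)) k).
have -> : (r k ^+ 2 / omega R k)%:C = k%:~R ^+ 2 * ((omega R k)^-1)%:C :> R[i].
  by rewrite rmorphM rmorphXn /= rmorph_int.
by ring.
Qed.

Variable u0 : distr R.

Definition scoef n k : R[i] :=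
  expi (- (n%:R * tau * omega R k)) * fourier (num_sol tau u0 n) k.

Lemma num_sol_cut n : exists a, num_sol tau u0 n = trigpoly (cut tau a).
Proof.
case: n => [|n]; first by exists u0; rewrite /num_sol /= proj_cut.
rewrite /num_sol iterS /Phi proj_cut; set X := (fun k => _ - _ - _).
exists (propag tau X); congr trigpoly.
by apply/funext => k; rewrite /propag /cut; case: ifP => _; rewrite ?mulr0.
Qed.

Lemma num_sol_sq n : sq (num_sol tau u0 n).
Proof. by have [a ->] := num_sol_cut n; exact: sq_trigpoly_cut. Qed.

Lemma num_sol_low n k :
  fourier (num_sol tau u0 n) k = cut tau (fourier (num_sol tau u0 n)) k.
Proof.
have [a ->] := num_sol_cut n; rewrite fourier_trigpoly_cut.
by rewrite /cut; case: ifP => // lk; rewrite fourier_trigpoly_cut /cut lk.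
Qed.

Lemma scoef0 k : scoef 0 k = cut tau u0 k.
Proof.
by rewrite /scoef !mul0r oppr0 expi0 mul1r /num_sol /= proj_cut fourier_trigpoly_cut.
Qed.

Lemma scoefS n k : scoef n.+1 k = if low tau k
  then scoef n k + tau%:C * rhs J (n%:R * tau) (scoef n) k else 0.
Proof.
have sN := num_sol_sq n; have lN := num_sol_low n.
have -> : scoef n = (fun j => if j \in J then
    expi (- (n%:R * tau * omega R j)) * fourier (num_sol tau u0 n) j else 0).
  apply/funext => j; rewrite /scoef; case: ifPn => // jJ.
  by rewrite lN /cut; case: ifP => [/low_J|]; rewrite ?(negbTE jJ) ?mulr0.
rewrite /scoef /num_sol iterS -/(num_sol tau u0 n) fourier_Phi // /cut.
case: ifP => lk; last by rewrite mulr0.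
rewrite rhs_forcing ?low_J //; last by move=> i; rewrite !mem_ints abszN.
rewrite mulrA -expiD -natr1.
have -> : - ((n%:R + 1) * tau * omega R k) + tau * omega R k = - (n%:R * tau * omega R k) by ring.
by ring.
Qed.

End Scheme.

(** * From errors on coefficients to errors on [z] and [z_t] *)

Lemma symm_l2le (R : realType) (a : int -> R[i]) E : l2le (fun k => nc (a k)) E ->
  l2le (fun k => nc (a k) + nc (a (- k))) (2 * E).
Proof.
move=> aE; have -> : 2 * E = E + E by ring.
exact: l2leD aE (l2le_inj (@oppr_inj int) aE).
Qed.

Lemma pi_bound (R : realType) : 2 * pi <= 3 ^+ 2 :> R.
Proof. have := @pihalf_lt2 R; lra. Qed.

(** The L2 norm is not normalized, so Parseval costs [sqrt (2 pi) <= 3]; taking the real part costs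
    nothing. *)
Lemma z_of_error (R : realType) (v w : R -> R[i]) E : sq v -> sq w ->
  l2le (fun k => nc (fourier v k - fourier w k)) E ->
  (L2norm (fun x => (z_of v x - z_of w x)%R) <= (3 * E)%:E)%E.
Proof.
move=> sv sw vwE; have E0 := l2le_ge0 vwE.
have se := sqB sv sw.
have sy : sq (fun x => (v x - w x) + fconj (fun x => v x - w x) x) by exact: sq_symm.
have -> : (fun x => (z_of v x - z_of w x)%R) =
   (fun x => 2^-1 * ((v x - w x) + fconj (fun x => v x - w x) x)).
  by apply/funext => x; rewrite /z_of /fconj rmorphB; ring.
apply: L2norm_le; [by rewrite mulr_ge0|exact: sqZ|].
apply: (@le_trans _ _ (2 * pi * E ^+ 2)); last first.
  by rewrite exprMn ler_wpM2r ?sqr_ge0 // pi_bound.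
apply: parseval_le; first exact: sqZ.
have -> : E = `|2^-1| * (2 * E) by rewrite ger0_norm // mulrA mulVf ?mul1r.
apply: (l2le_mono _ (l2leZ 2^-1 (symm_l2le vwE))) => k.
have p : 0 <= 2^-1 * (nc (fourier v k - fourier w k) +
    nc (fourier v (- k) - fourier w (- k))) :> R.
  by rewrite mulr_ge0 ?addr_ge0 ?nc_ge0.
rewrite (ger0_norm p) ger0_norm ?nc_ge0 // fourierZ // fourier_symm //.
rewrite (Normc.normcM 2^-1) Normc.normcV nc_nat ler_wpM2l //.
by apply: le_trans (nc_symm _ _) _; rewrite !fourierB.
Qed.

(** The weight [<k>^-2] compensates the multiplier, as [omega k <= 1 + k^2]. *)
Lemma zt_of_error (R : realType) (v w : R -> R[i]) E : sq v -> sq w ->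
  l2le (fun k => nc (fourier v k - fourier w k)) E ->
  (Hnorm (- 2) (fun k => (zt_of v k - zt_of w k)%R) <= E%:E)%E.
Proof.
move=> sv sw vwE; apply: Hnorm_le.
have -> : E = `|2^-1| * (2 * E) by rewrite ger0_norm // mulrA mulVf ?mul1r.
apply: (l2le_mono _ (l2leZ 2^-1 (symm_l2le vwE))) => k.
have p : 0 <= 2^-1 * (nc (fourier v k - fourier w k) +
    nc (fourier v (- k) - fourier w (- k))) :> R.
  by rewrite mulr_ge0 ?addr_ge0 ?nc_ge0.
have j1 := jsq_ge1 R k; have j0 : 0 < jsq R k by exact: lt_le_trans ltr01 j1.
have -> : (-2 / 2 : R) = -1 by rewrite mulNr divff.
rewrite powRN powRr1 ?(ltW j0) // (ger0_norm p).
rewrite ger0_norm; last by rewrite mulr_ge0 ?nc_ge0 // invr_ge0 ltW.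
have -> : zt_of v k - zt_of w k = ('i / 2) * ((omega R k)%:C *
    ((fourier v k - fourier w k) - (fourier v (- k) - fourier w (- k))^*%C)).
  have fc f j : sq f -> fourier (fconj f) j = (fourier f (- j))^*%C.
    exact: fourier_conj.
  have sc f : sq f -> sq (fconj f) by exact: sq_conj.
  rewrite /zt_of /bdx2 (fourierB _ sv (sc _ _ sv)) (fourierB _ sw (sc _ _ sw)) !fc // rmorphB.
  by ring.
rewrite !(Normc.normcM ('i / 2)) (Normc.normcM 'i) nc_i Normc.normcV nc_nat mul1r.
rewrite mulrCA ler_wpM2l // (Normc.normcM (omega R k)%:C) nc_real mulrA.
rewrite -[X in _ <= X]mul1r; apply: ler_pM; rewrite ?nc_ge0 ?mulr_ge0 ?invr_ge0 ?(ltW j0) //.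
  rewrite ger0_norm ?(ltW (omega_gt0 R k)) // mulrC ler_pdivrMr // mul1r.
  by rewrite /jsq addrC omega_le.
by apply: le_trans (nc_sub _ _) _; rewrite nc_conj.
Qed.

Theorem theorem1p1 (R : realType) (s : R) (phi0 : R -> R) (psi0 : distr R)
  (hs : 0 < s <= 2)
  (hphi0 : fun_in_H s (fun x => (phi0 x)%:C))
  (hpsi0 : in_H (s - 2) psi0)
  (hpsi0_real : real_distr psi0)
  (T : R) (hT0 : 0 < T) (hT : (T%:E < max_time s (u_init phi0 psi0))%E)
  (b : R) (hb : 2^-1 < b < 1)
  (z : R -> R -> R[i]) (zt : R -> distr R)
  (hz : gB_solution s b T phi0 psi0 z zt) :
  exists tau0 CT : R, [/\ 0 < tau0, 0 < CT &
    forall (tau : R) (n : nat), 0 < tau <= tau0 ->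
      0 < n%:R * tau <= T ->
      let un := num_sol tau (u_init phi0 psi0) n in
      (L2norm (fun x => (z (n%:R * tau) x - z_of un x)%R)
       + Hnorm (- 2) (fun k => (zt (n%:R * tau) k - zt_of un k)%R)
       <= (CT * tau `^ (s / 2))%:E)%E].
Proof.
have [u [[[uT _] uD] zu]] := hz; have T0 := ltW hT0.
have /andP[s0 _] := hs.
have [A uA] := sol_bounded hs uT.
have A0 : 0 <= A by have := @uA 0; rewrite lexx T0 => /(_ isT)/l2le_ge0.
have [C HC] := scheme_coefficients hs T0 uT uA uD.
pose C' := `|C| + 1; have C'0 : 0 < C' by rewrite ltr_wpDl.
have CC' : C <= C' by apply: le_trans (ler_norm C) _; rewrite lerDl.
have c0 : 0 < C'^-1 by rewrite invr_gt0.
(* The bound [3^-1] is the phase restriction, and the other one gives [C' tau^(s/2) <= 1], the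
   smallness required by the bootstrap. In the constant, [4 = 3 + 1] for the norms of [z] and [z_t],
   and [A] accounts for the frequencies of the solution removed by the filter. *)
exists (Num.min 3^-1 (C'^-1 `^ (2 / s))), (4 * (C' + A)); split.
- by rewrite lt_min invr_gt0 ltr0n powR_gt0.
- by rewrite mulr_gt0 // ltr_wpDr.
move=> tau n /andP[t0 tmin] /andP[nt0 ntT]; cbv zeta.
set un := num_sol tau (u_init phi0 psi0) n.
have /andP[t3 tC] : (tau <= 3^-1) && (tau <= C'^-1 `^ (2 / s)) by move: tmin; rewrite le_min.
set eta := tau `^ (s / 2).
have eta0 : 0 < eta by exact: powR_gt0.
have small' : C' * eta <= 1.
  rewrite mulrC -ler_pdivlMr // mul1r.
  have -> : C'^-1 = (C'^-1 `^ (2 / s)) `^ (s / 2).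
    rewrite -powRrM (_ : _ * _ = 1) ?powRr1 ?(ltW c0) //.
    by field; rewrite gt_eqF.
  by apply: ge0_ler_powR; rewrite ?nnegrE ?powR_ge0 ?(ltW t0) ?divr_ge0 ?(ltW s0).
have small : C * eta <= 1 by apply: le_trans small'; rewrite ler_wpM2r // ltW.
have nT : 0 <= n%:R * tau <= T by rewrite (ltW nt0).
have := HC tau n (scoef tau (u_init phi0 psi0)) t0 t3 ntT
  (scoef0 t0 (fun k => low_ints t0 (leqnn _)) _)
  (fun L lowL i k => scoefS t0 lowL (u_init phi0 psi0) i k) small.
move=> err.
have sv := sol_sq uT nT; have sw := num_sol_sq t0 (fun k => low_ints t0 (leqnn _)) (u_init phi0 psi0) n.
have E : l2le (fun k => nc (fourier (u (n%:R * tau)) k - fourier un k)) ((C' + A) * eta).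
  have hi := l2leZ eta (uA _ nT).
  apply: (l2le_weak (_ : C * eta + `|eta| * A <= _)).
    rewrite ger0_norm ?(ltW eta0) // mulrDl [A * _]mulrC lerD2r ler_wpM2r //.
    exact: ltW.
  apply: (l2le_mono _ (l2leD err hi)) => k.
  rewrite !ger0_norm ?addr_ge0 ?mulr_ge0 ?nc_ge0 ?(ltW eta0) ?(ltW (wt_gt0 hs k)) //.
  have -> : nc (fourier (u (n%:R * tau)) k - fourier un k) =
      nc (fint u (n%:R * tau) k - scoef tau (u_init phi0 psi0) n k).
    by rewrite /fint /scoef -(mulrBr (expi _)) (Normc.normcM (expi _)) nc_expi mul1r.
  rewrite -(nc_fint u).
  set F := fint u _; set dk := scoef _ _ _ _.
  (* The coefficient estimate covers the low frequencies; the high part of the solution is of size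
     [eta A] by its Sobolev regularity alone. *)
  have -> : F k - dk = (cut tau F k - dk) + high tau F k by rewrite /high; ring.
  by apply: le_trans (le_normcD _ _) _; apply: lerD => //; exact: nc_high.
have -> : (4 * (C' + A) * eta)%:E = ((3 * ((C' + A) * eta))%:E + ((C' + A) * eta)%:E)%E.
  by rewrite -EFinD; congr EFin; ring.
have [-> ->] := zu _ nT.
by apply: leeD; [exact: z_of_error|exact: zt_of_error].
Qed.
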